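(* Let $d_1,d_2\ge 1$, $m\ge 4$, let $f_k:(\mathbb R^{d_k})^m\to[0,\infty)$, $k=1,2$, be kernel functions of order $m$, and let $J_1,J_2$ be weakly regular score functions. Assume that, for $k=1,2$, $f_k$ is uniformly bounded and almost everywhere continuous. Then, under the hypothesis $H_0$ that $\mathbf X_1\sim P_{\mathbf X_1}\in\mathcal P_{d_1}^{ac}$ and $\mathbf X_2\sim P_{\mathbf X_2}\in\mathcal P_{d_2}^{ac}$ are independent, the rank-based statistic $\widetilde W^{(n)}_\mu$ associated with $\mu=\mu_{f_1,f_2,H_*^m}$ and its oracle version $W^{(n)}_\mu$ satisfy $$\widetilde W^{(n)}_\mu-W^{(n)}_\mu=o_{P}(n^{-1})\quad\text{as } n_R,n_S\to\infty .$$
   Context: **Generalized symmetric covariances.** For $m\ge4$, $H_*^m=\{(1),(1\,4),(2\,3),(1\,4)(2\,3)\}\subset\mathfrak S_m$ is the subgroup of the symmetric group generated by the transpositions $(1\,4)$ and $(2\,3)$. For $H=H_*^m$ and kernels $f_k:(\mathbb R^{d_k})^m\to[0,\infty)$, put $f_{k,H}(\mathbf x_{k1},\dots,\mathbf x_{km})=\sum_{\sigma\in H}\mathrm{sgn}(\sigma)f_k(\mathbf x_{k\sigma(1)},\dots,\mathbf x_{k\sigma(m)})$ and $k_{f_1,f_2,H}((\mathbf x_{11},\mathbf x_{21}),\dots,(\mathbf x_{1m},\mathbf x_{2m}))=f_{1,H}(\mathbf x_{11},\dots,\mathbf x_{1m})\,f_{2,H}(\mathbf x_{21},\dots,\mathbf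 x_{2m})$. The generalized symmetric covariance (GSC) is $\mu_{f_1,f_2,H}(\mathbf X_1,\mathbf X_2)=\mathrm E[k_{f_1,f_2,H}((\mathbf X_{11},\mathbf X_{21}),\dots,(\mathbf X_{1m},\mathbf X_{2m}))]$ with $(\mathbf X_{1i},\mathbf X_{2i})$ i.i.d. copies of $(\mathbf X_1,\mathbf X_2)$. Its sample version is $\hat\mu^{(n)}([(\mathbf x_{1i},\mathbf x_{2i})]_{i=1}^n;f_1,f_2,H)=\binom nm^{-1}\sum_{i_1<\dots<i_m}\overline k_{f_1,f_2,H}((\mathbf x_{1i_1},\mathbf x_{2i_1}),\dots,(\mathbf x_{1i_m},\mathbf x_{2i_m}))$, where $\overline k$ is the average of $k$ over all $m!$ permutations of its $m$ arguments. **Center-outward distribution functions.** $\mathcal P_d^{ac}$ is the set of probability measures on $\mathbb R^d$ absolutely continuous w.r.t. Lebesgue measure. $\mathbb S_d$ is the open unit ball and $\mathcal S_{d-1}$ the unit sphere of $\mathbb R^d$. $\mathrm U_d$ is the spherical uniform law on $\mathbb S_d$: the law of $RS$ with $R$ uniform on $[0,1)$ and $S$ uniform on $\mathcal S_{d-1}$, independent. For $P\in\mathcal P_d^{ac}$ the center-outward distribution function $\mathbf F_\pm$ is the $P$-a.s. unique map $\mathbb R^d\to\mathbb S_d$ that is the gradient of a convex function and pushes $P$ forward to $\mathrm U_d$. **Grid and sample version.** For $d\ge2$ write $n=n_Rn_S+n_0$ with $n_R,n_S\ge1$, $0\le n_0<\min\{n_R,n_S\}$. Let $\mathbf s^{(n_S)}_1,\dots,\mathbf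 s^{(n_S)}_{n_S}$ be distinct unit vectors (dividing the circle into equal arcs if $d=2$) whose empirical distribution converges weakly to the uniform law on $\mathcal S_{d-1}$ as $n_S\to\infty$. The grid $\mathfrak G^d_{\mathbf n}$ consists of the $n_Rn_S$ points $\frac r{n_R+1}\mathbf s_s^{(n_S)}$, $1\le r\le n_R$, $1\le s\le n_S$, plus, if $n_0\ge1$, the $n_0$ points $\frac1{2(n_R+1)}\mathbf s_s^{(n_S)}$, $s\in\mathcal S$, with $\mathcal S$ a random sample of size $n_0$ without replacement from $\{1,\dots,n_S\}$ (independent of the observations). For $d=1$: $n_S=2$, $n_R=\lfloor n/2\rfloor$, $n_0=n-2n_R$, and the grid is $\{\pm r/(n_R+1):1\le r\le n_R\}$ together with $0$ if $n_0=1$. Asymptotics are for $n\to\infty$ with $n_R,n_S\to\infty$ (for $d=1$, $n_R\to\infty$). Given distinct points $\mathbf z_1,\dots,\mathbf z_n$, $\mathbf F^{(n)}_\pm$ is the bijection $T$ from $\{\mathbf z_i\}$ onto $\mathfrak G^d_{\mathbf n}$ minimizing $\sum_i\|\mathbf z_i-T(\mathbf z_i)\|^2$. **Scores and statistics.** A score function $J:[0,1)\to[0,\infty)$ is weakly regular if it is continuous and $\int_0^1J^2(u)\,du>0$. For $k=1,2$, $\mathbf J_k(\mathbf u)=J_k(\|\mathbf u\|)\mathbf u/\|\mathbf u\|$ for $\mathbf u\in\mathbb S_{d_k}\setminus\{\mathbf 0\}$ and $\mathbf J_k(\mathbf 0)=\mathbf 0$. Let $(\mathbf X_{1i},\mathbf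 X_{2i})$, $i=1,\dots,n$, be i.i.d. copies of $(\mathbf X_1,\mathbf X_2)$; $\mathbf F_{k,\pm}$ is the center-outward distribution function of $\mathbf X_k$, $\mathbf F_{k,\pm}^{(n)}$ the sample version from $\{\mathbf X_{ki}\}_{i=1}^n$; $\mathbf G_{k,\pm}=\mathbf J_k\circ\mathbf F_{k,\pm}$, $\mathbf G^{(n)}_{k,\pm}=\mathbf J_k\circ\mathbf F^{(n)}_{k,\pm}$. The rank-based statistic and its oracle version are $\widetilde W^{(n)}_\mu=\hat\mu^{(n)}([(\mathbf G^{(n)}_{1,\pm}(\mathbf X_{1i}),\mathbf G^{(n)}_{2,\pm}(\mathbf X_{2i}))]_{i=1}^n;f_1,f_2,H_*^m)$ and $W^{(n)}_\mu=\hat\mu^{(n)}([(\mathbf G_{1,\pm}(\mathbf X_{1i}),\mathbf G_{2,\pm}(\mathbf X_{2i}))]_{i=1}^n;f_1,f_2,H_*^m)$.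
   Formalization: ''Almost everywhere continuous'' is taken with respect to the law of the m i.i.d. arguments G_k(X_k1),…,G_k(X_km) of f_k, not Lebesgue measure; with Lebesgue measure the claim fails for constant scores such as J_k = 1. *)

(* Defs.v *)
From HB Require Import structures.
From mathcomp Require Import all_boot all_order all_algebra all_fingroup finmap.
From mathcomp Require Import all_classical all_reals all_analysis.

Set Implicit Arguments.
Unset Strict Implicit.
Unset Printing Implicit Defensive.

Import Order.TTheory GRing.Theory Num.Theory numFieldNormedType.Exports.

Local Open Scope classical_set_scope.
Local Open Scope ring_scope.

(* Points of R^d are row vectors; an m-tuple of points of R^d is a matrix of   *)
(* type 'M_(m, d) whose rows are the points. The library norm on matrices is   *)
(* the sup norm: it induces the usual topology and Borel sets, but [enorm]     *)
(* below is the Euclidean norm.                                                *)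

HB.instance Definition _ (R : realType) (m n : nat) :=
  @isMeasurable.Build (sigma_display (@open 'M[R]_(m, n))) 'M[R]_(m, n)
    <<s @open 'M[R]_(m, n) >> (@sigma_algebra0 _ setT _)
    (@sigma_algebraC 'M[R]_(m, n) _) (@sigma_algebra_bigcup _ setT _).

Section euclidean.
Context {R : realType} {d : nat}.
Implicit Types x y : 'rV[R]_d.

Definition dotp x y : R := \sum_(i < d) x 0 i * y 0 i.

Definition enorm x : R := Num.sqrt (dotp x x).

Definition box (a b : 'rV[R]_d) : set 'rV[R]_d :=
  [set x | forall i, a 0 i <= x 0 i <= b 0 i].

Definition box_volume (a b : 'rV[R]_d) : R := \prod_(i < d) (b 0 i - a 0 i).

(* The Lebesgue measure of a Borel set is the value of this outer measure. *)
Definition lebesgue_outer (A : set 'rV[R]_d) : \bar R :=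
  ereal_inf [set v | exists a b : nat -> 'rV[R]_d,
    [/\ forall k i, a k 0 i <= b k 0 i,
        A `<=` \bigcup_k box (a k) (b k) &
        v = (\sum_(0 <= k <oo) (box_volume (a k) (b k))%:E)%E]].

Definition abs_continuous (mu : probability 'rV[R]_d R) : Prop :=
  forall A, measurable A -> lebesgue_outer A = 0%E -> mu A = 0%E.

(* The uniform law on the unit sphere is the rotation-invariant probability   *)
(* carried by the sphere.                                                     *)
Definition sphere_uniform (sigma : probability 'rV[R]_d R) : Prop :=
  sigma [set x | enorm x = 1] = 1%E /\
  forall Q : 'M[R]_d, Q *m Q^T = 1%:M ->
    forall B, measurable B -> sigma ((mulmx^~ Q) @^-1` B) = sigma B.

(* U_d: the law of r *: s with r uniform on the unit interval and s of law    *)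
(* sigma, r and s independent.                                                *)
Definition ball_uniform (sigma : probability 'rV[R]_d R)
    (B : set 'rV[R]_d) : \bar R :=
  (uniform_prob (@ltr01 R) \x sigma)%E [set z | B (z.1 *: z.2)].

(* A finite convex function need not be differentiable everywhere: F is only  *)
(* determined mu-almost everywhere.                                           *)
Definition center_outward (mu sigma : probability 'rV[R]_d R)
    (F : 'rV[R]_d -> 'rV[R]_d) : Prop :=
  [/\ measurable_fun setT F,
      forall x, enorm (F x) < 1,
      exists phi : 'rV[R]_d -> R,
        convex_function setT phi /\
        {ae mu, forall x, is_diff x phi (dotp (F x))} &
      forall B, measurable B -> mu (F @^-1` B) = ball_uniform sigma B].

Definition empirical_center_outward n (z : 'I_n -> 'rV[R]_d)
    (G : set 'rV[R]_d) (T : 'rV[R]_d -> 'rV[R]_d) : Prop :=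
  set_bij (range z) G T /\
  forall T', set_bij (range z) G T' ->
    \sum_(i < n) enorm (z i - T (z i)) ^+ 2 <=
    \sum_(i < n) enorm (z i - T' (z i)) ^+ 2.

Definition weakly_regular (J : R -> R) : Prop :=
  [/\ forall u, u \in `[0, 1[ -> 0 <= J u,
      {within [set` `[0, 1[], continuous J} &
      (0 < \int[lebesgue_measure]_(u in [set` `[0%R, 1%R[]) (J u ^+ 2)%:E)%E].

Definition score (J : R -> R) (u : 'rV[R]_d) : 'rV[R]_d :=
  if u == 0 then 0 else (J (enorm u) / enorm u) *: u.

End euclidean.

Section grids.
Context {R : realType} (d : nat).

Definition line_grid (n : nat) : set 'rV[R]_d :=
  [set x | (odd n /\ x = 0) \/
    exists2 r : nat, (1 <= r <= n./2)%N &
      x = const_mx (r%:R / (n./2).+1%:R) \/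
      x = const_mx (- (r%:R / (n./2).+1%:R))].

Definition sphere_grid (nR nS : nat) (s : 'I_nS -> 'rV[R]_d)
    (S : {set 'I_nS}) : set 'rV[R]_d :=
  [set x | (exists r j, (1 <= r <= nR)%N /\ x = (r%:R / nR.+1%:R) *: s j) \/
    (exists2 j, j \in S & x = (2 * nR.+1%:R)^-1 *: s j)].

Definition sphere_directions (sigma : probability 'rV[R]_d R)
    (s : forall N, 'I_N -> 'rV[R]_d) : Prop :=
  [/\ forall N i, enorm (s N i) = 1,
      forall N, injective (s N),
      d = 2%N -> forall N, exists theta : R,
        range (s N) = [set x | exists j : 'I_N,
          let t := theta + 2 * pi * j%:R / N%:R in
          forall i : 'I_d, x 0 i = if i == 0%N :> nat then cos t else sin t] &
      forall g : 'rV[R]_d -> R, continuous g ->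
        (exists M : R, forall x, `|g x| <= M) ->
        N%:R^-1 * (\sum_(i < N) g (s N i)) @[N --> \oo] -->
          (\int[sigma]_x g x)%R].

Context {dO} {Omega : measurableType dO} (P : probability Omega R).

Definition sample_without_replacement (N k : nat)
    (S : Omega -> {set 'I_N}) : Prop :=
  (forall w, #|S w| = k) /\
  forall A : {set 'I_N}, measurable [set w | S w = A] /\
    (#|A| = k -> P [set w | S w = A] = ('C(N, k)%:R^-1)%:E).

(* [G n w] is the grid of n points used for the sample of size n. *)
Definition grid_sequence (sigma : probability 'rV[R]_d R)
    (G : nat -> Omega -> set 'rV[R]_d) : Prop :=
  if d == 1%N then forall n w, G n w = line_grid n
  else exists (nR nS n0 : nat -> nat) (s : forall N, 'I_N -> 'rV[R]_d)
      (S : forall n, Omega -> {set 'I_(nS n)}),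
    [/\ forall n, (0 < n)%N ->
          [/\ n = (nR n * nS n + n0 n)%N, (0 < nR n)%N, (0 < nS n)%N &
              (n0 n < minn (nR n) (nS n))%N],
        nR n @[n --> \oo] --> \oo /\ nS n @[n --> \oo] --> \oo,
        sphere_directions sigma s,
        forall n, sample_without_replacement (n0 n) (S n) &
        forall n w, G n w = sphere_grid (nR n) (@s (nS n)) (S n w)].

End grids.

Section probability_notions.
Context {R : realType} {dO} {Omega : measurableType dO}.
Variable P : probability Omega R.
Local Open Scope ereal_scope.

Definition independent2 {d1 d2} {T1 : measurableType d1}
    {T2 : measurableType d2} (X : Omega -> T1) (Y : Omega -> T2) : Prop :=
  forall A B, measurable A -> measurable B ->
    P (X @^-1` A `&` Y @^-1` B) = P (X @^-1` A) * P (Y @^-1` B).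

Definition mutually_independent {dT} {T : measurableType dT}
    (Z : nat -> Omega -> T) : Prop :=
  forall (I : {fset nat}) (A : nat -> set T), (forall i, measurable (A i)) ->
    P (\bigcap_(i in [set` I]) Z i @^-1` A i) =
    \prod_(i <- enum_fset I) P (Z i @^-1` A i).

Definition iid_copies {dT} {T : measurableType dT}
    (Z : nat -> Omega -> T) (X : Omega -> T) : Prop :=
  mutually_independent Z /\
  forall i A, measurable A -> P (Z i @^-1` A) = P (X @^-1` A).

Definition generated_events {dT} {T : measurableType dT}
    (Z : nat -> Omega -> T) : set (set Omega) :=
  <<s \bigcup_i preimage_set_system setT (Z i) measurable >>.

(* Since the random grids take finitely many values, joint independence of    *)
(* the pair of grids from the observations is tested on their atoms. *)
Definition grids_independent {dT} {T : measurableType dT} {V1 V2 : Type}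
    (G1 : nat -> Omega -> V1) (G2 : nat -> Omega -> V2)
    (Z : nat -> Omega -> T) : Prop :=
  forall n g1 g2 E, generated_events Z E ->
    P ([set w | G1 n w = g1 /\ G2 n w = g2] `&` E) =
    P [set w | G1 n w = g1 /\ G2 n w = g2] * P E.

(* Stated with outer probability: empirical transports are arbitrary on the   *)
(* null set where the minimizer is not unique, hence possibly not measurable. *)
Definition little_o_P (Y : nat -> Omega -> R) (a : nat -> R) : Prop :=
  forall eps : R, (0 < eps)%R ->
    mu_ext P [set w | (eps * a n < `|Y n w|)%R] @[n --> \oo] --> 0.

(* Almost everywhere refers to the law of the m arguments at which f is        *)
(* evaluated. With a score such as J = 1 this law is carried by products of    *)
(* spheres, a Lebesgue-null set on which Lebesgue-a.e. continuity says nothing.*)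
Definition ae_continuous_along {m d} (f : 'M[R]_(m, d) -> R)
    (Z : nat -> Omega -> 'rV[R]_d) : Prop :=
  {ae P, forall w, {for (\matrix_(i < m) Z i w), continuous f}}.

End probability_notions.

Section symmetric_covariance.
Context {R : realType} {m : nat}.

Definition Hstar (hm : (4 <= m)%N) : {set 'S_m} :=
  let o k := widen_ord hm (inord k : 'I_4) in
  let t14 := tperm (o 0%N) (o 3%N) in
  let t23 := tperm (o 1%N) (o 2%N) in
  [set 1%g; t14; t23; (t14 * t23)%g]%SET.

Definition antisymmetrized {d} (H : {set 'S_m}) (f : 'M[R]_(m, d) -> R)
    (x : 'M[R]_(m, d)) : R :=
  \sum_(s in H) (-1) ^+ (odd_perm s) * f (row_perm s x).

Definition gsc_kernel {d1 d2} (H : {set 'S_m}) (f1 : 'M[R]_(m, d1) -> R)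
    (f2 : 'M[R]_(m, d2) -> R) (x1 : 'M[R]_(m, d1)) (x2 : 'M[R]_(m, d2)) : R :=
  antisymmetrized H f1 x1 * antisymmetrized H f2 x2.

Definition gsc_kernel_sym {d1 d2} (H : {set 'S_m}) (f1 : 'M[R]_(m, d1) -> R)
    (f2 : 'M[R]_(m, d2) -> R) (x1 : 'M[R]_(m, d1)) (x2 : 'M[R]_(m, d2)) : R :=
  (m`!)%:R^-1 *
  \sum_(s : 'S_m) gsc_kernel H f1 f2 (row_perm s x1) (row_perm s x2).

Definition sample_gsc {d1 d2 n} (H : {set 'S_m}) (f1 : 'M[R]_(m, d1) -> R)
    (f2 : 'M[R]_(m, d2) -> R) (x1 : 'M[R]_(n, d1)) (x2 : 'M[R]_(n, d2)) : R :=
  'C(n, m)%:R^-1 *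
  \sum_(i : {ffun 'I_m -> 'I_n} |
        [forall a : 'I_m, forall b : 'I_m, (a < b)%N ==> (i a < i b)%N])
    gsc_kernel_sym H f1 f2 (rowsub i x1) (rowsub i x2).

End symmetric_covariance.

(* Main.v *)
(** Write both statistics as averages over injections g of products A1(g) A2(g) and A1'(g) A2'(g),
   where Ak is the antisymmetrized kernel evaluated at the ranks and Ak' at the oracle values.
   Their difference is the average of A1 (A2 - A2') + (A1 - A1') A2'. Under the hypothesis of
   independence the first sample can be relabelled by any permutation without changing the joint
   law. Averaged over all relabellings, A1(g) A1(g') vanishes unless g' meets both {g(1), g(4)}
   and {g(2), g(3)}, because A1 changes sign under the two transpositions generating the group.
   Only a fraction O(n^-2) of the pairs (g, g') survives, so n^2 E (difference)^2 is bounded by a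
   constant times the average over g of E (Ak - Ak')^2, k = 1, 2.

   These averages tend to 0 by almost everywhere continuity of the kernels, once the proportion of
   sample points moved differently by the empirical and by the population transport tends to 0 in
   mean. For this compare a potential of the optimal assignment with the convex potential phi
   along a coupling of sample points whose images lie in the same small cell of the unit ball. The
   coupling nearly preserves the empirical measure, as the grid and the population image have the
   same limit, so the deficits in the convexity inequalities of phi must be small on average, and
   at points of differentiability this forces the two images to be close. *)

Require Import Defs.
From HB Require Import structures.
From mathcomp Require Import all_boot all_order all_algebra all_fingroup finmap.
From mathcomp Require Import all_classical all_reals all_analysis.
From mathcomp Require Import measurable_realfun ring lra zify.

Set Implicit Arguments.
Unset Strict Implicit.
Unset Printing Implicit Defensive.

Import Order.TTheory GRing.Theory Num.Theory numFieldNormedType.Exports.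

Local Open Scope classical_set_scope.
Local Open Scope ring_scope.

(** * Potentials of an optimal assignment *)

(** Three obstacles shape the proof. Measurability: neither the empirical transports nor the kernels
    are assumed measurable, so off a null set both statistics are replaced by canonical versions, in
    which ranks come from the strictly optimal permutation and oracles from a Borel modification
    that agrees with the kernel at its continuity points. Random grids: their independence of the
    sample is known on atoms only, so grids are coded by integers and laws are compared on a
    pi-system that fixes the code or leaves it free. Scores: [J] may blow up at 1 and [score J] may
    jump at the origin, so the score is absorbed into the kernel, which keeps the bound of [f]; what
    counts is continuity at the values of the population transport, which almost surely avoid the
    origin. In the second of the two products the alternating factor is an oracle term of the second
    sample, and there the second sample is relabelled. Weak convergence is used only through
    finitely many Lipschitz functions, a partition of unity on the ball. *)

Section walks.
Context {R : realType} {n : nat} (c : 'I_n -> 'I_n -> R).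

Fixpoint walk_weight (x : 'I_n) (p : seq 'I_n) : R :=
  if p is y :: q then c x y + walk_weight y q else 0.

Lemma walk_weight_cat x p q :
  walk_weight x (p ++ q) = walk_weight x p + walk_weight (last x p) q.
Proof. by elim: p x => [|y p IH] x /=; rewrite ?add0r// IH addrA. Qed.

Lemma walk_weight_nth x p :
  walk_weight x p = \sum_(0 <= i < size p) c (nth x (x :: p) i) (nth x p i).
Proof.
elim: p x => [|y p IH] x /=; first by rewrite big_nil.
rewrite big_nat_recl//= IH; congr (_ + _); rewrite !big_nat; apply: eq_bigr => i ip.
congr (c _ _); last exact: set_nth_default.
by apply: (set_nth_default x (s := y :: p)) => /=; rewrite ltnS ltnW.
Qed.

Hypothesis c_refl : forall i, c i i = 0.
Hypothesis c_perm : forall s : 'S_n, \sum_i c i (s i) <= 0.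

(** [next (x :: p)] is a permutation that fixes every index off the cycle, where [c_refl] makes the
    weight vanish; the weight of the cycle is thus one of the sums bounded by [c_perm]. *)
Lemma simple_cycle_weight x p : uniq (x :: p) -> walk_weight x (rcons p x) <= 0.
Proof.
move=> U.
have inj : injective (next (x :: p)) := can_inj (prev_next U).
apply: le_trans (c_perm (perm inj)).
rewrite (bigID (mem (x :: p)))/= [X in _ + X]big1 ?addr0; last first.
  move=> i ip; rewrite permE; suff -> : next (x :: p) i = i by rewrite c_refl.
  by rewrite next_nth (negbTE ip).
rewrite -big_uniq// walk_weight_nth (big_nth x) size_rcons.
rewrite le_eqVlt; apply/orP; left; apply/eqP.
rewrite !big_nat; apply: eq_bigr => i /= ip.
rewrite permE next_nth mem_nth// index_uniq//.
rewrite -rcons_cons nth_rcons /= ip; congr (c _ _).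
rewrite nth_rcons; move: ip; rewrite ltnS leq_eqVlt => /predU1P[->|->]//.
by rewrite ltnn eqxx nth_default.
Qed.

Lemma not_uniqP (T : eqType) (s : seq T) : ~~ uniq s ->
  exists a y b d, s = a ++ y :: b ++ y :: d.
Proof.
elim: s => //= y s IH; rewrite negb_and negbK => /orP[/splitPr[b d]|/IH[a [z [b [d ->]]]]].
  by exists [::], y, b, d.
by exists (y :: a), z, b, d.
Qed.

(** Strong induction on the length: a vertex met twice cuts the closed walk into two shorter closed
    walks, until a simple cycle is left. *)
Lemma closed_walk_weight x p : walk_weight x (rcons p x) <= 0.
Proof.
have [k] := ubnP (size p); elim: k x p => // k IH x p pk.
have [U|/not_uniqP[a [y [b [d E]]]]] := boolP (uniq (x :: p)).
  exact: simple_cycle_weight.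
have H1 : walk_weight y (rcons b y) <= 0.
  apply: IH; move/(congr1 size): E pk; rewrite /= size_cat/= size_cat/=; lia.
(* Cutting out the loop at [y] leaves a shorter closed walk at [x]. When [a] is empty the start
   itself is the repeated vertex, and the remainder is a closed walk at [x = y]. *)
have [a' Ea'] : exists q, rcons p x = q ++ [:: y] ++ rcons b y ++ rcons d x /\
    walk_weight x (q ++ [:: y] ++ rcons d x) <= 0 \/
    (q = [::] /\ rcons p x = rcons b y ++ rcons d x /\ x = y).
  case: a E => [|x' a] /= [xx Ep].
    by exists [::]; right; rewrite Ep rcons_cat/= cat_rcons.
  exists a; left; split; first by rewrite Ep rcons_cat/= rcons_cat/= cat_rcons.
  have := IH x (a ++ y :: d); rewrite rcons_cat/=; apply.
  by move: pk; rewrite Ep !size_cat/= !size_cat/=; lia.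
case: Ea' => [[-> ]|[_ [-> xy]]].
  rewrite !walk_weight_cat/= last_rcons; lra.
rewrite walk_weight_cat last_rcons xy.
have : walk_weight y (rcons d y) <= 0.
  apply: IH; move/(congr1 size): E pk; rewrite /= size_cat/= size_cat/=; lia.
lra.
Qed.

(** [psi j] is the supremum of the weights of walks from [i0] to [j]. Closing such a walk by the
    edge from [j] to [i0] bounds its weight by [- c j i0], and appending the edge from [i] to [j]
    gives the inequality. *)
Lemma potential_exists (i0 : 'I_n) :
  exists psi : 'I_n -> R, forall i j, psi i + c i j <= psi j.
Proof.
pose W j := [set walk_weight i0 p | p in [set p | last i0 p = j]].
have W0 j : W j !=set0 by exists (walk_weight i0 [:: j]), [:: j].
have ub j : has_ubound (W j).
  exists (- c j i0) => _ [p /= <- <-].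
  by have := closed_walk_weight i0 p; rewrite -cats1 walk_weight_cat /=; lra.
exists (fun j => sup (W j)) => i j; rewrite -lerBrDr; apply: ge_sup => //.
move=> _ [p /= pi <-]; rewrite lerBrDr; apply: ub_le_sup => //.
by exists (rcons p j); rewrite /= ?last_rcons// -cats1 walk_weight_cat /= pi addr0.
Qed.

End walks.

Lemma mx_norm_entry (R : realType) m n (x : 'M[R]_(m, n)) i j : `|x i j| <= `|x|.
Proof.
rewrite [leRHS]mx_normrE.
exact: (le_bigmax _ (fun ij : 'I_m * 'I_n => `|x ij.1 ij.2|) (i, j)).
Qed.

Lemma mx_norm_le (R : realType) m n (x : 'M[R]_(m, n)) e : 0 <= e ->
  (forall i j, `|x i j| <= e) -> `|x| <= e.
Proof.
by move=> e0 xe; rewrite [leLHS]mx_normrE; apply/bigmax_leP; split => // ij _; exact: xe.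
Qed.

Section dot_product.
Context {R : realType} {d : nat}.
Implicit Types x y z : 'rV[R]_d.

Lemma dotpC x y : dotp x y = dotp y x.
Proof. by apply: eq_bigr => i _; rewrite mulrC. Qed.

Lemma dotpDr x y z : dotp x (y + z) = dotp x y + dotp x z.
Proof. by rewrite -big_split/=; apply: eq_bigr => i _; rewrite mxE mulrDr. Qed.

Lemma dotpNr x y : dotp x (- y) = - dotp x y.
Proof. by rewrite -sumrN; apply: eq_bigr => i _; rewrite mxE mulrN. Qed.

Lemma dotpBr x y z : dotp x (y - z) = dotp x y - dotp x z.
Proof. by rewrite dotpDr dotpNr. Qed.

Lemma dotpBl x y z : dotp (y - z) x = dotp y x - dotp z x.
Proof. by rewrite dotpC dotpBr !(dotpC x). Qed.

Lemma dotpZr x a y : dotp x (a *: y) = a * dotp x y.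
Proof. by rewrite mulr_sumr; apply: eq_bigr => i _; rewrite mxE mulrCA. Qed.

Lemma dotp_delta x k : dotp x (delta_mx 0 k) = x 0 k.
Proof.
rewrite /dotp (bigD1 k)//= big1 ?addr0; first by rewrite mxE !eqxx mulr1.
by move=> i ik; rewrite mxE eqxx (negbTE ik) mulr0.
Qed.

Lemma dotp_le x y : `|dotp x y| <= d%:R * `|x| * `|y|.
Proof.
apply: le_trans (ler_norm_sum _ _ _) _.
rewrite -mulrA -[X in X%:R](card_ord d) -sumr_const mulr_suml.
by apply: ler_sum => i _; rewrite normrM mul1r ler_pM// mx_norm_entry.
Qed.

End dot_product.

(** * Stability of discrete optimal transport *)

Section couplings.
Context {R : realType} {n : nat}.

Definition freq (b : pred 'I_n) : R := n%:R^-1 * \sum_i (b i)%:R.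

Definition mean (f : 'I_n -> R) : R := n%:R^-1 * \sum_i f i.

(** The marginals are only bounded by the uniform law: matching two samples cell by cell loses the
    mass by which their cell frequencies differ. *)
Definition subcoupling (k : 'I_n -> 'I_n -> R) : Prop :=
  [/\ forall i j, 0 <= k i j,
      forall i, \sum_j k i j <= n%:R^-1 & forall j, \sum_i k i j <= n%:R^-1].

Hypothesis n_gt0 : (0 < n)%N.

Lemma mean_cst (c : R) : mean (fun=> c) = c.
Proof.
rewrite /mean sumr_const card_ord -[c *+ n]mulr_natl mulrA mulVf ?mul1r//.
by rewrite pnatr_eq0 -lt0n.
Qed.

(* With [a c] and [b c] the masses of [chi c] under the points [u] and [v], the coupling is
   [k i j = n^-2 \sum_c chi c (u i) * chi c (v j) / max (a c) (b c)]. *)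
Lemma subcoupling_exists (T : Type) (I : finType) (chi : I -> T -> R)
    (u v : 'I_n -> T) : (forall c x, 0 <= chi c x) ->
  (forall i, \sum_c chi c (u i) = 1) -> (forall i, \sum_c chi c (v i) = 1) ->
  exists k, [/\ subcoupling k,
    forall i j, k i j != 0 -> exists c, chi c (u i) != 0 /\ chi c (v j) != 0 &
    1 - \sum_c `|mean (chi c \o u) - mean (chi c \o v)| <= \sum_i \sum_j k i j].
Proof.
move=> chi0 u1 v1.
have ni : 0 <= n%:R^-1 :> R by rewrite invr_ge0.
pose a c := mean (chi c \o u); pose b c := mean (chi c \o v).
have a0 c : 0 <= a c by rewrite mulr_ge0//; apply: sumr_ge0 => i _; exact: chi0.
have b0 c : 0 <= b c by rewrite mulr_ge0//; apply: sumr_ge0 => i _; exact: chi0.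
(* Where both masses vanish the inverse is 0 by convention, and the cell carries nothing. *)
pose w c := (Num.max (a c) (b c))^-1.
have w0 c : 0 <= w c by rewrite invr_ge0 le_max a0.
pose k i j := n%:R^-1 * n%:R^-1 * \sum_c chi c (u i) * chi c (v j) * w c.
have aw c : a c * w c <= 1.
  have [m0|m0] := eqVneq (Num.max (a c) (b c)) 0; first by rewrite /w m0 invr0 mulr0.
  rewrite /w ler_pdivrMr ?mul1r ?le_max ?lexx//.
  by rewrite lt_neqAle eq_sym m0 le_max a0.
have bw c : b c * w c <= 1.
  have [m0|m0] := eqVneq (Num.max (a c) (b c)) 0; first by rewrite /w m0 invr0 mulr0.
  rewrite /w ler_pdivrMr ?mul1r ?le_max ?lexx ?orbT//.
  by rewrite lt_neqAle eq_sym m0 le_max a0.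
have krow i : \sum_j k i j = n%:R^-1 * \sum_c chi c (u i) * (b c * w c).
  rewrite -mulr_sumr -mulrA; congr (_ * _).
  rewrite exchange_big/= mulr_sumr; apply: eq_bigr => c _.
  by rewrite /b /mean/= -mulr_suml -mulr_sumr; ring.
have kcol j : \sum_i k i j = n%:R^-1 * \sum_c chi c (v j) * (a c * w c).
  rewrite -mulr_sumr -mulrA; congr (_ * _).
  rewrite exchange_big/= mulr_sumr; apply: eq_bigr => c _.
  by rewrite /a /mean/= -2!mulr_suml; ring.
exists k; split.
- split=> [i j|i|j].
  + by rewrite !mulr_ge0// sumr_ge0// => c _; rewrite !mulr_ge0.
  + rewrite krow -[leRHS]mulr1 ler_wpM2l// -(u1 i).
    by apply: ler_sum => c _; rewrite -[leRHS]mulr1 ler_wpM2l.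
  + rewrite kcol -[leRHS]mulr1 ler_wpM2l// -(v1 j).
    by apply: ler_sum => c _; rewrite -[leRHS]mulr1 ler_wpM2l.
- move=> i j kij; apply: contrapT => /forallNP H; move/eqP: kij; apply.
  rewrite /k big1 ?mulr0// => c _; apply/eqP; rewrite !mulf_eq0.
  have /not_andP[/negP|/negP] := H c; rewrite negbK => -> //.
  by rewrite orbT.
(* The total mass is the sum over the cells of the minimum of [a c] and [b c], which is at least
   [a c - |a c - b c|], while the [a c] add up to 1. *)
under [leRHS]eq_bigr do rewrite krow.
rewrite -[leRHS]mulr_sumr [in leRHS]exchange_big/= [leRHS]mulr_sumr.
have E1 : 1 = \sum_c a c.
  rewrite /a /mean -mulr_sumr exchange_big/= (eq_bigr (fun=> 1)) => [|i _]; last exact: u1.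
  by have := mean_cst 1; rewrite /mean => ->.
rewrite [X in X - _]E1 -sumrB; apply: ler_sum => c _.
rewrite -/(a c) -/(b c).
have -> : n%:R^-1 * \sum_i chi c (u i) * (b c * w c) = a c * (b c * w c).
  by rewrite -mulr_suml /a /mean/=; ring.
have [m0|m0] := eqVneq (Num.max (a c) (b c)) 0.
  have -> : a c = 0 by apply/eqP; rewrite eq_le a0 andbT -m0 le_max lexx.
  by rewrite mul0r subr_le0.
have mp : 0 < Num.max (a c) (b c) by rewrite lt_neqAle eq_sym m0 le_max a0.
have [ab|ba] := leP (a c) (b c).
  have -> : w c = (b c)^-1 by rewrite /w max_r.
  rewrite mulfV ?mulr1; last by move: m0; rewrite max_r.
  by rewrite lerBlDr lerDl.
have -> : w c = (a c)^-1 by rewrite /w max_l// ltW.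
rewrite mulrCA mulfV ?mulr1; last by move: m0; rewrite max_l// ltW.
by have := ler_norm (a c - b c); lra.
Qed.

(* Since [k] almost preserves the uniform law, the increments of a bounded function sum to
   almost zero along [k]: the deficits [D] below these increments are small on average.
   [h] is bounded on [K] only and has to be truncated. *)
Lemma subcoupling_descent (k : 'I_n -> 'I_n -> R) (h : 'I_n -> R)
    (D : 'I_n -> 'I_n -> R) (K K' : pred 'I_n) (C e th del : R) :
  subcoupling k -> 1 - del <= \sum_i \sum_j k i j ->
  0 <= C -> 0 <= e -> (forall i, K i -> `|h i| <= C) ->
  (forall i, K i -> K' i) -> (forall i j, 0 <= D i j) ->
  (forall i j, k i j != 0 -> K' i -> K' j -> D i j - e <= h i - h j) ->
  th * \sum_i \sum_j k i j * ([&& K i, K j & th < D i j])%:R <=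
    e + 4 * C * freq (predC K') + 2 * C * del.
Proof.
move=> [k0 kr kc] ktot C0 e0 hC KK' D0 hD.
(* The truncation of [h] to the interval from [- C] to [C]; it coincides with [h] on [K]. *)
pose t i := Num.max (- C) (Num.min C (h i)).
have tE i : [\/ t i = - C /\ h i <= - C, t i = h i /\ - C <= h i <= C | t i = C /\ C <= h i].
  have [H1|H1] := lerP C (h i).
    by apply: Or33; rewrite /t (min_l H1) max_r//; lra.
  have [H2|H2] := lerP (h i) (- C).
    by apply: Or31; rewrite /t (min_r (ltW H1)) (max_l H2).
  apply: Or32; rewrite /t (min_r (ltW H1)) (max_r (ltW H2)); split => //; lra.
have tC i : - C <= t i <= C.
  by have [[->]|[->]|[->]] := tE i; lra.
have th_ i : K i -> t i = h i.
  by move=> /hC; rewrite ler_norml; have [[->]|[->]|[->]] := tE i; lra.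
(* Truncation is nondecreasing and 1-Lipschitz, so a lower bound [- e] on an increment survives
   it. *)
have tlip i j : - e <= h i - h j -> - e <= t i - t j.
  by have [[->]|[->]|[->]] := tE i; have [[->]|[->]|[->]] := tE j; lra.
have nn : n%:R^-1 * n%:R = 1 :> R by rewrite mulVf// pnatr_eq0 -lt0n.
have nC : \sum_(i < n) n%:R^-1 * C = C.
  by rewrite sumr_const card_ord -[_ *+ n]mulr_natl mulrA (mulrC n%:R) nn mul1r.
(* Summation by parts: the total increment only sees the defects of the two marginals from [n^-1],
   and each family of defects has total mass at most [del]. *)
have up : \sum_i \sum_j k i j * (t i - t j) <= 2 * C * del.
  have -> : \sum_i \sum_j k i j * (t i - t j) =
      \sum_i ((\sum_j k i j - n%:R^-1) * t i) + \sum_j ((n%:R^-1 - \sum_i k i j) * t j).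
    transitivity (\sum_i (\sum_j k i j) * t i - \sum_j (\sum_i k i j) * t j).
      under [X in _ - X]eq_bigr do rewrite mulr_suml.
      rewrite [X in _ - X]exchange_big/= -sumrB; apply: eq_bigr => i _.
      by rewrite mulr_suml -sumrB; apply: eq_bigr => j _; ring.
    rewrite -sumrB -big_split/=; apply: eq_bigr => i _; ring.
  have b1 : \sum_i ((\sum_j k i j - n%:R^-1) * t i) <= C * (1 - \sum_i \sum_j k i j).
    rewrite mulrBr mulr1 mulr_sumr; rewrite -[X in X - _]nC.
    rewrite -sumrB; apply: ler_sum => i _; have /andP[t1 t2] := tC i.
    have a0 : 0 <= n%:R^-1 - \sum_j k i j by rewrite subr_ge0.
    have : 0 <= (n%:R^-1 - \sum_j k i j) * (C + t i) by rewrite mulr_ge0//; lra.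
    lra.
  have b2 : \sum_j ((n%:R^-1 - \sum_i k i j) * t j) <= C * (1 - \sum_i \sum_j k i j).
    rewrite exchange_big/= mulrBr mulr1 mulr_sumr; rewrite -[X in X - _]nC.
    rewrite -sumrB; apply: ler_sum => i _; have /andP[t1 t2] := tC i.
    have a0 : 0 <= n%:R^-1 - \sum_j k j i by rewrite subr_ge0.
    have : 0 <= (n%:R^-1 - \sum_j k j i) * (C - t i) by rewrite mulr_ge0//; lra.
    lra.
  have : C * (1 - \sum_i \sum_j k i j) <= C * del by rewrite ler_wpM2l//; lra.
  lra.
(* Nothing is known of a pair with an endpoint outside [K']; its increment is still at least
   [- 2 * C], and this loss is charged to that endpoint. *)
have lo : \sum_i \sum_j (k i j * (th * ([&& K i, K j & th < D i j])%:R - e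
     - 2 * C * (~~ K' i)%:R - 2 * C * (~~ K' j)%:R)) <= \sum_i \sum_j k i j * (t i - t j).
  apply: ler_sum => i _; apply: ler_sum => j _.
  have [->|kij] := eqVneq (k i j) 0; first by rewrite !mul0r.
  apply: ler_wpM2l => //.
  have [/and3P[Ki Kj thD]|_] := boolP [&& _, _ & _].
    rewrite !KK'// !th_//= !mulr1 !mulr0 !subr0.
    by have := hD i j kij (KK' _ Ki) (KK' _ Kj); lra.
  have /andP[ti1 ti2] := tC i; have /andP[tj1 tj2] := tC j.
  case: (boolP (K' i)) => Ki; case: (boolP (K' j)) => Kj /=; try lra.
  rewrite !mulr0 !subr0 sub0r; apply: tlip.
  by have := hD i j kij Ki Kj; have := D0 i j; lra.
have split4 : \sum_i \sum_j (k i j * (th * ([&& K i, K j & th < D i j])%:R - e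
     - 2 * C * (~~ K' i)%:R - 2 * C * (~~ K' j)%:R)) =
  th * \sum_i \sum_j k i j * ([&& K i, K j & th < D i j])%:R -
  e * \sum_i \sum_j k i j - 2 * C * (\sum_i (\sum_j k i j) * (~~ K' i)%:R)
   - 2 * C * (\sum_j (\sum_i k i j) * (~~ K' j)%:R).
  under [X in _ - 2 * C * X]eq_bigr do rewrite mulr_suml.
  rewrite [X in _ - 2 * C * X]exchange_big/= !mulr_sumr -!sumrB.
  apply: eq_bigr => i _; rewrite mulr_suml !mulr_sumr -!sumrB.
  by apply: eq_bigr => j _; ring.
have f1 : \sum_i (\sum_j k i j) * (~~ K' i)%:R <= freq (predC K').
  by rewrite /freq mulr_sumr; apply: ler_sum => i _; rewrite ler_wpM2r.
have f2 : \sum_j (\sum_i k i j) * (~~ K' j)%:R <= freq (predC K').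
  by rewrite /freq mulr_sumr; apply: ler_sum => i _; rewrite ler_wpM2r.
have k1 : \sum_i \sum_j k i j <= 1.
  rewrite -[leRHS]nn mulr_natr -[n in _ *+ n]card_ord -sumr_const.
  by apply: ler_sum => i _.
have := le_trans lo up; rewrite split4.
have : e * \sum_i \sum_j k i j <= e by rewrite -[leRHS]mulr1 ler_wpM2l.
have : C * \sum_i (\sum_j k i j) * (~~ K' i)%:R <= C * freq (predC K') by rewrite ler_wpM2l.
have : C * \sum_j (\sum_i k i j) * (~~ K' j)%:R <= C * freq (predC K') by rewrite ler_wpM2l.
lra.
Qed.

End couplings.

Section transport_bound.
Context {R : realType} {d n : nat} (z u v : 'I_n -> 'rV[R]_d) (phi : 'rV[R]_d -> R).
Hypothesis n_gt0 : (0 < n)%N.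
Hypothesis subgrad : forall i y, phi (z i) + dotp (v i) (y - z i) <= phi y.
Hypothesis opt : forall s : 'S_n,
  \sum_i dotp (z i) (u (s i)) <= \sum_i dotp (z i) (u i).
Hypothesis u1 : forall i, `|u i| <= 1.
Hypothesis v1 : forall i, `|v i| <= 1.

(** With the weights [dotp (u i) (z j - z i)], optimality of the identity among all assignments is,
    after reindexing by the inverse permutation, the hypothesis of [potential_exists]. *)
Lemma assignment_potential : exists psi : 'I_n -> R,
  forall i j, psi i + dotp (u i) (z j - z i) <= psi j.
Proof.
apply: potential_exists (Ordinal n_gt0).
  by move=> i; rewrite subrr /dotp big1// => k _; rewrite mxE mulr0.
move=> s; under eq_bigr do rewrite dotpBr.
rewrite sumrB subr_le0 (reindex_inj (@perm_inj _ s^-1%g))/=.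
under eq_bigr do rewrite permKV dotpC.
by rewrite (eq_bigr _ (fun i _ => dotpC (u i) (z i))).
Qed.

Lemma dotp_le_ball (x y : 'rV[R]_d) : `|x| <= 1 -> dotp x y <= d%:R * `|y|.
Proof.
move=> x1; apply: le_trans (ler_norm _) _; apply: le_trans (dotp_le _ _) _.
by rewrite -mulrA ler_wpM2l// ler_piMl.
Qed.

(* The descent lemma is applied to [h i = phi (z i) - psi i], with [psi] the potential of the
   assignment and [D i j] the convexity deficit [phi (z i) - phi (z j) - <v j, z i - z j>]. As
   [phi] is almost differentiable at scale [eta] at the regular points, a small [D i j] forces
   [v j] close to [v i], while [u i] is close to [v j] along the coupling. *)
Lemma transport_bound (I : finType) (chi : I -> 'rV[R]_d -> R)
    (K K' eps eps' eta del : R) (reg : pred 'I_n) :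
  (forall c x, 0 <= chi c x) ->
  (forall i, \sum_c chi c (u i) = 1) -> (forall i, \sum_c chi c (v i) = 1) ->
  (forall c x y, chi c x != 0 -> chi c y != 0 -> `|x - y| <= eps) ->
  0 < eps' -> 0 < eta -> 0 <= K <= K' -> 0 <= eps ->
  (forall i, reg i -> forall k,
    phi (z i + eta *: delta_mx 0 k) <= phi (z i) + eta * v i 0 k + eps' * eta /\
    phi (z i - eta *: delta_mx 0 k) <= phi (z i) - eta * v i 0 k + eps' * eta) ->
  \sum_c `|mean (chi c \o u) - mean (chi c \o v)| <= del ->
  freq (fun i => eps + 2 * eps' < `|u i - v i|) <=
    del + 2 * freq (fun i => K < `|z i|) + freq (predC reg) +
    (eta * eps')^-1 * (2 * d%:R * eps * K' +
       16 * d%:R * K * freq (fun i => K' < `|z i|) + 8 * d%:R * K * del).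
Proof.
move=> chi0 cu cv small e'0 eta0 /andP[K0 KK'] eps0 hreg hdel.
have [k [kcpl kchi ktot]] := subcoupling_exists n_gt0 chi0 cu cv.
have [k0 kr kc] := kcpl.
have [psi0 psiP] := assignment_potential.
have ktot' : 1 - del <= \sum_i \sum_j k i j by apply: le_trans ktot; lra.
have phiL i j : `|phi (z i) - phi (z j)| <= d%:R * `|z i - z j|.
  have H1 := subgrad i (z j); have H2 := subgrad j (z i).
  have B1 := dotp_le_ball (z i - z j) (v1 i); have B2 := dotp_le_ball (z j - z i) (v1 j).
  rewrite -(opprB (z i)) dotpNr in H1; rewrite -(opprB (z i)) dotpNr normrN in B2.
  by rewrite ler_norml; lra.
pose bigK i := K < `|z i|.
(* If every sample point lies outside the ball of radius [K], the frequency of these points is 1 and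
   the bound is trivial; otherwise [i0] anchors the potential. *)
have [[i0 /negP]|noK] := pselect (exists i0, ~ bigK i0); last first.
  have -> : freq (fun i => K < `|z i|) = 1 :> R.
    rewrite -[RHS](mean_cst n_gt0) /freq /mean; congr (_ * _).
    apply: eq_bigr => i _; move/forallNP: noK => /(_ i) /contrapT.
    by rewrite /bigK => ->.
  have fr0 (b : pred 'I_n) : 0 <= freq b :> R by rewrite mulr_ge0 ?invr_ge0// sumr_ge0.
  have fr1 (b : pred 'I_n) : freq b <= 1 :> R.
    rewrite -[leRHS](mean_cst n_gt0) /freq /mean ler_wpM2l ?invr_ge0//.
    by apply: ler_sum => i _; case: (b i).
  have del0 : 0 <= del by apply: le_trans hdel; apply: sumr_ge0.
  apply: le_trans (fr1 _) _.
  have X : 0 <= (eta * eps')^-1 * (2 * d%:R * eps * K' +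
       16 * d%:R * K * freq (fun i => K' < `|z i|) + 8 * d%:R * K * del).
    have K'0 := le_trans K0 KK'.
    apply: mulr_ge0; first by rewrite invr_ge0 mulr_ge0 ?ltW.
    have := fr0 (fun i => K' < `|z i|) => fK.
    by repeat (done || apply: addr_ge0 || apply: mulr_ge0).
  have := fr0 (predC reg); lra.
rewrite /bigK -leNgt => zi0.
(* Normalized to agree with [phi] at the anchor. From there both functions move by at most
   [d * |z i - z i0|], so on the ball of radius [K] their difference [h] is at most [4 * d * K]. *)
pose psi i := psi0 i - psi0 i0 + phi (z i0).
pose h i := phi (z i) - psi i.
pose D i j := phi (z i) - phi (z j) - dotp (v j) (z i - z j).
have D0 i j : 0 <= D i j by have := subgrad j (z i); rewrite /D; lra.
have hD i j : D i j + dotp (u i - v j) (z j - z i) <= h i - h j.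
  rewrite dotpBl; have -> : dotp (v j) (z j - z i) = - dotp (v j) (z i - z j).
    by rewrite -dotpNr opprB.
  by have := psiP i j; rewrite /D /h /psi; lra.
have psiL i : `|psi i - phi (z i0)| <= d%:R * `|z i - z i0|.
  have -> : psi i - phi (z i0) = psi0 i - psi0 i0 by rewrite /psi; ring.
  have := psiP i i0; have := psiP i0 i.
  have := dotp_le (u i0) (z i - z i0); have := dotp_le (u i) (z i0 - z i).
  rewrite !ler_norml (distrC (z i0)) -!mulrA.
  have H j : d%:R * (`|u j| * `|z i - z i0|) <= d%:R * `|z i - z i0|.
    by rewrite ler_wpM2l// ler_piMl.
  have := H i; have := H i0; lra.
have zz i : `|z i| <= K -> `|z i - z i0| <= 2 * K.
  by move=> zK; apply: le_trans (ler_normB _ _) _; lra.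
have hC i : `|z i| <= K -> `|h i| <= 4 * d%:R * K.
  move=> /zz /(ler_wpM2l (ler0n R d)).
  have := phiL i i0; have := psiL i; rewrite !ler_norml /h; lra.
have desc := @subcoupling_descent R n n_gt0 k h D (fun i => `|z i| <= K)
  (fun i => `|z i| <= K') (4 * d%:R * K) (2 * d%:R * eps * K') (eta * eps') del kcpl ktot'.
have {}desc := desc ltac:(rewrite !mulr_ge0//) ltac:(rewrite !mulr_ge0// (le_trans K0)//)
   (fun i => hC i) (fun i zi => le_trans zi KK') D0.
have {}desc : eta * eps' * \sum_i \sum_j k i j * ([&& `|z i| <= K, `|z j| <= K & eta * eps' < D i j])%R%:R <=
    2 * d%:R * eps * K' + 16 * d%:R * K * freq (fun i => K' < `|z i|) + 8 * d%:R * K * del.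
  have -> : freq (fun i => K' < `|z i|) = freq (predC (fun i => `|z i| <= K')) :> R.
    by congr (_ * _); apply: eq_bigr => i _ /=; rewrite ltNge.
  apply: le_trans (desc _) _; last by rewrite le_eqVlt; apply/orP; left; apply/eqP; ring.
  move=> i j kij ziK zjK; apply: le_trans (hD i j).
  rewrite lerD2l; apply: lerNnormlW; apply: le_trans (dotp_le _ _) _.
  have [c [cui cvj]] := kchi _ _ kij.
  have uv := small _ _ _ cui cvj.
  have zji : `|z j - z i| <= 2 * K' by apply: le_trans (ler_normB _ _) _; lra.
  have -> : 2 * d%:R * eps * K' = d%:R * (eps * (2 * K')) by ring.
  by rewrite -mulrA ler_wpM2l// ler_pM.
(* The affine minorant of [phi] at [z j] is tested at [z i] shifted by [eta] along each axis, in
   both directions; regularity at [z i] bounds [phi] from above there. *)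
have close i j : reg i -> `|v j - v i| <= D i j / eta + eps'.
  move=> ri; apply: mx_norm_le => [|i' l].
    by rewrite addr_ge0 ?(ltW e'0)// divr_ge0 ?(ltW eta0).
  rewrite (ord1 i') !mxE.
  have [p1 p2] := hreg i ri l.
  have q1 := subgrad j (z i + eta *: delta_mx 0 l).
  have q2 := subgrad j (z i - eta *: delta_mx 0 l).
  have E1 : dotp (v j) (z i + eta *: delta_mx 0 l - z j) = dotp (v j) (z i - z j) + eta * v j 0 l.
    by rewrite -[in RHS]dotp_delta -dotpZr -dotpDr; congr dotp; rewrite addrAC.
  have E2 : dotp (v j) (z i - eta *: delta_mx 0 l - z j) = dotp (v j) (z i - z j) - eta * v j 0 l.
    by rewrite -[in RHS]dotp_delta -dotpZr -dotpBr; congr dotp; rewrite addrAC.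
  rewrite -(ler_pM2r eta0) mulrDl divfK ?gt_eqF// -[X in _ * X](gtr0_norm eta0) -normrM.
  by rewrite ler_norml /D; move: q1 q2; rewrite E1 E2; lra.
(* If no endpoint is large, [z i] is regular and the deficit is small, then [u i] is within [eps] of
   [v j] and [v j] within [2 * eps'] of [v i]. *)
have pt i j : k i j * (eps + 2 * eps' < `|u i - v i|)%R%:R <=
    k i j * (K < `|z i|)%R%:R + k i j * (K < `|z j|)%R%:R + k i j * (~~ reg i)%:R +
    k i j * ([&& `|z i| <= K, `|z j| <= K & eta * eps' < D i j])%R%:R.
  have [->|kij] := eqVneq (k i j) 0; first by rewrite !mul0r !addr0.
  rewrite -!mulrDr ler_wpM2l//.
  case: ltP => [big|_]; last by rewrite !addr_ge0.
  case: (ltP K) => //= zi; first by rewrite -!addrA lerDl !addr_ge0.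
  case: (ltP K) => //= zj; first by rewrite -!addrA add0r lerDl !addr_ge0.
  case: (boolP (reg i)) => //= ri; last by rewrite -!addrA !add0r lerDl.
  case: ltP => //= Dle; first by rewrite !add0r.
  exfalso; have [c [cui cvj]] := kchi _ _ kij.
  have uv := small _ _ _ cui cvj.
  have vv := close i j ri.
  have Dd : D i j / eta <= eps' by rewrite ler_pdivrMr// mulrC.
  have := ler_distD (v j) (u i) (v i); lra.
have sumk1 i : 0 <= n%:R^-1 - \sum_j k i j by rewrite subr_ge0.
have nn : n%:R^-1 * n%:R = 1 :> R by rewrite mulVf// pnatr_eq0 -lt0n.
(* The points are weighted by the first marginal of [k]; the mass that it lacks is at most [del]. *)
have step : freq (fun i => eps + 2 * eps' < `|u i - v i|) <=
   del + \sum_i \sum_j k i j * (eps + 2 * eps' < `|u i - v i|)%R%:R.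
  rewrite /freq mulr_sumr.
  have : \sum_i (n%:R^-1 - \sum_j k i j) <= del.
    by rewrite sumrB sumr_const card_ord -[_ *+ n]mulr_natr nn; lra.
  have : \sum_(i < n) (n%:R^-1 * (eps + 2 * eps' < `|u i - v i|)%R%:R -
      \sum_j k i j * (eps + 2 * eps' < `|u i - v i|)%R%:R) <=
     \sum_(i < n) (n%:R^-1 - \sum_j k i j).
    apply: ler_sum => i _; rewrite -mulr_suml -mulrBl ler_piMr//.
    by case: ltP.
  by rewrite [X in X <= _]sumrB; lra.
apply: le_trans step _.
have : \sum_i \sum_j k i j * (eps + 2 * eps' < `|u i - v i|)%R%:R <=
   \sum_i \sum_j k i j * (K < `|z i|)%R%:R + \sum_i \sum_j k i j * (K < `|z j|)%R%:R +
   \sum_i \sum_j k i j * (~~ reg i)%:R +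
   \sum_i \sum_j k i j * ([&& `|z i| <= K, `|z j| <= K & eta * eps' < D i j])%R%:R.
  rewrite -!big_split/=; apply: ler_sum => i _.
  by rewrite -!big_split/=; apply: ler_sum => j _; exact: pt.
have f1 (b : pred 'I_n) : \sum_i \sum_j k i j * (b i)%:R <= freq b.
  by rewrite /freq mulr_sumr; apply: ler_sum => i _; rewrite -mulr_suml ler_wpM2r.
have f2 (b : pred 'I_n) : \sum_i \sum_j k i j * (b j)%:R <= freq b.
  rewrite exchange_big /freq mulr_sumr; apply: ler_sum => i _.
  by rewrite -mulr_suml ler_wpM2r.
have := f1 (fun i => K < `|z i|); have := f2 (fun i => K < `|z i|).
have /= := f1 (predC reg).
have : \sum_i \sum_j k i j * ([&& `|z i| <= K, `|z j| <= K & eta * eps' < D i j])%R%:R <=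
   (eta * eps')^-1 * (2 * d%:R * eps * K' +
       16 * d%:R * K * freq (fun i => K' < `|z i|) + 8 * d%:R * K * del).
  by rewrite ler_pdivlMl ?mulr_gt0.
lra.
Qed.

End transport_bound.

(** * Lipschitz partitions of unity on the ball *)

Section partition_of_unity.
Context {R : realType}.

Definition clip01 (t : R) : R := Num.max 0 (Num.min 1 t).

Lemma clip01P (t : R) :
  [\/ clip01 t = 0 /\ t <= 0, clip01 t = t /\ 0 <= t <= 1 | clip01 t = 1 /\ 1 <= t].
Proof.
have [t1|t1] := lerP 1 t.
  by apply: Or33; rewrite /clip01 (min_l t1) max_r//; lra.
have [t0|t0] := lerP t 0.
  by apply: Or31; rewrite /clip01 (min_r (ltW t1)) (max_l t0).
by apply: Or32; rewrite /clip01 (min_r (ltW t1)) (max_r (ltW t0)); split => //; lra.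
Qed.

(** For positive [N], the tent centred at [c / N - 1] with half-width [1 / N], written as a
    difference so that sums over [c] telescope. *)
Definition ramp (N : nat) (c : nat) (t : R) : R :=
  clip01 (N%:R * t + N%:R + 1 - c%:R) - clip01 (N%:R * t + N%:R - c%:R).

Lemma ramp01 N c t : 0 <= ramp N c t <= 1.
Proof.
rewrite /ramp; have [] := clip01P (N%:R * t + N%:R + 1 - c%:R);
have [] := clip01P (N%:R * t + N%:R - c%:R); move=> [-> ?] [-> ?]; lra.
Qed.

Lemma ramp_lipschitz N c s t : `|ramp N c s - ramp N c t| <= 2 * N%:R * `|s - t|.
Proof.
have clipL (a b : R) : `|clip01 a - clip01 b| <= `|a - b|.
  by rewrite ler_norml; have := ler_norm (a - b); have := ler_norm (b - a);
    rewrite (distrC b); have [] := clip01P a; have [] := clip01P b; move=> [-> ?] [-> ?]; lra.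
have -> : ramp N c s - ramp N c t =
  (clip01 (N%:R * s + N%:R + 1 - c%:R) - clip01 (N%:R * t + N%:R + 1 - c%:R)) -
  (clip01 (N%:R * s + N%:R - c%:R) - clip01 (N%:R * t + N%:R - c%:R)).
  by rewrite /ramp; ring.
apply: le_trans (ler_normB _ _) _.
apply: le_trans (lerD (clipL _ _) (clipL _ _)) _.
have -> : N%:R * s + N%:R + 1 - c%:R - (N%:R * t + N%:R + 1 - c%:R) = N%:R * (s - t) by ring.
have -> : N%:R * s + N%:R - c%:R - (N%:R * t + N%:R - c%:R) = N%:R * (s - t) by ring.
by rewrite normrM normr_nat; lra.
Qed.

Lemma ramp_support N c s t : ramp N c s != 0 -> ramp N c t != 0 ->
  N%:R * `|s - t| <= 2.
Proof.
have supp r : ramp N c r != 0 -> -1 <= N%:R * r + N%:R - c%:R <= 1.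
  move=> r0; apply: contraTT isT => H; apply/negP => _; move/negP: r0; apply; apply/eqP.
  rewrite /ramp; have [] := clip01P (N%:R * r + N%:R + 1 - c%:R);
  have [] := clip01P (N%:R * r + N%:R - c%:R); move=> [-> ?] [-> ?]; move: H; lra.
move=> /supp hs /supp ht.
rewrite -[X in X * _](normr_nat R N) -normrM ler_norml; lra.
Qed.

(** After telescoping, [clip01] is evaluated at [N * t + N + 1 >= 1] and at [N * t - N - 1 <= 0]. *)
Lemma ramp_sum N t : `|t| <= 1 -> \sum_(c < (2 * N).+2) ramp N c t = 1.
Proof.
move=> t1; pose f (c : nat) := - clip01 (N%:R * t + N%:R + 1 - c%:R).
rewrite (eq_bigr (fun c : 'I_ _ => f c.+1 - f c)); last first.
  move=> c _; rewrite /f /ramp opprK [RHS]addrC; congr (_ - clip01 _); rewrite -natr1; ring.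
rewrite -(big_mkord xpredT (fun c => f c.+1 - f c)) telescope_sumr// /f opprK.
rewrite subr0 -natr1 -natr1 natrM.
have /andP[Nt1 Nt2] : - N%:R <= N%:R * t <= N%:R.
  by rewrite -ler_norml normrM normr_nat ler_piMr.
have [] := clip01P (N%:R * t + N%:R + 1 - (2%:R * N%:R + 1 + 1));
have [] := clip01P (N%:R * t + N%:R + 1); move=> [-> ?] [-> ?]; lra.
Qed.

Lemma prod_dist (I : Type) (r : seq I) (a b : I -> R) :
  (forall i, 0 <= a i <= 1) -> (forall i, 0 <= b i <= 1) ->
  `|\prod_(i <- r) a i - \prod_(i <- r) b i| <= \sum_(i <- r) `|a i - b i|.
Proof.
move=> a01 b01; elim: r => [|i r IH]; first by rewrite !big_nil subrr normr0.
rewrite !big_cons.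
have p0 (f : I -> R) : (forall i, 0 <= f i <= 1) -> 0 <= \prod_(j <- r) f j <= 1.
  move=> f01; rewrite prodr_ge0 => [|j _]; last by have /andP[] := f01 j.
  by rewrite prodr_ile1// => j _; exact: f01.
have -> : a i * \prod_(j <- r) a j - b i * \prod_(j <- r) b j =
  (a i - b i) * \prod_(j <- r) a j + b i * (\prod_(j <- r) a j - \prod_(j <- r) b j) by ring.
apply: le_trans (ler_normD _ _) _; rewrite !normrM; apply: lerD.
  have /andP[q0 q1] := p0 _ a01.
  by rewrite ler_piMr// ger0_norm.
have /andP[q0 q1] := b01 i.
by rewrite (ger0_norm q0); apply: le_trans IH; rewrite ler_piMl.
Qed.

(** Products of coordinate tents over a cubic mesh. The Lipschitz bound, beyond continuity, controls
    the Riemann sums in the radius uniformly over the directions. *)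
Lemma partition_of_unity (d : nat) (eps : R) : 0 < eps ->
  exists (I : finType) (chi : I -> 'rV[R]_d -> R) (L : R),
  [/\ 0 <= L, forall c x, 0 <= chi c x <= 1,
      forall c x y, `|chi c x - chi c y| <= L * `|x - y|,
      forall x, `|x| <= 1 -> \sum_c chi c x = 1 &
      forall c x y, chi c x != 0 -> chi c y != 0 -> `|x - y| <= eps].
Proof.
(* The support of a tent has width [2 / N], which this choice makes at most [eps]. *)
move=> eps0; pose N := (Num.truncn (2 / eps)).+1.
have N0 : 0 < N%:R :> R by rewrite ltr0n.
have Neps : 2 <= N%:R * eps.
  by rewrite -ler_pdivrMr// ltW// truncnS_gt.
exists {ffun 'I_d -> 'I_(2 * N).+2}, 
  (fun (c : {ffun 'I_d -> 'I_(2 * N).+2}) (x : 'rV[R]_d) => \prod_k ramp N (c k) (x 0 k)),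
  (d%:R * (2 * N%:R)); split; first by rewrite !mulr_ge0.
- move=> c x; rewrite prodr_ge0 => [|k _]; last by have /andP[] := ramp01 N (c k) (x 0 k).
  by rewrite prodr_ile1// => k _; exact: ramp01.
- move=> c x y; apply: le_trans (prod_dist _ _ _) _ => [i|i|]; try exact: ramp01.
  rewrite -mulrA -[X in X%:R](card_ord d) -sumr_const mulr_suml.
  apply: ler_sum => k _; apply: le_trans (ramp_lipschitz _ _ _ _) _.
  rewrite mul1r ler_wpM2l//; have := mx_norm_entry (x - y) 0 k; rewrite !mxE.
  exact: le_trans.
- move=> x x1; rewrite -(bigA_distr_bigA (fun k (c : 'I_(2 * N).+2) => ramp N c (x 0 k))).
  rewrite big1// => k _; rewrite ramp_sum//.
  exact: le_trans (mx_norm_entry _ _ _) x1.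
- move=> c x y /prodf_neq0 cx /prodf_neq0 cy; apply: mx_norm_le (ltW eps0) _ => i k.
  rewrite (ord1 i) !mxE -(ler_pM2l N0); apply: le_trans Neps.
  exact: ramp_support (cx k isT) (cy k isT).
Qed.

End partition_of_unity.

(** * Borel sets, laws and expectations *)

Section matrix_borel.
Context {R : realType} {m n : nat}.
Implicit Types A U : set 'M[R]_(m, n).

Lemma open_measurable_mx U : open U -> measurable U.
Proof. exact: sub_sigma_algebra. Qed.

Lemma closed_measurable_mx A : closed A -> measurable A.
Proof. move=> cA; rewrite -(setCK A); apply: measurableC; apply: open_measurable_mx.
by rewrite openC. Qed.

Lemma continuous_measurable_mx (f : 'M[R]_(m, n) -> R) :
  continuous f -> measurable_fun setT f.
Proof.
move=> cf; apply: (measurability _ (RGenOpens.measurableE R)).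
move=> _ [_ [a [b ->]] <-]; rewrite setTI; apply: open_measurable_mx.
apply: open_comp; last exact: interval_open.
by move=> x _; exact: cf.
Qed.

Lemma measurable_coord i j : measurable_fun setT (fun x : 'M[R]_(m, n) => x i j).
Proof. by apply: continuous_measurable_mx; exact: coord_continuous. Qed.

(** Rational sup-norm cubes form a countable base. This is what makes a matrix-valued map measurable
    as soon as its entries are, the Borel structure being generated by open sets and not given as a
    product. *)
Definition rat_ball (c : 'M[rat]_(m, n) * nat) : set 'M[R]_(m, n) :=
  [set y | forall i j, `|ratr (c.1 i j) - y i j| < c.2.+1%:R^-1].

Lemma open_bigcup_rat_ball U : open U ->
  U = \bigcup_(c in [set c | rat_ball c `<=` U]) rat_ball c.
Proof.
move=> oU; apply/seteqP; split => [x Ux|x [c cU cx]]; last exact: cU.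
have /nbhs_ballP[e /= e0 eU] : nbhs x U by exact: open_nbhs_nbhs.
(* The rational centre may be a full radius away from [x], so two radii must fit into [e]. *)
pose k := Num.truncn (2 / e).
have k0 : 0 < k.+1%:R :> R by rewrite ltr0n.
have ke : k.+1%:R^-1 * 2 <= e.
  by rewrite ler_pdivrMl// mulrC -ler_pdivrMl// mulrC ltW// truncnS_gt.
have qx i j : {q : rat | `|ratr q - x i j| < k.+1%:R^-1}.
  apply: cid; have : x i j - k.+1%:R^-1 < x i j + k.+1%:R^-1.
    by rewrite ltrBlDr -addrA ltrDl addr_gt0 ?invr_gt0.
  move=> /rat_in_itvoo[q]; rewrite inE/= => /itvP qP; exists q.
  by rewrite ltr_distl !qP.
exists (\matrix_(i, j) sval (qx i j), k) => [y|] /=; last first.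
  by move=> i j /=; rewrite mxE; exact: (svalP (qx i j)).
move=> yq; apply: eU; split => // i j; have := yq i j; rewrite /= mxE /ball/= => H1.
have H2 := svalP (qx i j).
apply: le_lt_trans (ler_distD (ratr (sval (qx i j))) _ _) _.
by rewrite distrC; apply: lt_le_trans (ltrD H2 H1) _; move: ke; rewrite mulr_natr mulr2n.
Qed.

Lemma measurable_fun_mx d (T : measurableType d) (g : T -> 'M[R]_(m, n)) :
  (forall i j, measurable_fun setT (fun t => g t i j)) -> measurable_fun setT g.
Proof.
move=> mg; apply: (measurability _ (erefl : measurable = <<s @open 'M[R]_(m, n) >>)).
move=> _ [U oU <-]; rewrite setTI (open_bigcup_rat_ball oU) preimage_bigcup.
rewrite bigcup_mkcond; apply: countable_bigcupT_measurable => [|c]; first exact: countableP.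
case: ifPn => // _.
have -> : g @^-1` rat_ball c = \bigcap_(ij in [set: 'I_m * 'I_n])
    (fun t => `|ratr (c.1 ij.1 ij.2) - g t ij.1 ij.2|) @^-1` `]-oo, c.2.+1%:R^-1[.
  apply/seteqP; split => [t ct [i j] _|t ct i j] /=; first by rewrite in_itv/=; exact: ct.
  by have := ct (i, j) I; rewrite /= in_itv.
apply: fin_bigcap_measurable => // -[i j] _.
rewrite -[X in measurable X]setTI.
suff mf : measurable_fun setT (fun t => `|ratr (c.1 i j) - g t i j|) by exact: mf.
by apply: measurableT_comp => //; apply: measurable_funB.
Qed.

End matrix_borel.

Section equal_laws.
Context {R : realType} {d} {Omega : measurableType d} (P : probability Omega R).
Context {T : pointedType} (G : set (set T)).
Hypothesis GI : setI_closed G.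
Hypothesis GT : G setT.

(** Dynkin's theorem: two laws that agree on the generating pi-system [G] are equal. The space is
    abstract so as to serve both finite sequences and coded pairs of samples. *)
Lemma eq_law_integral (X Y : Omega -> g_sigma_algebraType G)
    (f : g_sigma_algebraType G -> R) :
  (forall A, G A -> measurable (X @^-1` A)) ->
  (forall A, G A -> measurable (Y @^-1` A)) ->
  (forall A, G A -> P (X @^-1` A) = P (Y @^-1` A)) ->
  measurable_fun setT f -> (forall t, 0 <= f t) ->
  (\int[P]_w (f (X w))%:E = \int[P]_w (f (Y w))%:E)%E.
Proof.
move=> gX gY XY mf f0.
have mX : measurable_fun setT X.
  apply: (@measurability _ _ Omega (g_sigma_algebraType G) setT _ G erefl).
  by move=> _ [A GA <-]; rewrite setTI; exact: gX.
have mY : measurable_fun setT Y.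
  apply: (@measurability _ _ Omega (g_sigma_algebraType G) setT _ G erefl).
  by move=> _ [A GA <-]; rewrite setTI; exact: gY.
pose XX : {mfun Omega >-> g_sigma_algebraType G} := HB.pack X (isMeasurableFun.Build _ _ _ _ _ mX).
pose YY : {mfun Omega >-> g_sigma_algebraType G} := HB.pack Y (isMeasurableFun.Build _ _ _ _ _ mY).
have mEf : measurable_fun setT (EFin \o f) by exact/measurable_EFinP.
have f0' t : (0 <= (EFin \o f) t)%E by rewrite lee_fin.
have -> : (\int[P]_w (f (X w))%:E = \int[distribution P XX]_t (f t)%:E)%E.
  by rewrite ge0_integral_distribution.
have -> : (\int[P]_w (f (Y w))%:E = \int[distribution P YY]_t (f t)%:E)%E.
  by rewrite ge0_integral_distribution.
apply: eq_measure_integral => A mA _.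
apply: (@measure_unique _ R (g_sigma_algebraType G) G (fun=> setT)) => //.
- by rewrite bigcup_const.
- by move=> k; rewrite (le_lt_trans (probability_le1 _ _))// ltry.
Qed.

End equal_laws.

Section product_law.
Context {R : realType} {dO} {Omega : measurableType dO} (P : probability Omega R).
Local Open Scope ereal_scope.

(** Stated along every injective choice of indices, so that subsamples and relabelled samples are
    covered at once. *)
Definition product_law {d} {T : measurableType d} (Z : nat -> Omega -> T)
    (mu : set T -> \bar R) : Prop :=
  forall k (e : 'I_k -> nat) (A : 'I_k -> set T), injective e ->
    (forall a, measurable (A a)) ->
    P [set w | forall a, A a (Z (e a) w)] = \prod_(a < k) mu (A a).

Lemma iid_product_law {d} {T : measurableType d} (Z : nat -> Omega -> T)
    (X : Omega -> T) :
  iid_copies P Z X -> product_law Z (fun A => P (X @^-1` A)).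
Proof.
move=> [indep ident] k e A einj mA.
pose B j := if [pick a | e a == j] is Some a then A a else setT.
have Be a : B (e a) = A a.
  rewrite /B; case: pickP => [a' /eqP /einj -> //|/(_ a)].
  by rewrite eqxx.
have mB j : measurable (B j) by rewrite /B; case: pickP => // a _.
pose I := [fset e a | a in 'I_k]%fset.
have := indep I B mB.
have -> : (\bigcap_(i in [set` I]) Z i @^-1` B i = [set w | forall a, A a (Z (e a) w)]).
  apply/seteqP; split => [w Hw a|w Hw j].
    by rewrite -Be; apply: (Hw (e a)) => /=; apply/imfsetP; exists a.
  by move=> /imfsetP[a _ ->]; rewrite /preimage/= Be.
move=> ->.
have /(perm_big _) -> /= : perm_eq (enum_fset I) [seq e a | a <- enum 'I_k].
  apply: uniq_perm; rewrite ?fset_uniq ?(map_inj_uniq einj) ?enum_uniq//.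
  move=> j; apply/imfsetP/mapP => [[a _ ->]|[a _ ->]]; first by exists a; rewrite ?mem_enum.
  by exists a.
rewrite big_map big_enum/=; apply: eq_bigr => a _.
by rewrite Be ident.
Qed.

End product_law.

Section bounded_measurable.
Context {R : realType} {d} {T : measurableType d}.
Implicit Types f g : T -> R.

(** A class stable under the algebraic operations and integrable for every probability: linearity of
    the expectation then has no other side condition. *)
Definition bounded_measurable f : Prop :=
  measurable_fun setT f /\ exists M, forall t, `|f t| <= M.

Lemma bounded_measurable_cst (c : R) : bounded_measurable (fun=> c).
Proof. by split => //; exists `|c|. Qed.

Lemma bounded_measurableD f g : bounded_measurable f -> bounded_measurable g ->
  bounded_measurable (fun t => f t + g t).
Proof.
move=> [mf [M fM]] [mg [N gN]]; split; first exact: measurable_funD.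
by exists (M + N) => t; apply: le_trans (ler_normD _ _) _; apply: lerD.
Qed.

Lemma bounded_measurableM f g : bounded_measurable f -> bounded_measurable g ->
  bounded_measurable (fun t => f t * g t).
Proof.
move=> [mf [M fM]] [mg [N gN]]; split; first exact: measurable_funM.
by exists (M * N) => t; rewrite normrM; apply: ler_pM.
Qed.

Lemma bounded_measurable_sqr f : bounded_measurable f ->
  bounded_measurable (fun t => f t ^+ 2).
Proof.
move=> bf; rewrite (_ : (fun _ => _) = fun t => f t * f t) //.
exact: bounded_measurableM.
Qed.

Lemma bounded_measurableZ c f : bounded_measurable f ->
  bounded_measurable (fun t => c * f t).
Proof. exact/bounded_measurableM/bounded_measurable_cst. Qed.

Lemma bounded_measurableN f : bounded_measurable f ->
  bounded_measurable (fun t => - f t).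
Proof.
move=> /(bounded_measurableZ (-1)); congr bounded_measurable.
by apply/funext => t; rewrite mulN1r.
Qed.

Lemma bounded_measurableB f g : bounded_measurable f -> bounded_measurable g ->
  bounded_measurable (fun t => f t - g t).
Proof. by move=> bf bg; apply: bounded_measurableD => //; exact: bounded_measurableN. Qed.

Lemma bounded_measurable_norm f : bounded_measurable f ->
  bounded_measurable (fun t => `|f t|).
Proof.
move=> [mf [M fM]]; split; first exact: measurableT_comp.
by exists M => t; rewrite normr_id.
Qed.

Lemma bounded_measurable_sum (I : Type) (r : seq I) (p : pred I) (f : I -> T -> R) :
  (forall i, bounded_measurable (f i)) ->
  bounded_measurable (fun t => \sum_(i <- r | p i) f i t).
Proof.
move=> bf; elim: r => [|i r IH].
  have -> : (fun t => \sum_(i <- [::] | p i) f i t) = cst 0.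
    by apply/funext => t; rewrite big_nil.
  exact: bounded_measurable_cst.
have -> : (fun t => \sum_(j <- i :: r | p j) f j t) =
   (fun t => (if p i then f i t else 0) + \sum_(j <- r | p j) f j t).
  by apply/funext => t; rewrite big_cons; case: ifP; rewrite ?add0r.
apply: bounded_measurableD => //; case: (p i) => //.
exact: bounded_measurable_cst.
Qed.

Lemma bounded_measurable_indic (A : set T) : measurable A ->
  bounded_measurable (\1_A : T -> R).
Proof.
move=> mA; split; first exact: measurable_indic.
by exists 1 => t; rewrite /= indicE ger0_norm// lern1 leq_b1.
Qed.

Lemma bounded_measurable_comp d' (T' : measurableType d') (f : T -> R) (X : T' -> T) :
  measurable_fun setT X -> bounded_measurable f ->
  measurable_fun setT (f \o X) /\ exists M, forall t, `|f (X t)| <= M.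
Proof. by move=> mX [mf [M fM]]; split; [exact: measurableT_comp|exists M]. Qed.

End bounded_measurable.

Section expectation.
Context {R : realType} {d} {T : measurableType d} (P : probability T R).
Implicit Types f g : T -> R.

Lemma bounded_measurable_integrable f : bounded_measurable f ->
  P.-integrable setT (EFin \o f).
Proof.
move=> [mf [M fM]]; apply: measurable_bounded_integrable => //.
  by rewrite (le_lt_trans (probability_le1 _ _))// ltry.
by exists M; split; [exact: num_real|move=> x Mx t _; apply: le_trans (fM t) _; exact: ltW].
Qed.

Lemma expect_cst (c : R) : \int[P]_t c = c.
Proof.
rewrite Rintegral_cst// -[RHS]mulr1; congr (_ * _).
by have := congr1 fine (probability_setT P).
Qed.

Lemma expect_ge0 f : (forall t, 0 <= f t) -> 0 <= \int[P]_t f t.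
Proof. by move=> f0; apply: Rintegral_ge0. Qed.

Lemma expectD f g : bounded_measurable f -> bounded_measurable g ->
  \int[P]_t (f t + g t) = \int[P]_t f t + \int[P]_t g t.
Proof. by move=> *; apply: RintegralD => //; exact: bounded_measurable_integrable. Qed.

Lemma expectB f g : bounded_measurable f -> bounded_measurable g ->
  \int[P]_t (f t - g t) = \int[P]_t f t - \int[P]_t g t.
Proof. by move=> *; apply: RintegralB => //; exact: bounded_measurable_integrable. Qed.

Lemma expectZ c f : bounded_measurable f ->
  \int[P]_t (c * f t) = c * \int[P]_t f t.
Proof. by move=> *; apply: RintegralZl => //; exact: bounded_measurable_integrable. Qed.

Lemma expect_sum (I : Type) (r : seq I) (p : pred I) (f : I -> T -> R) :
  (forall i, bounded_measurable (f i)) ->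
  \int[P]_t \sum_(i <- r | p i) f i t = \sum_(i <- r | p i) \int[P]_t f i t.
Proof.
move=> bf; elim: r => [|i r IH].
  rewrite big_nil -[RHS](expect_cst 0); congr fine; apply: eq_integral => t _.
  by rewrite big_nil.
rewrite big_cons -IH; case: ifPn => pi.
  rewrite -expectD//; last exact: bounded_measurable_sum.
  by apply: eq_Rintegral => t _; rewrite big_cons pi.
by apply: eq_Rintegral => t _; rewrite big_cons (negbTE pi).
Qed.

Lemma expect_le f g : bounded_measurable f -> bounded_measurable g ->
  (forall t, f t <= g t) -> \int[P]_t f t <= \int[P]_t g t.
Proof.
by move=> bf bg fg; apply: le_Rintegral => //; exact: bounded_measurable_integrable.
Qed.

Lemma expect_indic (A : set T) : measurable A -> \int[P]_t \1_A t = fine (P A).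
Proof. by move=> mA; rewrite /Rintegral integral_indic// setIT. Qed.

Lemma expect_le_ae f g (N : set T) : bounded_measurable f -> bounded_measurable g ->
  measurable N -> P N = 0%E ->
  (forall t, ~ N t -> f t <= g t) -> \int[P]_t f t <= \int[P]_t g t.
Proof.
move=> bf bg mN N0 fg; have [_ [M fM]] := bf; have [_ [M' gM']] := bg.
have b1 : bounded_measurable (fun t => (M + M') * \1_N t).
  exact/bounded_measurableZ/bounded_measurable_indic.
(* Adding [M + M'] on the null set leaves the integral unchanged and makes the inequality hold
   everywhere. *)
have -> : \int[P]_t g t = \int[P]_t (g t + (M + M') * \1_N t).
  rewrite expectD// expectZ; last exact: bounded_measurable_indic.
  by rewrite expect_indic// N0 mulr0 addr0.
apply: expect_le => // [|t]; first exact: bounded_measurableD.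
have [Nt|Nt] := pselect (N t).
  rewrite indicE mem_set// mulr1.
  by have := fM t; have := gM' t; rewrite !ler_norml; lra.
by rewrite indicE memNset// mulr0 addr0; exact: fg.
Qed.

Lemma expect_markov f (c : R) : bounded_measurable f -> (forall t, 0 <= f t) -> 0 < c ->
  c * fine (P [set t | c <= f t]) <= \int[P]_t f t.
Proof.
move=> bf f0 c0.
have mA : measurable [set t | c <= f t].
  have -> : [set t | c <= f t] = f @^-1` `[c, +oo[.
    by apply/seteqP; split => t /=; rewrite in_itv/= andbT.
  by rewrite -[X in measurable X]setTI; apply: (proj1 bf).
rewrite -expect_indic// -expectZ; last exact: bounded_measurable_indic.
apply: expect_le => // [|t]; first exact/bounded_measurableZ/bounded_measurable_indic.
rewrite indicE; have [cf|cf] := boolP (t \in [set t | c <= f t]); last by rewrite mulr0.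
by rewrite mulr1; move: cf; rewrite inE.
Qed.

Lemma fine_probability_le (A B : set T) : measurable A -> measurable B -> A `<=` B ->
  fine (P A) <= fine (P B).
Proof.
move=> mA mB AB; rewrite fine_le ?fin_num_measure//.
by apply: le_measure => //; rewrite inE.
Qed.

(** The [B j] need not increase. The sets on which all later [B i] hold do, and their union contains
    [G], so continuity from below applies. This serves for tails, for regular points and for
    continuity points. *)
Lemma exhausting_probability (B : nat -> set T) (G : set T) (e : R) :
  (forall j, measurable (B j)) -> measurable G -> P (~` G) = 0%E ->
  (forall t, G t -> exists j0, forall j, (j0 <= j)%N -> B j t) -> 0 < e ->
  exists j0, fine (P (~` (B j0))) <= e.
Proof.
move=> mB mG G0 GB e0.
pose C j := \bigcap_(i in [set i | (j <= i)%N]) B i.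
have mC j : measurable (C j) by apply: bigcap_measurable => //; exists j => /=.
have mU : measurable (\bigcup_j C j) by exact: bigcupT_measurable.
have CU : P (\bigcup_j C j) = 1%E.
  apply/eqP; rewrite eq_le probability_le1//=.
  have -> : 1%E = P G.
    have := probability_setC P mG; rewrite G0 -(@fineK _ (P G)) ?fin_num_measure// -EFinB.
    by move=> -[/esym/eqP]; rewrite subr_eq0 => /eqP <-.
  apply: le_measure; rewrite ?inE// => t /GB[j0 Hj]; exists j0 => // j; exact: Hj.
have cC : P (C j) @[j --> \oo] --> P (\bigcup_j C j).
  apply: nondecreasing_cvg_mu => // i j ij; apply/subsetPset => t Ct k /= jk.
  by apply: Ct => /=; exact: leq_trans jk.
rewrite CU in cC.
have /fine_cvgP[_] := cC; move=> /cvgrPdist_le /(_ _ e0)[j0 _ /(_ j0 (leqnn j0))]/=.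
rewrite distrC => H; exists j0.
have BC : ~` (B j0) `<=` ~` (C j0) by apply: subsetC => t; apply => /=.
apply: le_trans (fine_probability_le _ _ BC) _; try exact: measurableC.
rewrite probability_setC// fineB ?fin_num_measure//=.
by move: H; rewrite ler_norml; lra.
Qed.

End expectation.

Section product_law_consequences.
Context {R : realType} {dO} {Omega : measurableType dO} (P : probability Omega R).
Context {d} {T : measurableType d} (Z : nat -> Omega -> T) (mu : probability T R).
Hypothesis mZ : forall i, measurable_fun setT (Z i).
Hypothesis lawZ : product_law P Z mu.

Lemma product_law1 i (A : set T) : measurable A -> P (Z i @^-1` A) = mu A.
Proof.
move=> mA.
have inj : injective (fun _ : 'I_1 => i) by move=> a b _; rewrite (ord1 a) (ord1 b).
have := lawZ inj (fun _ => mA); rewrite big_ord1 => <-; congr (P _).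
by apply/seteqP; split => [w Aw a|w /(_ ord0)].
Qed.

Lemma product_law2 i j (A B : set T) : i != j -> measurable A -> measurable B ->
  P [set w | A (Z i w) /\ B (Z j w)] = (mu A * mu B)%E.
Proof.
move=> ij mA mB; pose e (a : 'I_2) := if a == 0 then i else j.
have inj : injective e.
  by move=> [[|[|//]] a2] [[|[|//]] b2]; rewrite /e/= => E; apply/val_inj => //=;
    move: ij; rewrite E eqxx.
have mC (a : 'I_2) : measurable (if a == 0 then A else B) by case: ifP.
have := lawZ inj mC; rewrite big_ord_recl big_ord1/= => <-; congr (P _).
apply/seteqP; split => [w [Aw Bw] a|w H]; first by rewrite /e; case: ifP.
by split; [exact: (H ord0)|exact: (H (lift ord0 ord0))].
Qed.

Lemma product_law_integral i (f : T -> R) : bounded_measurable f ->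
  \int[P]_w f (Z i w) = \int[mu]_x f x.
Proof.
move=> bf.
pose ZZ : {mfun Omega >-> T} := HB.pack (Z i) (isMeasurableFun.Build _ _ _ _ _ (mZ i)).
have E : (\int[distribution P ZZ]_x (f x)%:E = \int[mu]_x (f x)%:E)%E.
  by apply: eq_measure_integral => A mA _; exact: product_law1.
rewrite /Rintegral -E; congr fine; rewrite integral_distribution//.
  exact/measurable_EFinP/(proj1 bf).
rewrite -/(random_variable _ _).
have [mf [M fM]] := bf.
apply: measurable_bounded_integrable => //.
- by rewrite (le_lt_trans (probability_le1 P _))// ltry.
- exact: measurableT_comp.
by exists M; split; [exact: num_real|move=> x Mx t _; apply: le_trans (fM _) _; exact: ltW].
Qed.

Lemma product_law_integral2 i j (f g : T -> R) : i != j ->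
  bounded_measurable f -> bounded_measurable g ->
  (forall x, 0 <= f x) -> (forall x, 0 <= g x) ->
  \int[P]_w (f (Z i w) * g (Z j w)) = \int[mu]_x f x * \int[mu]_x g x.
Proof.
move=> ij bf bg f0 g0.
have mp : measurable_fun setT (fun w => (Z i w, Z j w)) by exact: measurable_fun_pair.
pose ZZ : {mfun Omega >-> (T * T)%type} :=
  HB.pack (fun w => (Z i w, Z j w)) (isMeasurableFun.Build _ _ _ _ _ mp).
have mfg : measurable_fun setT (fun x : T * T => (f x.1 * g x.2)%:E).
  apply/measurable_EFinP/measurable_funM; apply: measurableT_comp => //.
  - exact: (proj1 bf).
  - exact: (proj1 bg).
have E : (\int[distribution P ZZ]_x (f x.1 * g x.2)%:E =
    \int[mu \x mu]_x (f x.1 * g x.2)%:E)%E.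
  apply: eq_measure_integral => A mA _.
  apply/esym; refine (@product_measure_unique _ _ _ _ _ mu mu (distribution P ZZ) _ A mA) => B C mB mC.
  by rewrite -(product_law2 ij mB mC).
have fin (h : T -> R) : bounded_measurable h -> (\int[mu]_x (h x)%:E)%E \is a fin_num.
  by move=> bh; apply: integrable_fin_num => //; exact: bounded_measurable_integrable.
rewrite /Rintegral -fineM ?fin//; congr fine.
transitivity (\int[distribution P ZZ]_x (f x.1 * g x.2)%:E)%E.
  by rewrite ge0_integral_distribution// => x; rewrite lee_fin mulr_ge0.
rewrite E fubini_tonelli1//; last by move=> x; rewrite lee_fin mulr_ge0.
rewrite /fubini_F /=.
under eq_integral => x _.
  under eq_integral do rewrite EFinM.
  rewrite ge0_integralZl//; last first.
  - by rewrite lee_fin.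
  - by move=> y _; rewrite lee_fin.
  - exact/measurable_EFinP/(proj1 bg).
  over.
rewrite ge0_integralZr//.
- exact/measurable_EFinP/(proj1 bf).
- by move=> x _; rewrite lee_fin.
- by apply: integral_ge0 => x _; rewrite lee_fin.
Qed.

(** The centred variables are uncorrelated and bounded by 1, so their mean [S] has variance at most
    [1 / n]; the passage to the first moment is [|S| <= S ^ 2 / e + e / 4]. Convergence in mean is
    the form needed for bounds that are integrated later. *)
Lemma law_of_large_numbers (f : T -> R) (e : R) : measurable_fun setT f ->
  (forall x, 0 <= f x <= 1) -> 0 < e ->
  \forall n \near \oo,
    \int[P]_w `|n%:R^-1 * (\sum_(i < n) f (Z i w)) - \int[mu]_x f x| <= e.
Proof.
move=> mf f01 e0.
have f0 x : 0 <= f x by have /andP[] := f01 x.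
have bf : bounded_measurable f.
  by split => //; exists 1 => x; have /andP[? ?] := f01 x; rewrite ger0_norm.
pose c := \int[mu]_x f x.
have c0 : 0 <= c by exact: expect_ge0.
have c1 : c <= 1.
  rewrite -(expect_cst mu 1); apply: expect_le => //; first exact: bounded_measurable_cst.
  by move=> x; have /andP[] := f01 x.
have bfZ i : bounded_measurable (fun w => f (Z i w)).
  exact: (bounded_measurable_comp (mZ i) bf).
pose Y i w := f (Z i w) - c.
have bY i : bounded_measurable (Y i).
  by apply: bounded_measurableB => //; exact: bounded_measurable_cst.
have EY i j : \int[P]_w (Y i w * Y j w) <= (i == j)%:R.
  have [->|ij] := eqVneq i j.
    rewrite -[leRHS](expect_cst P); apply: expect_le; first exact: bounded_measurableM.
      exact: bounded_measurable_cst.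
    by move=> w; rewrite /Y; have /andP[? ?] := f01 (Z j w); rewrite /=; nra.
  rewrite (_ : (fun w => Y i w * Y j w) = fun w => (f (Z i w) * f (Z j w) -
      (c * f (Z i w) + c * f (Z j w))) + c * c); last first.
    by apply/funext => w; rewrite /Y; ring.
  have b1 : bounded_measurable (fun w => f (Z i w) * f (Z j w)) by exact: bounded_measurableM.
  have b2 k : bounded_measurable (fun w => c * f (Z k w)) by exact: bounded_measurableZ.
  rewrite expectD; [|by apply: bounded_measurableB => //; exact: bounded_measurableD|exact: bounded_measurable_cst].
  rewrite expectB//; last exact: bounded_measurableD.
  rewrite expectD// (expectZ P c (bfZ i)) (expectZ P c (bfZ j)) (product_law_integral2 ij bf bf f0 f0) !(product_law_integral _ bf) expect_cst.
  by rewrite -/c/=; lra.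
have nE n : (0 < n)%N -> \int[P]_w `|n%:R^-1 * (\sum_(i < n) f (Z i w)) - c| <=
    (n%:R * e)^-1 + e / 4.
  move=> n0; have n0R : 0 < n%:R :> R by rewrite ltr0n.
  pose S w := n%:R^-1 * \sum_(i < n) Y i w.
  have SE w : n%:R^-1 * (\sum_(i < n) f (Z i w)) - c = S w.
    rewrite /S /Y sumrB sumr_const card_ord -[c *+ n]mulr_natl mulrBr mulrA.
    by rewrite mulVf ?mul1r// gt_eqF.
  have bS : bounded_measurable S by apply: bounded_measurableZ; exact: bounded_measurable_sum.
  under eq_Rintegral do rewrite SE.
  apply: le_trans (_ : \int[P]_w (e^-1 * (S w * S w) + e / 4) <= _).
    apply: expect_le; first exact: bounded_measurable_norm.
      apply: bounded_measurableD; last exact: bounded_measurable_cst.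
      by apply: bounded_measurableZ; exact: bounded_measurableM.
    move=> w; rewrite -(ler_pM2l e0).
    have -> : e * (e^-1 * (S w * S w) + e / 4) = S w * S w + e * e / 4.
      by field; rewrite gt_eqF.
    have : S w * S w = `|S w| * `|S w| by rewrite -normrM ger0_norm// -expr2 sqr_ge0.
    move=> ->; have := sqr_ge0 (`|S w| - e / 2); rewrite expr2; lra.
  have bSS : bounded_measurable (fun w => S w * S w) by exact: bounded_measurableM.
  rewrite (expectD P (bounded_measurableZ e^-1 bSS) (bounded_measurable_cst (e / 4))).
  rewrite (expectZ P _ bSS) expect_cst lerD2r.
  have -> : (n%:R * e)^-1 = e^-1 * n%:R^-1 by rewrite invfM mulrC.
  rewrite ler_pM2l ?invr_gt0//.
  rewrite (_ : (fun w => S w * S w) =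
    fun w => n%:R^-2 * \sum_(i < n) \sum_(j < n) Y i w * Y j w); last first.
    apply/funext => w; under [in RHS]eq_bigr do rewrite -mulr_sumr.
    by rewrite -mulr_suml -exprVn /S; ring.
  rewrite expectZ; last first.
    by apply: bounded_measurable_sum => i; apply: bounded_measurable_sum => j; exact: bounded_measurableM.
  rewrite expect_sum; last first.
    by move=> i; apply: bounded_measurable_sum => j; exact: bounded_measurableM.
  have -> : n%:R^-1 = n%:R^-2 * n%:R :> R.
    by rewrite -exprVn expr2 -mulrA mulVf ?mulr1// gt_eqF.
  rewrite ler_pM2l ?invr_gt0 ?exprn_gt0//.
  rewrite -[X in _ <= X%:R](card_ord n) -sumr_const; apply: ler_sum => i _.
  rewrite expect_sum; last by move=> j; exact: bounded_measurableM.
  apply: (@le_trans _ _ (\sum_(j < n) (i == j :> nat)%:R)).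
    by apply: ler_sum => j _; exact: EY.
  rewrite (bigD1 i)//= eqxx big1 ?addr0// => j.
  by rewrite -val_eqE eq_sym/= => /negbTE ->.
(* From [n1] on the variance term [(n * e)^-1] is at most [e / 2]. *)
pose n1 := (Num.truncn (2 / (e * e))).+1.
exists n1 => // n /= n1n.
have n0 : (0 < n)%N by apply: leq_trans n1n.
apply: le_trans (nE n n0) _.
have : 2 <= n%:R * (e * e).
  rewrite -ler_pdivrMr ?mulr_gt0//; apply: le_trans (ltW (truncnS_gt _)) _.
  by rewrite ler_nat.
have n0R : 0 < n%:R :> R by rewrite ltr0n.
move=> H.
have : (n%:R * e)^-1 <= e / 2.
  rewrite -(ler_pM2l (mulr_gt0 n0R e0)) mulfV; last by rewrite gt_eqF// mulr_gt0.
  lra.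
lra.
Qed.

End product_law_consequences.

(** * Absence of ties *)

Section rectangles.
Context {d} {T : measurableType d} (n : nat).

Definition rectangles : set (set ('I_n -> T)) :=
  [set E | exists2 A : 'I_n -> set T, (forall i, measurable (A i)) &
    E = [set z | forall i, A i (z i)]].

Lemma rectangles_setI : setI_closed rectangles.
Proof.
move=> _ _ [A mA ->] [B mB ->]; exists (fun i => A i `&` B i).
  by move=> i; exact: measurableI.
by apply/seteqP; split => [z [Az Bz] i|z H]; [split|split => i; have [] := H i].
Qed.

Lemma rectangles_setT : rectangles setT.
Proof. by exists (fun=> setT) => //; apply/seteqP; split. Qed.

(** A finite power of [T], with the sigma-algebra generated by the very rectangles on which
    [product_law] gives the probabilities. *)
Definition sequence_space := g_sigma_algebraType rectangles.

Lemma measurable_sequence_coord (i : 'I_n) :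
  measurable_fun setT (fun z : sequence_space => z i).
Proof.
move=> _ A mA; rewrite setTI; apply: sub_sigma_algebra.
exists (fun j => if j == i then A else setT) => [j|]; first by case: ifP.
apply/seteqP; split => [z /= Az j|z /(_ i)]; last by rewrite eqxx.
by case: eqP => // ->.
Qed.

End rectangles.
Arguments rectangles {d T} n _.
Arguments sequence_space {d T} n.

(** Provides a generating pi-system for the product of the sequence space with one more factor, as
    required to identify a joint law with a product measure. *)
Lemma product_rectangles_sigma {d d'} {T : measurableType d} {T' : measurableType d'} n :
  @measurable _ (sequence_space (T := T) n * T')%type =
  <<s [set A `*` B | A in rectangles n & B in measurable] >>.
Proof.
set C := (X in <<s X >>).
rewrite measurable_prod_measurableType; apply/seteqP; split; last first.
  apply: smallest_sub; first exact: smallest_sigma_algebra.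
  move=> _ [A rA [B mB <-]]; apply: sub_sigma_algebra.
  by exists A; [exact: sub_sigma_algebra|exists B].
apply: smallest_sub; first exact: smallest_sigma_algebra.
move=> _ [A mA [B mB <-]].
have -> : A `*` B = (A `*` setT) `&` (setT `*` B).
  by apply/seteqP; split => -[x y] /=; [move=> [? ?]|move=> [[? _] [_ ?]]].
suff [H1 H2] : (<<s C >> (A `*` setT) /\ <<s C >> (setT `*` B)).
  exact: (@measurableI _ (g_sigma_algebraType C)).
split; last first.
  by apply: sub_sigma_algebra; exists setT; [exact: rectangles_setT|exists B].
have mf : measurable_fun setT (fst : g_sigma_algebraType C -> sequence_space (T := T) n).
  apply: (@measurability _ _ _ (sequence_space (T := T) n) setT _ (rectangles n) erefl).
  move=> _ [E rE <-]; rewrite setTI; apply: sub_sigma_algebra.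
  by exists E => //; exists setT => //; apply/seteqP; split => -[x y]//= [].
have := mf measurableT A mA; rewrite setTI => H.
have -> : A `*` setT = fst @^-1` A :> set (_ * T') by apply/seteqP; split => -[x y]//= [].
exact: H.
Qed.

Section ties.
Context {R : realType} {dO} {Omega : measurableType dO} (P : probability Omega R).
Context {d : nat} (Z : nat -> Omega -> 'rV[R]_d) (mu : probability 'rV[R]_d R).
Hypothesis mZ : forall i, measurable_fun setT (Z i).
Hypothesis lawZ : product_law P Z mu.
Hypothesis hyperplane0 : forall (c : 'rV[R]_d) t, c != 0 -> mu [set x | dotp x c = t] = 0%E.

Lemma measurable_dotp {d'} {S : measurableType d'} (f g : S -> 'rV[R]_d) :
  measurable_fun setT f -> measurable_fun setT g ->
  measurable_fun setT (fun x => dotp (f x) (g x)).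
Proof.
move=> mf mg; apply: measurable_sum => i; apply: measurable_funM.
  by apply: (measurableT_comp (measurable_coord 0 i)).
by apply: (measurableT_comp (measurable_coord 0 i)).
Qed.

(** Given the other observations, the event confines [Z i0] to a hyperplane with normal [c i0],
    which is null; Fubini's theorem concludes. *)
Lemma linear_tie_negligible n (c : 'I_n -> 'rV[R]_d) (t : R) (i0 : 'I_n) : c i0 != 0 ->
  P [set w | \sum_(i < n) dotp (Z i w) (c i) = t] = 0%E.
Proof.
move=> c0.
(* All observations except [Z i0], whose slot holds the constant 0: [V] is independent of [Z i0] and
   stays in the same space. *)
pose V w : sequence_space (T := 'rV[R]_d) n :=
  fun i : 'I_n => if i == i0 then 0 else Z i w.
have Vrect (B : set 'rV[R]_d) (A : 'I_n -> set 'rV[R]_d) : measurable B ->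
    (forall i, measurable (A i)) ->
  P [set w | (forall i, A i (V w i)) /\ B (Z i0 w)] =
    (P [set w | forall i, A i (V w i)] * mu B)%E.
  move=> mB mA.
  have inj : injective (fun i : 'I_n => i : nat) by exact: val_inj.
  have [A0|A0] := pselect (A i0 0); last first.
    have -> : [set w | forall i, A i (V w i)] = set0.
      by apply/seteqP; split => // w /= /(_ i0); rewrite /V eqxx.
    rewrite measure0 mul0e; have -> : [set w | (forall i, A i (V w i)) /\ B (Z i0 w)] = set0.
      by apply/seteqP; split => // w /= [/(_ i0)]; rewrite /V eqxx.
    by rewrite measure0.
  have mB' i : measurable (if i == i0 then B else A i) by case: ifP.
  have mA' i : measurable (if i == i0 then setT else A i) by case: ifP.
  have -> : [set w | (forall i, A i (V w i)) /\ B (Z i0 w)] =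
      [set w | forall i : 'I_n, (if i == i0 then B else A i) (Z i w)].
    apply/seteqP; split => [w [H BZ] i|w H].
      by have := H i; rewrite /V; case: eqP => // ->.
    split=> [i|]; last by have := H i0; rewrite eqxx.
    by have := H i; rewrite /V; case: eqP => // ->.
  have -> : [set w | (forall i, A i (V w i))] =
      [set w | forall i : 'I_n, (if i == i0 then setT else A i) (Z i w)].
    apply/seteqP; split => [w H i|w H i].
      by have := H i; rewrite /V; case: eqP => // ->.
    by have := H i; rewrite /V; case: eqP => // ->.
  rewrite (lawZ inj mB') (lawZ inj mA') (bigD1 i0)//= [in RHS](bigD1 i0)//= eqxx.
  rewrite probability_setT mul1e muleC; congr (_ * _)%E.
  by apply: eq_bigr => i /negbTE ->.
have mV : measurable_fun setT V.
  apply: (@measurability _ _ _ (sequence_space (T := 'rV[R]_d) n) setT _ (rectangles n) erefl).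
  move=> _ [_ [A mA ->] <-]; rewrite setTI.
  have -> : V @^-1` [set z | forall i, A i (z i)] =
      \bigcap_(i in [set: 'I_n]) [set w | A i (V w i)].
    by apply/seteqP; split => [w H i _|w H i]; exact: H.
  apply: fin_bigcap_measurable => // i _; rewrite /V; case: eqP => _.
    have [A0|A0] := pselect (A i 0).
      by rewrite (_ : [set w | _] = setT)//; apply/seteqP; split.
    by rewrite (_ : [set w | _] = set0)//; apply/seteqP; split.
  by rewrite -[X in measurable X]setTI; exact: mZ.
pose VV : {mfun Omega >-> sequence_space (T := 'rV[R]_d) n} :=
  HB.pack V (isMeasurableFun.Build _ _ _ _ _ mV).
have mW : measurable_fun setT (fun w => (V w, Z i0 w)) by exact: measurable_fun_pair.
pose W : {mfun Omega >-> (sequence_space (T := 'rV[R]_d) n * 'rV[R]_d)%type} :=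
  HB.pack (fun w => (V w, Z i0 w)) (isMeasurableFun.Build _ _ _ _ _ mW).
have WE E : measurable E -> distribution P W E = (distribution P VV \x mu)%E E.
  move=> mE.
  refine (@measure_unique _ R (sequence_space (T := 'rV[R]_d) n * 'rV[R]_d)%type _ (fun=> setT)
    (product_rectangles_sigma n) _ _ _ (distribution P W) (distribution P VV \x mu)%E _ _ _ mE).
  - move=> _ _ [A rA [B mB <-]] [A' rA' [B' mB' <-]]; rewrite -setXI.
    by exists (A `&` A'); [exact: rectangles_setI|exists (B `&` B') => //; exact: measurableI].
  - by move=> _; exists setT; [exact: rectangles_setT|exists setT => //; rewrite setXTT].
  - by rewrite bigcup_const.
  - move=> _ [_ [A mA ->] [B mB <-]].
    have mrA : measurable ([set z | forall i, A i (z i)] : set (sequence_space n)).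
      by apply: sub_sigma_algebra; exists A.
    refine (etrans _ (esym (product_measure1E (distribution P VV) mu mrA mB))).
    exact: Vrect.
  - by move=> k; rewrite (le_lt_trans (probability_le1 (distribution P W) _))// ltry.
pose E : set (sequence_space (T := 'rV[R]_d) n * 'rV[R]_d) :=
  [set vx | dotp vx.2 (c i0) + \sum_(i < n | i != i0) dotp (vx.1 i) (c i) = t].
have mE : measurable E.
  have mS : measurable_fun setT (fun vx : sequence_space (T := 'rV[R]_d) n * 'rV[R]_d =>
      dotp vx.2 (c i0) + \sum_(i < n | i != i0) dotp (vx.1 i) (c i)).
    apply: measurable_funD; first exact: measurable_dotp.
    have -> : (fun vx : sequence_space (T := 'rV[R]_d) n * 'rV[R]_d =>
        \sum_(i < n | i != i0) dotp (vx.1 i) (c i)) =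
      (fun vx => \sum_(i < n) if i != i0 then dotp (vx.1 i) (c i) else 0).
      by apply/funext => vx; rewrite big_mkcond.
    apply: measurable_sum => i; case: (i != i0) => //; apply: measurable_dotp => //.
    have mc := measurable_sequence_coord (T := 'rV[R]_d) i.
    have mf : measurable_fun setT (@fst (sequence_space (T := 'rV[R]_d) n) 'rV[R]_d) by [].
    exact: (measurableT_comp mc mf).
  by rewrite -[E]setTI; apply: (mS measurableT [set t]).
have -> : [set w | \sum_(i < n) dotp (Z i w) (c i) = t] = W @^-1` E.
  have EE w : \sum_(i < n) dotp (Z i w) (c i) =
      dotp (W w).2 (c i0) + \sum_(i < n | i != i0) dotp ((W w).1 i) (c i).
    rewrite (bigD1 i0)//=; congr (_ + _).
    by apply: eq_bigr => i /negbTE; rewrite /V => ->.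
  by apply/seteqP; split => w /=; rewrite EE.
transitivity (distribution P W E) => //; rewrite WE// /product_measure1.
apply: integral0_eq => v _ /=.
rewrite (_ : xsection E v = [set x | dotp x (c i0) = t - \sum_(i < n | i != i0) dotp (v i) (c i)]).
  exact: hyperplane0.
apply/seteqP; split => x; rewrite /xsection /E/= inE/=; first by move=> <-; rewrite addrK.
by move=> ->; rewrite subrK.
Qed.

End ties.

(** * Hyperplanes are Lebesgue-null *)

Section hyperplanes.
Context {R : realType}.

Lemma lebesgue_outer_ge0 d (A : set 'rV[R]_d) : (0 <= lebesgue_outer A)%E.
Proof.
apply: le_ereal_inf_tmp => _ [a [b [ab _ ->]]]; apply: nneseries_ge0 => k _ _.
by rewrite lee_fin; apply: prodr_ge0 => i _; rewrite subr_ge0.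
Qed.

(** The finite cover is padded to a sequence by boxes reduced to the origin. Their volume is 0 in
    positive dimension, whereas the empty product would be 1. *)
Lemma lebesgue_outer_finite_cover d (A : set 'rV[R]_d.+1) (I : finType)
    (a b : I -> 'rV[R]_d.+1) : (forall i l, a i 0 l <= b i 0 l) ->
  (forall x, A x -> exists i, box (a i) (b i) x) ->
  (lebesgue_outer A <= (\sum_i box_volume (a i) (b i))%:E)%E.
Proof.
move=> ab cover; apply: ereal_inf_lbound.
pose s (f : I -> 'rV[R]_d.+1) k := nth 0 [seq f i | i <- enum I] k.
have sE f k (x0 : I) : (k < size (enum I))%N -> s f k = f (nth x0 (enum I) k).
  by move=> kI; rewrite /s (nth_map x0).
have s0 f k : (size (enum I) <= k)%N -> s f k = 0.
  by move=> kI; rewrite /s nth_default// size_map.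
exists (s a), (s b); split.
- move=> k l; have [kI|kI] := ltnP k (size (enum I)); last by rewrite !s0.
  have x0 : I by move: kI; case: (enum I).
  by rewrite !(sE _ _ x0).
- move=> x /cover[i xi]; exists (index i (enum I)) => //.
  by rewrite !(sE _ _ i) ?index_mem ?mem_enum// nth_index ?mem_enum.
have v0 k : (size (enum I) <= k)%N -> box_volume (s a k) (s b k) = 0.
  by move=> kI; rewrite /box_volume (bigD1 ord0)//= !s0// !mxE subr0 mul0r.
have v_ge0 k : (0 <= (box_volume (s a k) (s b k))%:E)%E.
  rewrite lee_fin; apply: prodr_ge0 => l _; rewrite subr_ge0.
  have [kI|kI] := ltnP k (size (enum I)); last by rewrite !s0.
  have x0 : I by move: kI; case: (enum I).
  by rewrite !(sE _ _ x0).
rewrite (nneseries_split 0 (size (enum I))) => [|k _]; last exact: v_ge0.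
rewrite add0n [X in (_ + X)%E]eseries0 ?adde0 => [|k kI _]; last by rewrite v0.
rewrite sumEFin; congr EFin.
have [E|[x0 _]] : enum I = [::] \/ exists x0 : I, x0 \in enum I.
    by case: (enum I) => [|x l]; [left|right; exists x; rewrite mem_head].
  rewrite E big_geq// big1// => i; have := mem_enum I i; by rewrite E.
rewrite -big_enum (big_nth x0) !big_nat; apply: eq_bigr => k /= kI.
by rewrite !(sE _ _ x0).
Qed.

(** Where [c 0 k] is nonzero the hyperplane is the graph of a function of the other coordinates,
    with Lipschitz constant [S] for the sup norm. Over a cell of side [h] it stays in a box of
    height [2 * S * h], so the total volume is of order [h]. *)
Lemma lebesgue_outer_hyperplane_cube d (c : 'rV[R]_d) (t : R) (M : nat) : c != 0 ->
  lebesgue_outer [set x | dotp x c = t /\ forall l, `|x 0 l| <= M.+1%:R] = 0%E.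
Proof.
case: d c => [|d] c; first by rewrite (_ : c = 0) ?eqxx//; apply/rowP => -[].
move=> c0; have [k ck] : exists k, c 0 k != 0.
  apply: contrapT => /forallNP H; move/eqP: c0; apply; apply/rowP => k.
  by have /negP := H k; rewrite negbK mxE => /eqP.
set m := M.+1%:R; have m0 : 0 < m :> R by rewrite ltr0n.
pose S := \sum_(l < d) `|c 0 (lift k l)| / `|c 0 k|.
have S0 : 0 <= S by apply: sumr_ge0 => l _; rewrite divr_ge0.
apply/eqP; rewrite eq_le lebesgue_outer_ge0 andbT.
apply/lee_addgt0Pr => e e0; rewrite add0e.
(* [K / N.+1] is the total volume of [N.+1 ^ d] boxes of volume [2 * (S * h) * h ^ d], with
   [h = 2 * m / N.+1]. *)
pose K := 4 * m * S * (2 * m) ^+ d.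
have K0 : 0 <= K by rewrite !mulr_ge0 ?exprn_ge0// ?mulr_ge0// ltW.
pose N := (Num.truncn (K / e)).
have N0 : 0 < N.+1%:R :> R by rewrite ltr0n.
have NK : K / N.+1%:R <= e.
  by rewrite ler_pdivrMr// mulrC -ler_pdivrMr// ltW// truncnS_gt.
pose h := 2 * m / N.+1%:R.
have h0 : 0 <= h by rewrite divr_ge0 ?mulr_ge0 ?ltW.
pose low (a : {ffun 'I_d -> 'I_N.+1}) l := - m + h * (a l)%:R.
pose y a := (t - \sum_(l < d) c 0 (lift k l) * low a l) / c 0 k.
pose lo a : 'rV[R]_d.+1 := \row_l if unlift k l is Some l' then low a l' else y a - S * h.
pose hi a : 'rV[R]_d.+1 := \row_l if unlift k l is Some l' then low a l' + h else y a + S * h.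
apply: le_trans (@lebesgue_outer_finite_cover d _ _ lo hi _ _) _.
- move=> a l; rewrite !mxE; case: unliftP => [l' _|_]; first by rewrite lerDl.
  by have := mulr_ge0 S0 h0; lra.
- move=> x [xt xm].
  (* The cell below [x]; the minimum with [N] puts the upper faces of the cube into the last
     cells. *)
  pose a : {ffun 'I_d -> 'I_N.+1} :=
    [ffun l => inord (minn (Num.truncn ((x 0 (lift k l) + m) / h)) N)].
  have hp : 0 < h by rewrite divr_gt0// mulr_gt0.
  have la l : low a l <= x 0 (lift k l) <= low a l + h.
    have := xm (lift k l); rewrite ler_norml => /andP[x1 x2].
    have q0 : 0 <= (x 0 (lift k l) + m) / h by rewrite divr_ge0// -lerBlDr sub0r.
    rewrite /low /a ffunE inordK ?ltnS ?geq_minr//.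
    set q := (x 0 (lift k l) + m) / h in q0 *.
    have xq : x 0 (lift k l) = - m + h * q by rewrite /q mulrC divfK ?gt_eqF//; ring.
    rewrite xq -addrA !lerD2l -[X in _ + X]mulr1 -mulrDr !ler_pM2l//.
    have qN : q <= N.+1%:R.
      by rewrite /q /h ler_pdivrMr// mulrC divfK ?gt_eqF//; lra.
    have tq : (Num.truncn q)%:R <= q by rewrite truncn_le.
    apply/andP; split.
      by apply: le_trans tq; rewrite ler_nat geq_minl.
    rewrite natr1; rewrite /minn; case: ltnP => _; first exact/ltW/truncnS_gt.
    exact: qN.
  exists a => l; rewrite !mxE; case: unliftP => [l' ->|->]; first exact: la.
  have -> : x 0 k = (t - \sum_(l < d) c 0 (lift k l) * x 0 (lift k l)) / c 0 k.
    rewrite -xt /dotp (bigD1_ord k)//=.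
    under [X in _ - X]eq_bigr do rewrite mulrC.
    by rewrite addrK mulfK.
  rewrite -ler_distl -mulrBl normrM normfV ler_pdivrMr ?normr_gt0//.
  rewrite opprB addrC addrA subrK -sumrB.
  apply: le_trans (ler_norm_sum _ _ _) _.
  rewrite /S mulrAC mulr_suml !mulr_suml; apply: ler_sum => l' _.
  rewrite divfK ?normr_eq0// -mulrBr normrM ler_wpM2l//.
  by have := la l'; rewrite ler_norml; lra.
rewrite lee_fin; apply: le_trans NK.
have vol a : box_volume (lo a) (hi a) = 2 * (S * h) * h ^+ d.
  rewrite /box_volume (bigD1_ord k)//= !mxE unlift_none; congr (_ * _); first by ring.
  rewrite (eq_bigr (fun=> h)) => [|l _]; first by rewrite prodr_const card_ord.
  by rewrite !mxE liftK; ring.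
under eq_bigr do rewrite vol.
rewrite sumr_const card_ffun !card_ord -[leLHS]mulr_natr natrX /K /h.
rewrite le_eqVlt; apply/orP; left; apply/eqP.
rewrite expr_div_n; field.
by rewrite expf_neq0 ?gt_eqF.
Qed.

Lemma abs_continuous_hyperplane d (mu : probability 'rV[R]_d R) (c : 'rV[R]_d) t :
  abs_continuous mu -> c != 0 -> mu [set x | dotp x c = t] = 0%E.
Proof.
move=> ac c0.
pose H M := [set x : 'rV[R]_d | dotp x c = t /\ forall l, `|x 0 l| <= M.+1%:R].
have mH M : measurable (H M).
  have -> : H M = (fun x => dotp x c) @^-1` [set t] `&`
      \bigcap_(l in [set: 'I_d]) (fun x : 'rV[R]_d => `|x 0 l|) @^-1` `]-oo, M.+1%:R].
    apply/seteqP; split => x [xt xM]; split => // l; last by have := xM l I; rewrite /= in_itv.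
    by move=> _ /=; rewrite in_itv/=; exact: xM.
  apply: measurableI.
    rewrite -[X in measurable X]setTI.
    have md : measurable_fun setT (fun x : 'rV[R]_d => dotp x c) by exact: measurable_dotp.
    exact: md.
  apply: fin_bigcap_measurable => // l _; rewrite -[X in measurable X]setTI.
  have ml : measurable_fun setT (fun x : 'rV[R]_d => `|x 0 l|).
    by apply: measurableT_comp => //; exact: measurable_coord.
  exact: ml.
have -> : [set x | dotp x c = t] = \bigcup_M H M.
  apply/seteqP; split => [x xt|x [M _ []]//].
  exists (Num.truncn `|x|) => //; split => // l.
  by apply: le_trans (mx_norm_entry _ _ _) _; exact/ltW/truncnS_gt.
apply/eqP; rewrite eq_le measure_ge0 andbT.
apply: le_trans (generalized_Boole_inequality mu mH (bigcupT_measurable _ mH)) _.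
rewrite eseries0// => M _ _; apply: ac => //.
exact: lebesgue_outer_hyperplane_cube.
Qed.

End hyperplanes.

(** * Averages over injections *)

Section injections.
Context {m n : nat}.
Implicit Types g h : {ffun 'I_m -> 'I_n}.

(** [postcomp] relabels the sample, [precomp] permutes the arguments of the kernel. *)
Definition postcomp (s : 'S_n) g : {ffun 'I_m -> 'I_n} := [ffun a => s (g a)].
Definition precomp g (t : 'S_m) : {ffun 'I_m -> 'I_n} := [ffun a => g (t a)].

Lemma postcomp_injectiveb s g : injectiveb (postcomp s g) = injectiveb g.
Proof.
apply/injectiveP/injectiveP => inj a b; first by move=> E; apply: inj; rewrite !ffunE E.
by rewrite !ffunE => /perm_inj /inj.
Qed.

Lemma precomp_injectiveb g t : injectiveb (precomp g t) = injectiveb g.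
Proof.
apply/injectiveP/injectiveP => inj a b.
  by move=> E; apply: (@perm_inj _ t^-1%g); apply: inj; rewrite !ffunE !permKV.
by rewrite !ffunE => /inj /perm_inj.
Qed.

Lemma postcomp_inj s : injective (postcomp s).
Proof.
by move=> g g' /ffunP E; apply/ffunP => a; have := E a; rewrite !ffunE => /perm_inj.
Qed.

Lemma postcompM s t g : postcomp (s * t)%g g = postcomp t (postcomp s g).
Proof. by apply/ffunP => a; rewrite !ffunE permM. Qed.

Definition ninj : nat := #|[pred g : {ffun 'I_m -> 'I_n} | injectiveb g]|.

(** Relabelling by a transposition maps the fibres of [g p] onto one another, so all [n] of them
    have the same size. *)
Lemma count_fixed1 (p : 'I_m) (x : 'I_n) :
  (n * #|[pred g : {ffun 'I_m -> 'I_n} | injectiveb g & g p == x]| <= ninj)%N.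
Proof.
rewrite /ninj -[X in (_ <= X)%N]sum1_card (partition_big (fun g : {ffun 'I_m -> 'I_n} => g p) xpredT)//=.
rewrite -[X in (X * _)%N](card_ord n) -sum_nat_const; apply: leq_sum => y _.
rewrite -[X in (X <= _)%N]sum1_card.
rewrite (reindex_inj (@postcomp_inj (tperm y x)))/=.
apply: eq_leq; apply: eq_bigl => g.
rewrite !inE postcomp_injectiveb ffunE; congr (_ && _).
by rewrite -{2}(tpermL y x) (inj_eq perm_inj).
Qed.

(** The same symmetry argument over the [n * n.-1] ordered pairs of distinct labels. *)
Lemma count_fixed2 (p q : 'I_m) (x y : 'I_n) : p != q ->
  (n * n.-1 * #|[pred g : {ffun 'I_m -> 'I_n} | injectiveb g & (g p == x) && (g q == y)]| <= ninj)%N.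
Proof.
move=> pq; have [->|xy] := eqVneq x y.
  rewrite [X in (_ * X)%N](_ : _ = 0)%N ?muln0//; apply: eq_card0 => g; rewrite !inE.
  apply/negbTE/negP => /and3P[/injectiveP inj /eqP gp /eqP gq].
  by move/eqP: pq; apply; apply: inj; rewrite gp gq.
rewrite /ninj -[X in (_ <= X)%N]sum1_card.
rewrite (partition_big (fun g : {ffun 'I_m -> 'I_n} => (g p, g q))
  (fun xy : 'I_n * 'I_n => xy.1 != xy.2))/=; last first.
  move=> g /injectiveP inj; apply: contra pq => /eqP; exact: (fun E => introT eqP (inj _ _ E)).
have -> : (n * n.-1)%N = #|[pred xy : 'I_n * 'I_n | xy.1 != xy.2]|.
  rewrite -sum1_card (eq_bigl (fun xy : 'I_n * 'I_n => true && (xy.1 != xy.2)))//.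
  rewrite -(pair_big_dep xpredT (fun x y : 'I_n => x != y) (fun _ _ => 1%N))/=.
  rewrite -[X in (X * _)%N](card_ord n) -sum_nat_const; apply: eq_bigr => z _.
  have := cardC1 z; rewrite card_ord => <-; rewrite sum1_card.
  by apply: eq_card => u; rewrite !inE eq_sym.
rewrite -sum_nat_const; apply: leq_sum => -[x' y'] /= xy'.
rewrite -[X in (X <= _)%N]sum1_card.
(* The first transposition sends [x'] to [x]; the second sends the image of [y'] to [y] and fixes
   [x]. *)
pose s := (tperm x' x * tperm (tperm x' x y') y)%g.
have sx : s x' = x.
  rewrite permM tpermL; apply: tpermD; last by rewrite eq_sym.
  by rewrite -[X in _ != X](tpermL x' x) (inj_eq perm_inj) eq_sym.
have sy : s y' = y by rewrite permM tpermL.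
rewrite (reindex_inj (@postcomp_inj s))/=.
apply: eq_leq; apply: eq_bigl => g.
rewrite !inE postcomp_injectiveb !ffunE xpair_eqE; congr (_ && _).
by rewrite -[X in (_ == X) && _]sx -[X in _ && (_ == X)]sy !(inj_eq perm_inj).
Qed.

Variable R : realType.
Implicit Types A D : {ffun 'I_m -> 'I_n} -> R.

(** Weaker than meeting both exchanged pairs of labels, but symmetric in [g] and [g']; two shared
    labels already give a proportion of order [n ^ -2]. *)
Definition overlap g g' : bool :=
  [exists p, [exists q, [exists b, [exists b',
    [&& p != q, b != b', g p == g' b & g q == g' b']]]]].

(** A union bound over the [m ^ 4] choices of positions: each prescribes two values of [g'], which
    [count_fixed2] estimates. *)
Lemma count_overlap g : (n * n.-1 *
  #|[pred g' : {ffun 'I_m -> 'I_n} | injectiveb g' & overlap g g']| <= m ^ 4 * ninj)%N.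
Proof.
pose c (p q b b' : 'I_m) := #|[pred g' : {ffun 'I_m -> 'I_n} | injectiveb g' &
   [&& b != b', g' b == g p & g' b' == g q]]|.
have H : (#|[pred g' : {ffun 'I_m -> 'I_n} | injectiveb g' & overlap g g']| <=
    \sum_p \sum_q \sum_b \sum_b' c p q b b')%N.
  rewrite !pair_big /= -sum1_card.
  have -> : (\sum_(i : 'I_m * 'I_m * 'I_m * 'I_m) c i.1.1.1 i.1.1.2 i.1.2 i.2 =
     \sum_(g' : {ffun 'I_m -> 'I_n} | injectiveb g')
        \sum_(i : 'I_m * 'I_m * 'I_m * 'I_m)
          [&& i.1.2 != i.2, g' i.1.2 == g i.1.1.1 & g' i.2 == g i.1.1.2])%N.
    rewrite exchange_big/=; apply: eq_bigr => i _; rewrite /c -sum1_card.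
    by rewrite big_mkcondr/=; apply: eq_bigr => g' _; case: ifP.
  rewrite [X in (X <= _)%N]big_mkcondr/=; apply: leq_sum => g' _.
  case: ifP => // /existsP[p /existsP[q /existsP[b /existsP[b' /and4P[pq bb' e1 e2]]]]].
  by rewrite (bigD1 (p, q, b, b'))//= bb' (eq_sym (g' b)) e1 eq_sym e2.
apply: leq_trans (leq_mul (leqnn _) H) _.
have c4 p q b b' : (n * n.-1 * c p q b b' <= ninj)%N.
  have [E|bb'] := eqVneq b b'.
    rewrite /c (_ : #|_| = 0)%N ?muln0//; apply: eq_card0 => g'.
    by rewrite !inE E eqxx andbF.
  apply: leq_trans (count_fixed2 (g p) (g q) bb').
  by apply: eq_leq; congr (_ * _)%N; apply: eq_card => g'; rewrite !inE bb'.
rewrite !big_distrr/=.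
have -> : (m ^ 4 * ninj = \sum_(p < m) \sum_(q < m) \sum_(b < m) \sum_(b' < m) ninj)%N.
  by rewrite !sum_nat_const card_ord !expnS expn0 muln1 !mulnA.
apply: leq_sum => p _; rewrite big_distrr/=; apply: leq_sum => q _.
rewrite big_distrr/=; apply: leq_sum => b _.
by rewrite big_distrr/=; apply: leq_sum => b' _; exact: c4.
Qed.

Lemma overlap_sym g g' : overlap g g' = overlap g' g.
Proof.
by apply/idP/idP => /existsP[p /existsP[q /existsP[b /existsP[b' /and4P[pq bb' e1 e2]]]]];
  apply/existsP; exists b; apply/existsP; exists b'; apply/existsP; exists p;
  apply/existsP; exists q; rewrite pq bb' eq_sym e1 eq_sym e2.
Qed.

(* Exchanging the labels [g p] and [g q] flips the sign of [A] along [g] and, when they do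
   not occur in [g'], leaves [A] along [g'] unchanged. *)
Lemma antisymmetric_cancel A g g' (p q : 'I_m) :
  injectiveb g -> (forall h, injectiveb h -> A (precomp h (tperm p q)) = - A h) ->
  (forall b, g' b != g p) -> (forall b, g' b != g q) ->
  \sum_(s : 'S_n) A (postcomp s g) * A (postcomp s g') = 0.
Proof.
move=> inj hA gp gq.
pose t := tperm (g p) (g q).
have tg : postcomp t g = precomp g (tperm p q).
  apply/ffunP => a; rewrite !ffunE /t.
  case: (tpermP p q a) => [->|->|/eqP ap /eqP aq]; rewrite ?tpermL ?tpermR//.
  by apply: tpermD; rewrite eq_sym (inj_eq (injectiveP _ inj)).
have tg' : postcomp t g' = g'.
  by apply/ffunP => b; rewrite ffunE; apply: tpermD; rewrite eq_sym.
set S := LHS.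
have : S = - S.
  rewrite {1}/S (reindex_inj (mulgI t))/= -sumrN; apply: eq_bigr => s _.
  rewrite !postcompM tg tg'.
  have -> : postcomp s (precomp g (tperm p q)) = precomp (postcomp s g) (tperm p q).
    by apply/ffunP => a; rewrite !ffunE.
  by rewrite hA ?mulNr// postcomp_injectiveb.
lra.
Qed.

(** After expanding the square, the sum over [s] of the products of [A] along [g] and [g'] is at
    most [n! * M ^ 2] in absolute value, and 0 without overlap. The products of [D] are split by the
    arithmetic-geometric mean inequality, and [count_overlap] bounds the sum over the free index. *)
Lemma permutation_second_moment (S : {set {ffun 'I_m -> 'I_n}}) A D (M : R)
    (o1 o2 o3 o4 : 'I_m) : uniq [:: o1; o2; o3; o4] ->
  (forall g, g \in S -> injectiveb g) ->
  (forall h, injectiveb h -> A (precomp h (tperm o1 o4)) = - A h) ->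
  (forall h, injectiveb h -> A (precomp h (tperm o2 o3)) = - A h) ->
  (forall h, injectiveb h -> `|A h| <= M) -> (1 < n)%N ->
  \sum_(s : 'S_n) (\sum_(g in S) A (postcomp s g) * D g) ^+ 2 <=
    (n`!)%:R * M ^+ 2 * (m ^ 4)%:R * ninj%:R / (n%:R * n.-1%:R) *
    \sum_(g : {ffun 'I_m -> 'I_n} | injectiveb g) D g ^+ 2.
Proof.
move=> ou Sinj A14 A23 AM n1.
pose E g g' := \sum_(s : 'S_n) A (postcomp s g) * A (postcomp s g').
have EM g g' : injectiveb g -> injectiveb g' ->
    `|E g g'| <= (n`!)%:R * M ^+ 2 * (overlap g g')%:R.
  (* Without overlap [g'] misses all labels of one exchanged pair: meeting both pairs would give two
     common labels at distinct positions. *)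
  move=> inj inj'; have [_|nov] := boolP (overlap g g'); last first.
    rewrite mulr0 normr_le0; apply/eqP.
    have [e1|e1] := boolP [exists b, (g' b == g o1) || (g' b == g o4)]; last first.
      apply: (antisymmetric_cancel inj A14) => b; apply: contra e1 => e1;
        by apply/existsP; exists b; rewrite e1 ?orbT.
    have [e2|e2] := boolP [exists b, (g' b == g o2) || (g' b == g o3)]; last first.
      apply: (antisymmetric_cancel inj A23) => b; apply: contra e2 => e2;
        by apply/existsP; exists b; rewrite e2 ?orbT.
    exfalso; move/negP: nov; apply.
    have [p [b [po /eqP pb]]] : exists p b, p \in [:: o1; o4] /\ g' b == g p.
      by case/existsP: e1 => b /orP[e|e]; [exists o1, b|exists o4, b]; rewrite !inE eqxx ?orbT.
    have [q [b' [qo /eqP qb']]] : exists q b', q \in [:: o2; o3] /\ g' b' == g q.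
      by case/existsP: e2 => b' /orP[e|e]; [exists o2, b'|exists o3, b']; rewrite !inE eqxx ?orbT.
    have pq : p != q.
      move: ou; rewrite /= !inE !negb_or => /and4P[/and3P[u1 u2 u3] /andP[u4 u5] u6 _].
      by move: po qo; rewrite !inE => /orP[/eqP ->|/eqP ->] /orP[/eqP ->|/eqP ->] //; rewrite eq_sym.
    apply/existsP; exists p; apply/existsP; exists q; apply/existsP; exists b.
    apply/existsP; exists b'; rewrite pq pb qb' !eqxx !andbT /=.
    apply: contra pq => /eqP bb'; move: qb'; rewrite -bb' pb => /(injectiveP _ inj) ->//.
  apply: le_trans (ler_norm_sum _ _ _) _.
  rewrite mulr1; have -> : n`!%:R * M ^+ 2 = \sum_(s : 'S_n) M ^+ 2.
    by rewrite sumr_const card_Sn mulr_natl.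
  apply: ler_sum => s _; rewrite normrM expr2.
  by rewrite ler_pM// AM// postcomp_injectiveb.
have nn0 : 0 < n%:R * n.-1%:R :> R by rewrite mulr_gt0 ?ltr0n//; case: (n) n1 => [|[]].
have sq : \sum_(s : 'S_n) (\sum_(g in S) A (postcomp s g) * D g) ^+ 2 =
    \sum_(g in S) \sum_(g' in S) D g * D g' * E g g'.
  transitivity (\sum_(s : 'S_n) \sum_(g in S) \sum_(g' in S)
      D g * D g' * (A (postcomp s g) * A (postcomp s g'))).
    apply: eq_bigr => s _; rewrite expr2 mulr_suml; apply: eq_bigr => g _.
    by rewrite mulr_sumr; apply: eq_bigr => g' _; ring.
  rewrite exchange_big/=; apply: eq_bigr => g _; rewrite exchange_big/=.
  by apply: eq_bigr => g' _; rewrite mulr_sumr.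
pose K := n`!%:R * M ^+ 2.
have K0 : 0 <= K by rewrite mulr_ge0// sqr_ge0.
pose ov g g' : R := (overlap g g')%:R.
have step1 : \sum_(g in S) \sum_(g' in S) D g * D g' * E g g' <=
    \sum_(g in S) \sum_(g' in S) K * (ov g g' * (D g ^+ 2 / 2) + ov g' g * (D g' ^+ 2 / 2)).
  apply: ler_sum => g Sg; apply: ler_sum => g' Sg'.
  rewrite /ov (overlap_sym g') -mulrDr mulrA.
  apply: le_trans (ler_norm _) _; rewrite normrM mulrC.
  apply: ler_pM => //; first by apply: EM; exact: Sinj.
  have := sqr_ge0 (`|D g| - `|D g'|); rewrite normrM.
  rewrite -(real_normK (num_real (D g))) -(real_normK (num_real (D g'))) !expr2; lra.
have S_inj (F : {ffun 'I_m -> 'I_n} -> R) : (forall g, 0 <= F g) ->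
    \sum_(g in S) F g <= \sum_(g : {ffun 'I_m -> 'I_n} | injectiveb g) F g.
  move=> F0; rewrite [leRHS](bigID (mem S))/=.
  rewrite [X in _ <= X + _](eq_bigl (mem S)) => [|g]; first by rewrite lerDl sumr_ge0.
  by rewrite /=; case: (boolP (g \in S)) => [/Sinj ->|]; rewrite ?andbF.
have half : \sum_(g in S) \sum_(g' in S) ov g g' * (D g ^+ 2 / 2) <=
   (m ^ 4)%:R * ninj%:R / (n%:R * n.-1%:R) / 2 *
     \sum_(g : {ffun 'I_m -> 'I_n} | injectiveb g) D g ^+ 2.
  apply: (@le_trans _ _ (\sum_(g : {ffun 'I_m -> 'I_n} | injectiveb g)
      \sum_(g' : {ffun 'I_m -> 'I_n} | injectiveb g') ov g g' * (D g ^+ 2 / 2))).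
    apply: (@le_trans _ _ (\sum_(g in S)
      \sum_(g' : {ffun 'I_m -> 'I_n} | injectiveb g') ov g g' * (D g ^+ 2 / 2))).
      apply: ler_sum => g _; apply: S_inj => g'.
      by rewrite mulr_ge0// divr_ge0// sqr_ge0.
    apply: S_inj => g; apply: sumr_ge0 => g' _.
    by rewrite mulr_ge0// divr_ge0// sqr_ge0.
  rewrite mulr_sumr; apply: ler_sum => g _; rewrite -mulr_suml.
  rewrite [leRHS]mulrAC [leRHS](_ : _ = (m ^ 4)%:R * ninj%:R / (n%:R * n.-1%:R) * (D g ^+ 2 / 2)); last first.
    by rewrite -!mulrA; congr (_ * (_ * (_ * _))); rewrite mulrC.
  apply: ler_wpM2r; first by rewrite divr_ge0// sqr_ge0.
  rewrite ler_pdivlMr// mulrC -!natrM.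
  have -> : \sum_(g' : {ffun 'I_m -> 'I_n} | injectiveb g') ov g g' =
      #|[pred g' : {ffun 'I_m -> 'I_n} | injectiveb g' & overlap g g']|%:R.
    by rewrite -sum1_card natr_sum big_mkcondr; apply: eq_bigr => g' _; rewrite /ov; case: overlap.
  by rewrite -natrM ler_nat count_overlap.
rewrite sq; apply: le_trans step1 _.
under eq_bigr do rewrite -mulr_sumr.
rewrite -mulr_sumr -/K.
rewrite [leRHS](_ : _ = K * (2 * ((m ^ 4)%:R * ninj%:R / (n%:R * n.-1%:R) / 2 *
     \sum_(g : {ffun 'I_m -> 'I_n} | injectiveb g) D g ^+ 2))); last first.
  set x := (m ^ 4)%:R; set y := ninj%:R; set z := n%:R * n.-1%:R in nn0 *.
  by field; rewrite gt_eqF.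
apply: ler_wpM2l => //.
under eq_bigr do rewrite big_split/=.
rewrite big_split/= [X in _ + X]exchange_big/=.
have := half; lra.
Qed.

End injections.

(** * From symmetrized averages over subsets to averages over injections *)

Section sample_average.
Context {m n : nat}.

Definition increasing (i : {ffun 'I_m -> 'I_n}) : bool :=
  [forall a : 'I_m, forall b : 'I_m, (a < b)%N ==> (i a < i b)%N].

Lemma increasingP (i : {ffun 'I_m -> 'I_n}) (a b : 'I_m) :
  increasing i -> (a < b)%N -> (i a < i b)%N.
Proof. by move=> /forallP /(_ a) /forallP /(_ b) /implyP; apply. Qed.

Lemma increasing_injective (i : {ffun 'I_m -> 'I_n}) : increasing i -> injective i.
Proof.
move=> inc a b E; apply: val_inj.
case: (ltngtP (val a) (val b)) => // lt.
  by have := increasingP inc lt; rewrite E ltnn.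
by have := increasingP inc lt; rewrite E ltnn.
Qed.

Lemma increasing_sorted (i : {ffun 'I_m -> 'I_n}) : increasing i ->
  sorted ltn [seq nat_of_ord (i a) | a <- enum 'I_m].
Proof.
move=> inc; rewrite sorted_map.
have : sorted ltn [seq val a | a <- enum 'I_m] by rewrite val_enum_ord iota_ltn_sorted.
rewrite sorted_map; apply: sub_sorted => a b /=.
exact: increasingP.
Qed.

(** The increasing factor is recovered by sorting the values, and the permutation then follows from
    injectivity. *)
Lemma increasing_precomp_inj (i i' : {ffun 'I_m -> 'I_n}) (s s' : 'S_m) :
  increasing i -> increasing i' -> precomp i s = precomp i' s' -> i = i' /\ s = s'.
Proof.
move=> inc inc' /ffunP E.
have E' a : i (s a) = i' (s' a) by have := E a; rewrite !ffunE.
have sub (j j' : {ffun 'I_m -> 'I_n}) (t t' : 'S_m) : (forall a, j (t a) = j' (t' a)) ->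
    {subset [seq nat_of_ord (j a) | a <- enum 'I_m] <= [seq nat_of_ord (j' a) | a <- enum 'I_m]}.
  move=> jj' x /mapP[a _ ->]; apply/mapP; exists (t' (t^-1%g a)); first by rewrite mem_enum.
  by rewrite -jj' permKV.
have ii' : i = i'.
  have /eq_in_map H : [seq nat_of_ord (i a) | a <- enum 'I_m] = [seq nat_of_ord (i' a) | a <- enum 'I_m].
    apply: (irr_sorted_eq ltn_trans ltnn); try exact: increasing_sorted.
    move=> x; apply/idP/idP; [exact: (sub _ _ s s' E')|apply: (sub _ _ s' s)].
    by move=> a; rewrite E'.
  by apply/ffunP => a; apply/val_inj/H; rewrite mem_enum.
split => //; apply/permP => a; apply: (increasing_injective inc).
by rewrite E' ii'.
Qed.

(** The image of the pairs formed by an increasing choice of indices and a permutation of the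
    arguments: it merges the two sums in [sample_gsc]. *)
Definition ordered_injections : {set {ffun 'I_m -> 'I_n}} :=
  [set precomp p.1 p.2 | p : {ffun 'I_m -> 'I_n} * 'S_m in [pred p | increasing p.1]].

Lemma ordered_injections_inj g : g \in ordered_injections -> injectiveb g.
Proof.
move=> /imsetP[[i s] /=]; rewrite inE/= => /increasing_injective inj ->.
by rewrite precomp_injectiveb; apply/injectiveP.
Qed.

Lemma ninjE : @ninj m n = (n ^_ m)%N.
Proof. by have := card_inj_ffuns 'I_m 'I_n; rewrite cardsE !card_ord. Qed.

Lemma row_perm_rowsub (R : Type) d (s : 'S_m) (g : {ffun 'I_m -> 'I_n}) (x : 'M[R]_(n, d)) :
  row_perm s (rowsub g x) = rowsub (precomp g s) x.
Proof. by apply/matrixP => a b; rewrite !mxE ffunE. Qed.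

(** The normalizations ['C(n, m)] and [m!] multiply to the falling factorial, which counts the
    injections. *)
Lemma sample_gscE (R : realType) d1 d2 (H : {set 'S_m}) (f1 : 'M[R]_(m, d1) -> R)
    (f2 : 'M[R]_(m, d2) -> R) (x1 : 'M[R]_(n, d1)) (x2 : 'M[R]_(n, d2)) :
  sample_gsc H f1 f2 x1 x2 = (@ninj m n)%:R^-1 * \sum_(g in ordered_injections)
    antisymmetrized H f1 (rowsub g x1) * antisymmetrized H f2 (rowsub g x2).
Proof.
rewrite ninjE -bin_ffact natrM invfM -mulrA; congr (_ * _).
rewrite /gsc_kernel_sym -mulr_sumr; congr (_ * _).
rewrite big_imset/=; last first.
  move=> [i s] [i' s']; rewrite !inE/= => inc inc' E.
  by have [-> ->] := increasing_precomp_inj inc inc' E.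
rewrite (eq_bigl (fun p : {ffun 'I_m -> 'I_n} * 'S_m => increasing p.1 && true)); last first.
  by move=> p; rewrite inE andbT.
rewrite -(pair_big increasing xpredT (fun i s =>
  antisymmetrized H f1 (rowsub (precomp i s) x1) * antisymmetrized H f2 (rowsub (precomp i s) x2)))/=.
by apply: eq_bigr => i _; apply: eq_bigr => s _; rewrite /gsc_kernel !row_perm_rowsub.
Qed.

End sample_average.
Arguments ordered_injections {m n}.

Section klein_group.
Context {m : nat} (hm : (4 <= m)%N).

(** The positions 1 to 4 of the informal group, counted from 0; convertible with the indices inside
    [Hstar]. *)
Definition star_index (k : nat) : 'I_m := widen_ord hm (inord k : 'I_4).

Lemma star_index_uniq :
  uniq [:: star_index 0; star_index 1; star_index 2; star_index 3].
Proof. by rewrite /= !inE -!val_eqE /= !inordK. Qed.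

(** Right multiplication by [t] permutes [H] and flips every sign. *)
Lemma antisymmetrized_flip (R : realType) d (H : {set 'S_m}) (t : 'S_m) (f : 'M[R]_(m, d) -> R) x :
  odd_perm t -> (forall s, ((s * t)%g \in H) = (s \in H)) ->
  antisymmetrized H f (row_perm t x) = - antisymmetrized H f x.
Proof.
move=> ot Ht; rewrite /antisymmetrized -sumrN [RHS](reindex_inj (mulIg t))/=.
apply: eq_big => [s|s _]; first by rewrite Ht.
by rewrite odd_permM ot row_permM addbT signrN mulNr opprK.
Qed.

(** The two transpositions are disjoint, hence commute, and [Hstar] is the Klein four-group they
    generate. *)
Lemma Hstar_flip k l : ((k, l) = (0, 3) \/ (k, l) = (1, 2))%N ->
  forall s, ((s * tperm (star_index k) (star_index l))%g \in Hstar hm) = (s \in Hstar hm).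
Proof.
set t14 := tperm (star_index 0) (star_index 3); set t23 := tperm (star_index 1) (star_index 2).
have := star_index_uniq; rewrite /= !inE !negb_or => /and4P[/and3P[u1 u2 u3] /andP[u4 u5] u6 _].
have com : (t14 * t23 = t23 * t14)%g.
  by rewrite conjgC tpermJ !tpermD// eq_sym.
have k14 : (t14 * t14 = 1)%g by rewrite tperm2.
have k23 : (t23 * t23 = 1)%g by rewrite tperm2.
have sub t : t = t14 \/ t = t23 -> forall s, s \in Hstar hm -> (s * t)%g \in Hstar hm.
  move=> tt s; rewrite !inE -!orbA => /or4P[] /eqP ->; case: tt => ->.
  - by rewrite mul1g eqxx orbT.
  - by rewrite mul1g eqxx !orbT.
  - by rewrite k14 eqxx.
  - by rewrite eqxx !orbT.
  - by rewrite -com eqxx !orbT.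
  - by rewrite k23 eqxx.
  - by rewrite -mulgA -com mulgA k14 mul1g eqxx !orbT.
  - by rewrite -mulgA k23 mulg1 eqxx orbT.
move=> kl s; have {kl} tt : tperm (star_index k) (star_index l) = t14 \/
    tperm (star_index k) (star_index l) = t23.
  by case: kl => -[-> ->]; [left|right].
apply/idP/idP => [/(sub _ tt)|]; last exact: sub.
by rewrite -mulgA tperm2 mulg1.
Qed.

End klein_group.

(** * Convergence of the grids *)

Section riemann_sums.
Context {R : realType}.
Local Notation leb := (@lebesgue_measure R).

Lemma lipschitz_continuous (f : R -> R) (L : R) :
  (forall s t, `|f s - f t| <= L * `|s - t|) -> continuous f.
Proof.
move=> fL x; apply/cvgrPdist_le => e e0.
have L0 : 0 <= L by have := le_trans (normr_ge0 _) (fL 1 0); rewrite subr0 normr1 mulr1.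
have L1 : 0 < L + 1 by lra.
near=> t; apply: le_trans (fL _ _) _.
have : `|x - t| <= e / (L + 1).
  by near: t; have /cvgrPdist_le := @cvg_id _ (nbhs x); apply; exact: divr_gt0.
rewrite ler_pdivlMr// => H; apply: le_trans H; rewrite mulrC ler_wpM2l//; lra.
Unshelve. all: by end_near. Qed.

Lemma lipschitz_integrable_itv (f : R -> R) (L a b : R) :
  (forall s t, `|f s - f t| <= L * `|s - t|) -> leb.-integrable `[a, b] (EFin \o f).
Proof.
move=> fL; apply: continuous_compact_integrable; first exact: segment_compact.
by apply: continuous_subspaceT; exact: (lipschitz_continuous fL).
Qed.

Lemma lipschitz_integrable_itvoc (f : R -> R) (L a b : R) :
  (forall s t, `|f s - f t| <= L * `|s - t|) -> leb.-integrable `]a, b] (EFin \o f).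
Proof.
move=> fL; apply: (integrableS _ _ _ (lipschitz_integrable_itv a b fL)) => //.
by apply: subset_itvr; rewrite bnd_simp.
Qed.

Lemma integral_itv_approx (f : R -> R) (L a b c : R) : a <= b ->
  (forall s t, `|f s - f t| <= L * `|s - t|) -> a <= c <= b ->
  `|\int[leb]_(t in `]a, b]) f t - (b - a) * f c| <= L * (b - a) * (b - a).
Proof.
move=> ab fL /andP[ac cb].
have L0 : 0 <= L by have := le_trans (normr_ge0 _) (fL 1 0); rewrite subr0 normr1 mulr1.
have fi : leb.-integrable `]a, b] (EFin \o f) by exact: lipschitz_integrable_itvoc fL.
have ci (r : R) : leb.-integrable `]a, b] (EFin \o fun=> r).
  by apply: (@lipschitz_integrable_itvoc (fun=> r) 0) => s t; rewrite subrr normr0 mul0r.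
have di : leb.-integrable `]a, b] (EFin \o (fun t => f t - f c)).
  apply: (@lipschitz_integrable_itvoc _ L) => s t.
  by rewrite opprB addrA subrK.
have ni : leb.-integrable `]a, b] (EFin \o (fun t => `|f t - f c|)).
  apply: (@lipschitz_integrable_itvoc _ L) => s t; apply: le_trans (ler_dist_dist _ _) _.
  by rewrite opprB addrA subrK.
have vol (r : R) : \int[leb]_(t in `]a, b]) r = r * (b - a).
  rewrite Rintegral_cst//; congr (_ * _).
  transitivity (fine (lebesgue_measure `]a, b]%classic)) => //.
  rewrite lebesgue_measure_itv/= lte_fin.
  by case: ltP => //= ba; have -> : b = a by [apply/eqP; rewrite eq_le ab ba]; rewrite subrr.
rewrite (mulrC (b - a)) -(vol (f c)) -RintegralB//.
apply: le_trans (le_normr_Rintegral _ _) _ => //.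
rewrite -(vol (L * (b - a))); apply: le_Rintegral => //.
move=> t /=; rewrite in_itv/= => /andP[at_ tb]; apply: le_trans (fL _ _) _.
by rewrite ler_wpM2l// ler_norml; lra.
Qed.

(** The nodes are the grid radii, with denominator [M + 1], matched with [M] equal cells:
    [(r + 1) / (M + 1)] lies between [r / M] and [(r + 1) / M], so a cell contributes an error of at
    most [L / M ^ 2]. *)
Lemma riemann_sum_lipschitz (f : R -> R) (L : R) (M : nat) :
  (forall s t, `|f s - f t| <= L * `|s - t|) -> (0 < M)%N ->
  `|M%:R^-1 * (\sum_(r < M) f (r.+1%:R / M.+1%:R)) - \int[leb]_(t in `[0, 1]) f t| <= L / M%:R.
Proof.
move=> fL M0.
have M0R : 0 < M%:R :> R by rewrite ltr0n.
have part k : (k <= M)%N ->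
  `|M%:R^-1 * (\sum_(r < k) f (r.+1%:R / M.+1%:R)) - \int[leb]_(t in `[0, k%:R / M%:R]) f t| <=
     k%:R * (L / (M%:R * M%:R)).
  elim: k => [_|k IH kM].
    by rewrite big_ord0 mulr0 mul0r mul0r set_itv1 Rintegral_set1 subrr normr0.
  have k1 : k%:R / M%:R <= k.+1%:R / M%:R :> R by rewrite ler_pM2r ?invr_gt0// ler_nat.
  have k0 : 0 <= k%:R / M%:R :> R by rewrite divr_ge0.
  have split : \int[leb]_(t in `[0, k.+1%:R / M%:R]) f t =
     \int[leb]_(t in `[0, k%:R / M%:R]) f t + \int[leb]_(t in `]k%:R / M%:R, k.+1%:R / M%:R]) f t.
    have <- := @Rintegral_itvB _ f (BLeft 0) (BRight (k.+1%:R / M%:R)) (k%:R / M%:R)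
       (lipschitz_integrable_itv _ _ fL) _ _; rewrite ?bnd_simp//.
    ring.
  rewrite big_ord_recr/= split mulrDr opprD addrACA.
  apply: le_trans (ler_normD _ _) _.
  rewrite -[in leRHS]natr1 [leRHS]mulrDl mul1r; apply: lerD; first exact/IH/ltnW.
  rewrite distrC.
  have step : k.+1%:R / M%:R - k%:R / M%:R = M%:R^-1 :> R.
    by rewrite -mulrBl -natr1 addrAC subrr add0r mul1r.
  have kM' : k%:R + 1 <= M%:R :> R by rewrite natr1 ler_nat.
  have := @integral_itv_approx f L _ _ (k.+1%:R / M.+1%:R) k1 fL; rewrite step.
  have -> : L * M%:R^-1 * M%:R^-1 = L / (M%:R * M%:R) by rewrite invfM mulrA.
  apply; apply/andP; split.
    by rewrite ler_pdivrMr// mulrAC ler_pdivlMr ?ltr0n// -!natrM ler_nat; lia.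
  by rewrite ler_pM2l ?ltr0n// lef_pV2 ?posrE ?ltr0n// ler_nat.
have := part M (leqnn M).
rewrite divff ?gt_eqF//; move=> H; apply: le_trans H _.
by rewrite le_eqVlt; apply/orP; left; apply/eqP; field; rewrite gt_eqF.
Qed.

(** Directions and radii are refined independently, so [f N] must converge uniformly in the radius:
    this follows from convergence at the finitely many nodes [l / K] and the common Lipschitz
    constant. *)
Lemma riemann_sum_uniform (f : nat -> R -> R) (g : R -> R) (L e : R) :
  (forall N s t, `|f N s - f N t| <= L * `|s - t|) ->
  (forall s t, `|g s - g t| <= L * `|s - t|) ->
  (forall t, f N t @[N --> \oo] --> g t) -> 0 < e ->
  exists N0 M0 : nat, forall N M, (N0 <= N)%N -> (M0 <= M)%N ->
    `|M%:R^-1 * (\sum_(r < M) f N (r.+1%:R / M.+1%:R)) - \int[leb]_(t in `[0, 1]) g t| <= e.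
Proof.
move=> fL gL fg e0.
have L0 : 0 <= L by have := le_trans (normr_ge0 _) (gL 1 0); rewrite subr0 normr1 mulr1.
(* Two Lipschitz errors of [e / 8] and a nodal error of [e / 4] add up to [e / 2]; the rest is left
   for the Riemann sum. *)
pose K := (Num.truncn (8 * L / e)).+1.
have K0 : 0 < K%:R :> R by rewrite ltr0n.
have KL : L / K%:R <= e / 8.
  rewrite ler_pdivrMr// mulrC -ler_pdivrMr ?divr_gt0//.
  apply: le_trans (ltW (truncnS_gt _)); rewrite invf_div mulrA (mulrC L)//.
have [N0 _ HN0] : \forall N \near \oo, forall l : 'I_K.+1, `|g (l%:R / K%:R) - f N (l%:R / K%:R)| <= e / 4.
  apply: filter_forall => l; apply: cvgr_dist_le; [exact: fg|lra].
exists N0, K => N M NN MK.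
have M0 : (0 < M)%N by apply: leq_trans MK.
have unif t : 0 <= t <= 1 -> `|g t - f N t| <= e / 2.
  move=> /andP[t0 t1].
  pose l := Num.truncn (t * K%:R).
  have tK0 : 0 <= t * K%:R by rewrite mulr_ge0// ltW.
  have l1 : l%:R <= t * K%:R by rewrite truncn_le.
  have l2 : t * K%:R < l.+1%:R by exact: truncnS_gt.
  have lK : (l < K.+1)%N.
    by rewrite ltnS -(ler_nat R); apply: le_trans l1 _; rewrite ler_piMl// ltW.
  have H := HN0 N NN (Ordinal lK); rewrite /= in H.
  have tl : `|t - l%:R / K%:R| <= K%:R^-1.
    rewrite -(ler_pM2r K0) mulVf ?gt_eqF// -[X in _ * X](gtr0_norm K0) -normrM mulrBl divfK ?gt_eqF//.
    by move: l2; rewrite -natr1 ler_norml; lra.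
  have g1 := le_trans (gL t (l%:R / K%:R)) (ler_wpM2l L0 tl).
  have f1 := le_trans (fL N t (l%:R / K%:R)) (ler_wpM2l L0 tl).
  have := ler_distD (g (l%:R / K%:R)) (g t) (f N t).
  have := ler_distD (f N (l%:R / K%:R)) (g (l%:R / K%:R)) (f N t).
  rewrite (distrC (f N (l%:R / K%:R)) (f N t)); lra.
have H := riemann_sum_lipschitz gL M0.
have M0R : 0 < M%:R :> R by rewrite ltr0n.
apply: le_trans (ler_distD (M%:R^-1 * (\sum_(r < M) g (r.+1%:R / M.+1%:R))) _ _) _.
have -> : e = e / 2 + e / 2 by lra.
apply: lerD; last first.
  apply: le_trans H _; apply: (@le_trans _ _ (L / K%:R)); last by lra.
  by rewrite ler_wpM2l// lef_pV2 ?posrE// ler_nat.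
rewrite -mulrBr normrM gtr0_norm ?invr_gt0// ler_pdivrMl//.
rewrite -sumrB; apply: le_trans (ler_norm_sum _ _ _) _.
rewrite -[X in _ <= X%:R * _](card_ord M) mulr_natl -sumr_const; apply: ler_sum => r _.
rewrite distrC; apply: unif; rewrite divr_ge0//= ler_pdivrMr ?ltr0n// mul1r ler_nat.
by rewrite ltnS ltnW.
Qed.

End riemann_sums.

Section enorm_theory.
Context {R : realType} {d : nat}.
Implicit Types x y : 'rV[R]_d.

Lemma dotpp_ge0 x : 0 <= dotp x x.
Proof. by apply: sumr_ge0 => i _; rewrite -expr2 sqr_ge0. Qed.

Lemma norm_le_enorm x : `|x| <= enorm x.
Proof.
apply: mx_norm_le => [|i j]; first exact: sqrtr_ge0.
rewrite (ord1 i) -sqrtr_sqr; apply: ler_wsqrtr.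
rewrite /dotp (bigD1 j)//= expr2 lerDl.
by apply: sumr_ge0 => k _; rewrite -expr2 sqr_ge0.
Qed.

Lemma enorm0 : enorm (0 : 'rV[R]_d) = 0.
Proof. by rewrite /enorm /dotp big1 ?sqrtr0// => i _; rewrite mxE mul0r. Qed.

Lemma enorm_eq0 x : enorm x = 0 -> x = 0.
Proof.
move=> x0; apply/eqP; rewrite -normr_eq0 eq_le normr_ge0 andbT -x0.
exact: norm_le_enorm.
Qed.

Lemma enormZ a x : enorm (a *: x) = `|a| * enorm x.
Proof.
rewrite /enorm dotpZr dotpC dotpZr mulrA -expr2 sqrtrM ?sqr_ge0//.
by rewrite sqrtr_sqr.
Qed.

Lemma enorm_unitE : [set x : 'rV[R]_d | enorm x = 1] = [set x | dotp x x = 1].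
Proof.
apply/seteqP; split => x /= x1; last by rewrite /enorm x1 sqrtr1.
by rewrite -(sqr_sqrtr (dotpp_ge0 x)) -/(enorm x) x1 expr1n.
Qed.

Lemma measurable_unit_sphere : measurable [set x : 'rV[R]_d | enorm x = 1].
Proof.
rewrite enorm_unitE -[X in measurable X]setTI.
have m : measurable_fun setT (fun x : 'rV[R]_d => dotp x x) by exact: measurable_dotp.
exact: (m measurableT [set 1]).
Qed.

Lemma lipschitz_continuous_mx (f : 'rV[R]_d -> R) (L : R) : 0 <= L ->
  (forall x y, `|f x - f y| <= L * `|x - y|) -> continuous f.
Proof.
move=> L0 fL x A /nbhs_ballP[e e0 eA].
have L1 : 0 < L + 1 by lra.
apply/nbhs_ballP; exists (e / (L + 1)); first exact: divr_gt0.
move=> t; rewrite -ball_normE /= ltr_pdivlMr// => H.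
apply: eA; rewrite /ball/=; apply: le_lt_trans (fL _ _) _; apply: le_lt_trans H.
by rewrite mulrC ler_wpM2l//; lra.
Qed.

End enorm_theory.

Section mean_of_enumeration.
Context {R : realType} {V : Type} (n : nat) (I : finType) (p : 'I_n -> V) (e : I -> V)
  (chi : V -> R).
Hypothesis e_inj : injective e.
Hypothesis ep : forall a, exists i, p i = e a.
Hypothesis chi01 : forall x, 0 <= chi x <= 1.

Lemma sum_enumeration_dist : (#|I| <= n)%N /\
  `|\sum_i chi (p i) - \sum_a chi (e a)| <= (n - #|I|)%N%:R.
Proof.
pose k a := sval (cid (ep a)).
have kE a : p (k a) = e a by rewrite /k; case: cid.
have k_inj : injective k by move=> a b E; apply: e_inj; rewrite -!kE E.
have In : (#|I| <= n)%N by rewrite -[leqRHS](card_ord n); exact: leq_card k_inj.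
split => //.
have -> : \sum_a chi (e a) = \sum_(i in k @: [set: I]%SET) chi (p i).
  rewrite big_imset/=; last by move=> a b _ _; exact: k_inj.
  by apply: eq_big => a; rewrite ?inE// kE.
rewrite (bigID (mem (k @: [set: I]%SET)))/= addrAC subrr add0r.
rewrite ger0_norm; last by apply: sumr_ge0 => i _; have /andP[] := chi01 (p i).
apply: le_trans (_ : \sum_(i in ~: (k @: [set: I]%SET)) 1 <= _).
  rewrite (eq_bigl (mem (~: (k @: [set: I]%SET)))) => [|i]; last by rewrite !inE.
  by apply: ler_sum => i _; have /andP[] := chi01 (p i).
have := cardsC (k @: [set: I]%SET); rewrite card_imset// cardsT card_ord => E.
by rewrite sumr_const ler_nat leq_eqVlt -(eqn_add2l #|I|) E subnKC ?eqxx.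
Qed.

(** [e] lists the regular part of the grid and [p] the whole of it. Each extra point costs 1 in the
    sum and as much in the change of normalization, hence the factor 2. *)
Lemma mean_enumeration_dist : (0 < #|I|)%N ->
  `|mean (chi \o p) - (#|I|)%:R^-1 * \sum_a chi (e a)| <= 2 * (n - #|I|)%N%:R / n%:R.
Proof.
move=> I0; have [In H] := sum_enumeration_dist.
have n0 : 0 < n%:R :> R by rewrite ltr0n (leq_trans I0).
have I0R : 0 < #|I|%:R :> R by rewrite ltr0n.
set S := \sum_a chi (e a) in H *; set T := \sum_i chi (p i) in H *.
have S0 : 0 <= S by apply: sumr_ge0 => a _; have /andP[] := chi01 (e a).
have S1 : S <= #|I|%:R.
  rewrite -sum1_card natr_sum; apply: ler_sum => a _; by have /andP[] := chi01 (e a).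
have -> : mean (chi \o p) - #|I|%:R^-1 * S = (T - S) / n%:R - S / #|I|%:R * (n - #|I|)%N%:R / n%:R.
  by rewrite /mean -/T natrB//; field; rewrite !gt_eqF.
have -> : 2 * (n - #|I|)%N%:R / n%:R = (n - #|I|)%N%:R / n%:R + 1 * (n - #|I|)%N%:R / n%:R :> R.
  by rewrite mul1r -mulrDl; congr (_ / _); ring.
apply: le_trans (ler_normB _ _) _; apply: lerD.
  by rewrite normrM normfV (gtr0_norm n0) ler_pM2r ?invr_gt0.
rewrite ger0_norm ?mulr_ge0 ?invr_ge0// ?(ltW n0)//.
by rewrite ler_pM2r ?invr_gt0// ler_wpM2r// ler_pdivrMr// mul1r.
Qed.

End mean_of_enumeration.

Section radial_means.
Context {R : realType} {d : nat} (sigma : probability 'rV[R]_d R).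
Context (chi : 'rV[R]_d -> R) (L : R).
Hypothesis L0 : 0 <= L.
Hypothesis chi01 : forall x, 0 <= chi x <= 1.
Hypothesis chiL : forall x y, `|chi x - chi y| <= L * `|x - y|.
Hypothesis hsigma : sphere_uniform sigma.

Definition radial_mean (t : R) : R := \int[sigma]_s chi (t *: s).

Lemma bounded_measurable_chi : bounded_measurable chi.
Proof.
split; first by apply: continuous_measurable_mx; exact: (lipschitz_continuous_mx L0 chiL).
by exists 1 => x; have /andP[? ?] := chi01 x; rewrite ger0_norm.
Qed.

Lemma measurable_scale (t : R) : measurable_fun setT (fun s : 'rV[R]_d => t *: s).
Proof.
apply: measurable_fun_mx => i j.
have -> : (fun s : 'rV[R]_d => (t *: s) i j) = (fun s => t * s i j).
  by apply/funext => s; rewrite mxE.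
by apply: measurable_funM => //; exact: measurable_coord.
Qed.

Lemma bounded_measurable_chiZ t : bounded_measurable (fun s : 'rV[R]_d => chi (t *: s)).
Proof. exact: (bounded_measurable_comp (measurable_scale t) bounded_measurable_chi). Qed.

Lemma sphere_negligibleC : sigma (~` [set x | enorm x = 1]) = 0%E.
Proof.
rewrite probability_setC; last exact: measurable_unit_sphere.
by rewrite (proj1 hsigma) subee.
Qed.

Lemma chiZ_lipschitz s t (x : 'rV[R]_d) : enorm x = 1 ->
  `|chi (s *: x) - chi (t *: x)| <= L * `|s - t|.
Proof.
move=> x1; apply: le_trans (chiL _ _) _; rewrite ler_wpM2l// -scalerBl normrZ.
by rewrite ler_piMr// -x1 norm_le_enorm.
Qed.

Lemma radial_mean_lipschitz s t : `|radial_mean s - radial_mean t| <= L * `|s - t|.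
Proof.
have mN := measurableC (@measurable_unit_sphere R d).
have H a b : radial_mean a - radial_mean b <= L * `|a - b|.
  rewrite /radial_mean -expectB; try exact: bounded_measurable_chiZ.
  rewrite -[leRHS](expect_cst sigma).
  apply: (expect_le_ae _ _ mN sphere_negligibleC).
  - by apply: bounded_measurableB; exact: bounded_measurable_chiZ.
  - exact: bounded_measurable_cst.
  move=> x /contrapT x1; apply: le_trans (chiZ_lipschitz a b x1).
  exact: ler_norm.
rewrite ler_norml; apply/andP; split; last exact: H.
by rewrite lerNl opprB distrC H.
Qed.

End radial_means.

Section grid_means.
Context {R : realType}.
Local Notation leb := (@lebesgue_measure R).

(** The mean of [chi] under [ball_uniform sigma], in polar coordinates. *)
Definition ball_mean d (sigma : probability 'rV[R]_d R) (chi : 'rV[R]_d -> R) : R :=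
  \int[leb]_(t in `[0, 1]) radial_mean sigma chi t.

(** Invariance under [- 1] makes [sigma] symmetric, and the unit sphere of the line is a pair of
    opposite points: the radial mean is the plain average over the two grid points of that
    radius. *)
Lemma radial_mean_line (sigma : probability 'rV[R]_1 R) (chi : 'rV[R]_1 -> R) (L t : R) :
  0 <= L -> (forall x, 0 <= chi x <= 1) ->
  (forall x y, `|chi x - chi y| <= L * `|x - y|) -> sphere_uniform sigma ->
  radial_mean sigma chi t = (chi (const_mx t) + chi (const_mx (- t))) / 2.
Proof.
move=> L0 chi01 chiL hs; have [_ rot] := hs.
have bc := bounded_measurable_chiZ L0 chi01 chiL.
pose Q : 'M[R]_1 := (-1)%:M.
have QQ : Q *m Q^T = 1%:M by rewrite tr_scalar_mx -scalar_mxM mulrNN mulr1.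
have sQ (x : 'rV[R]_1) : x *m Q = - x by rewrite mul_mx_scalar scaleN1r.
have mQ : measurable_fun setT (mulmx^~ Q : 'rV[R]_1 -> 'rV[R]_1).
  rewrite (_ : mulmx^~ Q = fun s => -1 *: s); first exact: measurable_scale.
  by apply/funext => x; rewrite sQ scaleN1r.
pose QQQ : {mfun 'rV[R]_1 >-> 'rV[R]_1} :=
  HB.pack (mulmx^~ Q : 'rV[R]_1 -> 'rV[R]_1) (isMeasurableFun.Build _ _ _ _ _ mQ).
have flip : radial_mean sigma chi t = radial_mean sigma chi (- t).
  rewrite /radial_mean /Rintegral; congr fine.
  transitivity (\int[distribution sigma QQQ]_s (chi (t *: s))%:E)%E.
    by apply: eq_measure_integral => A mA _; rewrite /= /distribution /pushforward rot.
  rewrite ge0_integral_distribution//.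
  - by apply: eq_integral => s _; rewrite /= sQ scalerN scaleNr.
  - by apply/measurable_EFinP; exact: (proj1 (bc t)).
  - by move=> s; rewrite lee_fin; have /andP[] := chi01 (t *: s).
have sum : radial_mean sigma chi t + radial_mean sigma chi (- t) =
    chi (const_mx t) + chi (const_mx (- t)).
  rewrite /radial_mean -expectD//.
  have mN := measurableC (@measurable_unit_sphere R 1).
  have key s : ~ (~` [set x : 'rV[R]_1 | enorm x = 1]) s ->
      chi (t *: s) + chi (- t *: s) = chi (const_mx t) + chi (const_mx (- t)).
    move=> /contrapT; rewrite -[X in X -> _]/([set x | enorm x = 1] s) enorm_unitE/=.
    rewrite /dotp big_ord1 => /eqP; rewrite -expr2 sqrf_eq1 => s1.
    have E a : s 0 0 = a -> forall r, r *: s = const_mx (r * a).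
      by move=> sa r; apply/matrixP => i j; rewrite !mxE (ord1 i) (ord1 j) sa.
    by case/orP: s1 => /eqP /E H; rewrite !H ?mulr1// !mulrN1 opprK addrC.
  rewrite -[RHS](expect_cst sigma); apply/eqP; rewrite eq_le; apply/andP; split.
    apply: (expect_le_ae _ _ mN (sphere_negligibleC hs)) => [||s /key ->//].
    - exact: bounded_measurableD.
    - exact: bounded_measurable_cst.
  apply: (expect_le_ae _ _ mN (sphere_negligibleC hs)) => [||s /key ->//].
  - exact: bounded_measurable_cst.
  - exact: bounded_measurableD.
by move: sum; rewrite -flip; lra.
Qed.

Lemma ratio_succ_inj (M r r' : nat) :
  r.+1%:R / M.+1%:R = r'.+1%:R / M.+1%:R :> R -> r = r'.
Proof.
move=> /(congr1 (fun x => x * M.+1%:R)); rewrite !divfK ?pnatr_eq0//.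
by move=> /eqP; rewrite eqr_nat eqSS => /eqP.
Qed.

(** A grid mean is a Riemann sum over the radii of averages over the directions. The threshold is
    uniform in the outcome, because the randomly placed points form a vanishing fraction of the grid
    wherever they lie. *)
Lemma grid_mean_cvg d {dO} {Omega : measurableType dO} (P : probability Omega R)
    (sigma : probability 'rV[R]_d R) (G : nat -> Omega -> set 'rV[R]_d)
    (chi : 'rV[R]_d -> R) (L e : R) :
  0 <= L -> (forall x, 0 <= chi x <= 1) ->
  (forall x y, `|chi x - chi y| <= L * `|x - y|) -> sphere_uniform sigma ->
  grid_sequence P sigma G -> 0 < e ->
  exists n0 : nat, forall n, (n0 <= n)%N -> forall w (p : 'I_n -> 'rV[R]_d),
    injective p -> range p = G n w -> `|mean (chi \o p) - ball_mean sigma chi| <= e.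
Proof.
move=> L0 chi01 chiL hs; have e20 : 0 < e -> 0 < e / 2 by move=> ?; lra.
rewrite /grid_sequence; case: ifP => d1.
  move/eqP: d1 => d1; subst d => GE e0.
  have rL := radial_mean_lipschitz L0 chi01 chiL hs.
  pose M1 := (Num.truncn (L / (e / 2))).+1; pose M2 := (Num.truncn (2 / (e / 2))).+1.
  exists (2 * (maxn M1 M2).+1)%N => n n0 w p pinj pG.
  have {}n0 : ((maxn M1 M2).+1 <= n./2)%N by have := half_leq n0; rewrite mul2n doubleK.
  set M := n./2 in n0 *.
  have M0 : (0 < M)%N by apply: leq_trans n0.
  pose c (b : bool) (t : R) : 'rV[R]_1 := const_mx (if b then t else - t).
  pose ev (a : 'I_M * bool) := c a.2 (a.1.+1%:R / M.+1%:R).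
  have evinj : injective ev.
    have pos (r : nat) : 0 < r.+1%:R / M.+1%:R :> R by rewrite divr_gt0 ?ltr0n.
    move=> [r b] [r' b'] /matrixP /(_ 0 0); rewrite !mxE /=.
    case: b; case: b' => /= E.
    - by have /val_inj -> := ratio_succ_inj E.
    - by exfalso; move: (pos r); rewrite E oppr_gt0 ltNge ltW.
    - by exfalso; move: (pos r'); rewrite -E oppr_gt0 ltNge ltW.
    - by move/oppr_inj: E => /ratio_succ_inj/val_inj ->.
  have evp a : exists i, p i = ev a.
    suff : range p (ev a) by move=> [i _ <-]; exists i.
    rewrite pG GE; right; exists (a.1).+1 => /=; first exact: ltn_ord.
    by rewrite /ev /c; case: (a.2); [left|right].
  have cI : #|{: 'I_M * bool}| = (M * 2)%N by rewrite card_prod card_ord card_bool.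
  have := mean_enumeration_dist evinj evp chi01; rewrite cI muln_gt0 M0 => /(_ isT) H1.
  have n1 : (n - M * 2 <= 1)%N.
    by rewrite leq_subLR muln2 -{1}(odd_double_half n) [leqRHS]addnC leq_add2r leq_b1.
  have avg : (M * 2)%:R^-1 * (\sum_a chi (ev a)) =
      M%:R^-1 * \sum_(r < M) radial_mean sigma chi (r.+1%:R / M.+1%:R).
    rewrite natrM invfM -mulrA; congr (_ * _).
    rewrite -(pair_big xpredT xpredT (fun r b => chi (ev (r, b))))/= mulr_sumr.
    apply: eq_bigr => r _; rewrite big_bool/= (radial_mean_line _ L0 chi01 chiL hs).
    by rewrite /ev /c/= mulrC.
  rewrite avg in H1.
  have H2 := riemann_sum_lipschitz rL M0.
  have MM1 : (M1 <= M)%N by rewrite (leq_trans _ n0)// leqW// leq_maxl.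
  have Mn : (M <= n)%N by rewrite /M -{2}(odd_double_half n) -addnn addnA leq_addl.
  have MM2 : (M2 <= n)%N by rewrite (leq_trans _ Mn)// (leq_trans _ n0)// leqW// leq_maxr.
  have K2 : L / M%:R <= e / 2.
    rewrite ler_pdivrMr ?ltr0n// mulrC -ler_pdivrMr ?e20//.
    by apply: le_trans (ltW (truncnS_gt _)) _; rewrite ler_nat.
  have nR0 : 0 < n%:R :> R by rewrite ltr0n (leq_trans M0).
  have K1 : 2 * (n - M * 2)%N%:R / n%:R <= e / 2.
    rewrite ler_pdivrMr//; apply: (@le_trans _ _ 2).
      by rewrite -[leRHS]mulr1 ler_pM2l// -(ler_nat R) in n1 *.
    rewrite mulrC -ler_pdivrMr ?e20//.
    by apply: le_trans (ltW (truncnS_gt _)) _; rewrite ler_nat.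
  apply: le_trans (ler_distD _ _ _) (_ : _ + _ <= _); last first.
    by apply: le_trans (lerD (le_trans H1 K1) (le_trans H2 K2)) _; lra.
move=> [nR [nS [n0 [s [S [nE [nRoo nSoo] [s1 sinj _ sconv] _ GE]]]]]] e0.
pose f N t : R := N%:R^-1 * \sum_(j < N) chi (t *: s N j).
have sn1 N j : enorm (s N j) = 1 by exact: s1.
have fL N t t' : `|f N t - f N t'| <= L * `|t - t'|.
  rewrite /f -mulrBr -sumrB normrM.
  have [->|N0] := posnP N.
    by rewrite invr0 normr0 mul0r mulr_ge0.
  have N0R : 0 < N%:R :> R by rewrite ltr0n.
  rewrite gtr0_norm ?invr_gt0// ler_pdivrMl//.
  apply: le_trans (ler_norm_sum _ _ _) _.
  rewrite -[X in _ <= X%:R * _](card_ord N) mulr_natl -sumr_const; apply: ler_sum => j _.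
  exact: chiZ_lipschitz.
have rL := radial_mean_lipschitz L0 chi01 chiL hs.
have fr t : f N t @[N --> \oo] --> radial_mean sigma chi t.
  apply: (sconv (fun x => chi (t *: x))).
    apply: (@lipschitz_continuous_mx _ _ _ (L * `|t|)); first by rewrite mulr_ge0.
    move=> x y; apply: le_trans (chiL _ _) _.
    by rewrite -scalerBr normrZ mulrA.
  by exists 1 => x; have /andP[? ?] := chi01 (t *: x); rewrite ger0_norm.
have [N0 [M0 HNM]] := riemann_sum_uniform fL rL fr (e20 e0).
pose N1 := (Num.truncn (2 / (e / 2))).+1.
move/cvgnyPge: nRoo => /(_ M0)[k1 _ Hk1].
move/cvgnyPge: nSoo => /(_ (maxn N0 N1))[k2 _ Hk2].
exists (maxn 1 (maxn k1 k2)) => n; rewrite !geq_max => /and3P[n1 nk1 nk2] w p pinj pG.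
have [En nR0 nS0 n0lt] := nE n n1.
have := Hk1 n nk1; have := Hk2 n nk2; rewrite /= geq_max => /andP[NN0 NN1] MM0.
have {}GE := GE n w; move: n0lt; rewrite leq_min => /andP[n0R n0S].
move: (nR n) (nS n) (n0 n) (S n) En nR0 nS0 NN0 NN1 MM0 GE n0R n0S
  => M N k Sn En M_gt0 N_gt0 NN0 NN1 MM0 GE kM kN.
pose ev (a : 'I_M * 'I_N) := (a.1.+1%:R / M.+1%:R) *: s N a.2.
have pos (r : nat) : 0 < r.+1%:R / M.+1%:R :> R by rewrite divr_gt0 ?ltr0n.
have evinj : injective ev.
  move=> [r j] [r' j'] /= E.
  have rr : r = r'.
    have := congr1 enorm E; rewrite /ev !enormZ !sn1 !mulr1 !gtr0_norm//=.
    by move=> /ratio_succ_inj/val_inj.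
  subst r'; have /sinj -> : s N j = s N j'; last by [].
  by apply: (scalerI _ E); rewrite gt_eqF.
have evp a : exists i, p i = ev a.
  suff : range p (ev a) by move=> [i _ <-]; exists i.
  by rewrite pG GE; left; exists (a.1).+1, a.2; split => //=; exact: ltn_ord.
have cI : #|{: 'I_M * 'I_N}| = (M * N)%N by rewrite card_prod !card_ord.
have := mean_enumeration_dist evinj evp chi01; rewrite cI muln_gt0 M_gt0 N_gt0 => /(_ isT) H1.
have avg : (M * N)%:R^-1 * (\sum_a chi (ev a)) =
    M%:R^-1 * \sum_(r < M) f N (r.+1%:R / M.+1%:R).
  rewrite natrM invfM -mulrA; congr (_ * _).
  rewrite -(pair_big xpredT xpredT (fun r j => chi (ev (r, j))))/= mulr_sumr.
  by apply: eq_bigr => r _; rewrite /f /ev.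
rewrite avg in H1.
have H2 := HNM N M NN0 MM0.
have nR0 : 0 < n%:R :> R by rewrite ltr0n.
have NR0 : 0 < N%:R :> R by rewrite ltr0n.
(* The extra points number fewer than [M] among at least [M * N], a fraction of at most [1 / N]. *)
have K1 : 2 * (n - M * N)%N%:R / n%:R <= e / 2.
  apply: (@le_trans _ _ (2 / N%:R)).
    rewrite -!mulrA ler_pM2l// ler_pdivrMr// mulrC ler_pdivlMr// -natrM ler_nat.
    by rewrite {1}En addKn En (leq_trans _ (leq_addr _ _))// leq_mul2r (ltnW kM) orbT.
  rewrite ler_pdivrMr// mulrC -ler_pdivrMr ?e20//.
  by apply: le_trans (ltW (truncnS_gt _)) _; rewrite ler_nat.
apply: le_trans (ler_distD _ _ _) (_ : _ + _ <= _); last first.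
  by apply: le_trans (lerD (le_trans H1 K1) H2) _; lra.
Qed.

End grid_means.

(** * Consistency of the empirical transport *)

Section law_of_center_outward.
Context {R : realType} {d : nat}.
Context (mu sigma : probability 'rV[R]_d R) (F : 'rV[R]_d -> 'rV[R]_d).
Hypothesis hsigma : sphere_uniform sigma.
Hypothesis mF : measurable_fun setT F.
Hypothesis lawF : forall B, measurable B -> mu (F @^-1` B) = ball_uniform sigma B.
Local Notation unif := (uniform_prob (@ltr01 R)).

Lemma measurable_scale2 :
  measurable_fun setT (fun z : R * 'rV[R]_d => z.1 *: z.2).
Proof.
apply: measurable_fun_mx => i j.
have -> : (fun z : R * 'rV[R]_d => (z.1 *: z.2) i j) = (fun z => z.1 * z.2 i j).
  by apply/funext => z; rewrite mxE.
apply: measurable_funM => //.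
have mc := measurable_coord (R := R) (m := 1) (n := d) i j.
have ms : measurable_fun setT (@snd R 'rV[R]_d) by [].
exact: (measurableT_comp mc ms).
Qed.

(** Identifies the limit of the sample means of [chi] at the population images with that of the grid
    means: the two empirical laws to be coupled have a common limit. *)
Lemma center_outward_mean (chi : 'rV[R]_d -> R) (L : R) : 0 <= L ->
  (forall x, 0 <= chi x <= 1) -> (forall x y, `|chi x - chi y| <= L * `|x - y|) ->
  \int[mu]_x chi (F x) = ball_mean sigma chi.
Proof.
move=> L0 chi01 chiL.
have bc := bounded_measurable_chi L0 chi01 chiL.
have mE : measurable_fun setT (EFin \o chi) by apply/measurable_EFinP; exact: (proj1 bc).
have c0 x : (0 <= (chi x)%:E)%E by rewrite lee_fin; have /andP[] := chi01 x.
pose FF : {mfun 'rV[R]_d >-> 'rV[R]_d} := HB.pack F (isMeasurableFun.Build _ _ _ _ _ mF).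
rewrite /ball_mean /Rintegral; congr fine.
transitivity (\int[distribution mu FF]_x (chi x)%:E)%E.
  by rewrite ge0_integral_distribution.
pose SS : {mfun (R * 'rV[R]_d)%type >-> 'rV[R]_d} :=
  HB.pack (fun z : R * 'rV[R]_d => z.1 *: z.2) (isMeasurableFun.Build _ _ _ _ _ measurable_scale2).
transitivity (\int[pushforward (unif \x sigma)%E SS]_x (chi x)%:E)%E.
  apply: eq_measure_integral; first exact: measurable_scale2.
  by move=> mS A mA _; exact: lawF.
rewrite ge0_integral_pushforward//; last exact: measurable_scale2.
rewrite preimage_setT fubini_tonelli1//=; last first.
  by apply: (measurableT_comp mE); exact: measurable_scale2.
transitivity (\int[unif]_t (radial_mean sigma chi t)%:E)%E.
  apply: eq_integral => t _; rewrite /fubini_F /= /radial_mean /Rintegral fineK//.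
  apply: integrable_fin_num => //; apply: (@bounded_measurable_integrable _ _ _ sigma (fun s => chi (t *: s))).
  exact: bounded_measurable_chiZ L0 chi01 chiL t.
rewrite integral_uniform.
- by rewrite subr0 invr1 mul1e.
- apply/measurable_EFinP; apply: continuous_measurable_fun.
  exact: lipschitz_continuous (radial_mean_lipschitz L0 chi01 chiL hsigma).
- by move=> t; rewrite lee_fin; apply: expect_ge0 => s; have /andP[] := chi01 (t *: s).
Qed.

Lemma measurable_set1_mx m n (x : 'M[R]_(m, n)) : measurable [set x].
Proof.
have -> : [set x] = \bigcap_(ij in [set: 'I_m * 'I_n]) (fun y : 'M[R]_(m, n) => y ij.1 ij.2) @^-1` [set x ij.1 ij.2].
  apply/seteqP; split => [y -> ij _//|y H]; apply/matrixP => i j; exact: (H (i, j) I).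
apply: fin_bigcap_measurable => // -[i j] _; rewrite -[X in measurable X]setTI.
by apply: (measurable_coord i j) => //; exact: measurable_set1.
Qed.

(** The radius is almost surely nonzero and [sigma] is carried by the unit sphere. This keeps the
    oracle arguments away from the origin, where the score map may be discontinuous. *)
Lemma center_outward_neq0 : mu (F @^-1` [set 0]) = 0%E.
Proof.
rewrite lawF; last exact: measurable_set1_mx.
rewrite /ball_uniform.
have -> : [set z : R * 'rV[R]_d | [set 0] (z.1 *: z.2)] = ([set 0] `*` setT) `|` (setT `*` [set 0]).
  apply/seteqP; split => -[r s] /=.
    by move=> /eqP; rewrite scaler_eq0 => /orP[/eqP ->|/eqP ->]; [left|right].
  by move=> [[-> _]|[_ ->]]; rewrite ?scale0r ?scaler0.
have m1 := measurable_set1_mx (0 : 'rV[R]_d).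
apply/eqP; rewrite eq_le measure_ge0 andbT.
have mA : measurable ([set 0] `*` setT : set (R * 'rV[R]_d)) by exact: measurableX.
have mB : measurable (setT `*` [set 0] : set (R * 'rV[R]_d)) by exact: measurableX.
apply: le_trans (measureU2 (unif \x sigma)%E mA mB) _.
rewrite [X in (X + _)%E](product_measure1E unif sigma)//.
rewrite [X in (_ + X)%E](product_measure1E unif sigma)//.
have u0 : unif [set 0] = 0%E by rewrite /uniform_prob integral_set1.
suff s0 : sigma [set 0] = 0%E.
  have e1 : (unif [set 0%R] * sigma setT = 0)%E by rewrite u0 mul0e.
  have e2 : (unif setT * sigma [set 0%R] = 0)%E by rewrite s0 mule0.
  apply: (@le_trans _ _ (0 + 0)%E); last by rewrite adde0.
  by apply: leeD; rewrite le_eqVlt; apply/orP; left; apply/eqP.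
apply/eqP; rewrite eq_le measure_ge0 andbT -(sphere_negligibleC hsigma).
apply: le_measure; rewrite ?inE//; first by apply: measurableC; exact: measurable_unit_sphere.
by move=> x /= ->; rewrite enorm0 => /esym/eqP; rewrite oner_eq0.
Qed.

End law_of_center_outward.

(** * Supporting gradients of convex functions *)

Section convex_gradient.
Context {R : realType} {d : nat}.
Implicit Types (phi : 'rV[R]_d -> R) (x y u v : 'rV[R]_d).

Lemma is_diff_quotient phi x u v (e : R) : is_diff x phi (dotp u) -> 0 < e ->
  exists2 del, 0 < del & forall h, 0 < h < del ->
    `|h^-1 * (phi (h *: v + x) - phi x) - dotp u v| <= e.
Proof.
move=> [df dv] e0.
have D : 'D_v phi x = dotp u v by rewrite deriveE// dv.
have := @diff_derivable _ _ _ phi x v df; rewrite /derivable => cv.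
have {}cv : (fun h => h^-1 *: ((phi \o shift x) (h *: v) - phi x)) @ 0^' --> dotp u v.
  by rewrite -D; exact: cv.
have /cvgrPdist_le /(_ _ e0) := cv.
move=> /nbhs_ballP[del /= del0 H]; exists del => // h /andP[h0 hd].
have := H h; rewrite /ball/= sub0r normrN gtr0_norm// => /(_ hd).
by rewrite gt_eqF// distrC; apply.
Qed.

Lemma convex_below phi x y (h : R) : convex_function setT phi -> 0 <= h <= 1 ->
  phi (x + h *: (y - x)) <= phi x + h * (phi y - phi x).
Proof.
move=> cphi /andP[h0 h1].
pose t : {i01 R} := Itv01 h0 h1.
have := cphi t y x; rewrite !in_setT => /(_ isT isT).
rewrite /conv/=.
have -> : h *: y + (1 - h) *: x = x + h *: (y - x) :> 'rV[R]_d.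
  by rewrite scalerBl scale1r scalerBr addrC addrAC -addrA.
move=> H; apply: le_trans H _; change (h * phi y + (1 - h) * phi x <= phi x + h * (phi y - phi x)); lra.
Qed.

Lemma convex_subgradient phi x u y : convex_function setT phi -> is_diff x phi (dotp u) ->
  phi x + dotp u (y - x) <= phi y.
Proof.
move=> cphi dphi; apply/ler_addgt0Pr => e e0.
have [del del0 H] := is_diff_quotient (y - x) dphi e0.
pose h := Num.min (del / 2) 1.
have h0 : 0 < h by rewrite lt_min ltr01 divr_gt0.
have h1 : h <= 1 by rewrite ge_min lexx orbT.
have hd : h < del by rewrite /h; case: (leP (del / 2) 1); lra.
have := H h; rewrite h0 hd => /(_ isT).
have := @convex_below phi x y h cphi; rewrite (ltW h0) h1 addrC => /(_ isT) C.
have : h^-1 * (phi (h *: (y - x) + x) - phi x) <= phi y - phi x.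
  by rewrite ler_pdivrMl//; lra.
rewrite ler_norml; lra.
Qed.

(* On [G] the supremum of the tangent functions agrees with [phi], but it is Lipschitz and
   hence measurable on the whole space. *)
Lemma lipschitz_convex_modification phi (F : 'rV[R]_d -> 'rV[R]_d) (G : set 'rV[R]_d) :
  convex_function setT phi -> (forall x, G x -> is_diff x phi (dotp (F x))) ->
  (forall x, `|F x| <= 1) -> G !=set0 ->
  exists psi : 'rV[R]_d -> R,
    [/\ forall x y, `|psi x - psi y| <= d%:R * `|x - y|,
        forall x y, G x -> psi x + dotp (F x) (y - x) <= psi y &
        forall x v e, G x -> 0 < e -> exists2 del, 0 < del & forall h, 0 < h < del ->
          psi (x + h *: v) <= psi x + h * dotp (F x) v + e * h].
Proof.
move=> cphi dphi F1 [x0 Gx0].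
pose S x := [set phi z + dotp (F z) (x - z) | z in G].
have S0 x : S x !=set0 by exists (phi x0 + dotp (F x0) (x - x0)), x0.
have Sub x : ubound (S x) (phi x).
  by move=> _ [z Gz <-]; apply: convex_subgradient => //; exact: dphi.
have Sb x : has_ubound (S x) by exists (phi x).
pose psi x := sup (S x).
have psi_le x : psi x <= phi x by apply: ge_sup.
have psi_ge x z : G z -> phi z + dotp (F z) (x - z) <= psi x.
  by move=> Gz; apply: ub_le_sup => //; exists z.
have psiG x : G x -> psi x = phi x.
  move=> Gx; apply/eqP; rewrite eq_le psi_le/=.
  by apply: le_trans (psi_ge x x Gx); rewrite subrr /dotp big1 ?addr0// => k _; rewrite mxE mulr0.
exists psi; split.
- have H x y : psi x - psi y <= d%:R * `|x - y|.
    rewrite lerBlDr; apply: ge_sup => // _ [z Gz <-].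
    have Hz := psi_ge y z Gz.
    have -> : x - z = (y - z) + (x - y) by rewrite [RHS]addrC addrA subrK.
    rewrite (dotpDr _ (y - z)).
    have := dotp_le (F z) (x - y); rewrite ler_norml => /andP[_].
    have : d%:R * `|F z| * `|x - y| <= d%:R * `|x - y| by rewrite -mulrA ler_wpM2l// ler_piMl.
    lra.
  move=> x y; rewrite ler_norml H andbT lerNl opprB.
  by rewrite distrC H.
- by move=> x y Gx; rewrite psiG//; exact: psi_ge.
move=> x v e Gx e0; have [del del0 H] := is_diff_quotient v (dphi _ Gx) e0.
exists del => // h hd; have /andP[h0 _] := hd.
apply: le_trans (psi_le _) _; rewrite (psiG _ Gx).
have := H h hd; rewrite (addrC (h *: v)) ler_norml => /andP[_].
by rewrite lerBlDr ler_pdivrMl//; lra.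
Qed.

End convex_gradient.

Lemma grid_norm_le1 (R : realType) d {dO} {Omega : measurableType dO} (P : probability Omega R)
    (sigma : probability 'rV[R]_d R) (G : nat -> Omega -> set 'rV[R]_d) n w x :
  grid_sequence P sigma G -> (0 < n)%N -> G n w x -> `|x| <= 1.
Proof.
have ratio r N : (r <= N)%N -> 0 <= (r%:R : R) / N.+1%:R <= 1.
  by move=> rN; rewrite divr_ge0//= ler_pdivrMr ?ltr0n// mul1r ler_nat leqW.
rewrite /grid_sequence; case: ifP => [d1 GE n0|_].
  have cst (t : R) : 0 <= t <= 1 -> `|const_mx t : 'rV[R]_d| <= 1 /\ `|const_mx (- t) : 'rV[R]_d| <= 1.
    move=> /andP[t0 t1]; split; apply: mx_norm_le => // i j; rewrite mxE ?normrN ger0_norm//.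
  rewrite GE => -[[_ ->]|[r /andP[_ rn] [->|->]]]; first by rewrite normr0.
    by have [] := cst _ (ratio _ _ rn).
  by have [] := cst _ (ratio _ _ rn).
move=> [nR [nS [n0 [s [S [nE _ [s1 _ _ _] _ GE]]]]]] n_gt0.
rewrite GE => -[[r [j [/andP[_ rn] ->]]]|[j _ ->]]; apply: le_trans (norm_le_enorm _) _;
  rewrite enormZ s1 mulr1.
  by have /andP[r0 r1] := ratio _ _ rn; rewrite ger0_norm.
rewrite ger0_norm ?invr_ge0// invf_le1 ?mulr_gt0// -natrM ler1n muln_gt0//.
Qed.

Section consistency.
Context {R : realType} {d : nat} {dO} {Omega : measurableType dO} (P : probability Omega R).
Context (mu sigma : probability 'rV[R]_d R) (F : 'rV[R]_d -> 'rV[R]_d).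
Context (Z : nat -> Omega -> 'rV[R]_d) (G : nat -> Omega -> set 'rV[R]_d).
Hypothesis mZ : forall i, measurable_fun setT (Z i).
Hypothesis lawZ : product_law P Z mu.
Hypothesis hsigma : sphere_uniform sigma.
Hypothesis hF : center_outward mu sigma F.
Hypothesis hG : grid_sequence P sigma G.

Definition frequency (A : set 'rV[R]_d) n (w : Omega) : R :=
  n%:R^-1 * \sum_(i < n) \1_A (Z i w).

Lemma freqE (b : 'rV[R]_d -> bool) n w :
  freq (fun i : 'I_n => b (Z i w)) = frequency [set x | b x] n w.
Proof.
rewrite /freq /frequency; congr (_ * _); apply: eq_bigr => i _; rewrite indicE.
by have -> : (Z i w \in [set x | b x]) = b (Z i w) by apply/idP/idP; rewrite inE.
Qed.

Lemma bounded_measurable_frequency A n : measurable A -> bounded_measurable (frequency A n).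
Proof.
move=> mA; apply: bounded_measurableZ; apply: bounded_measurable_sum => i.
exact: (bounded_measurable_comp (mZ i) (bounded_measurable_indic mA)).
Qed.

Lemma expect_frequency A n : measurable A -> (0 < n)%N ->
  \int[P]_w frequency A n w = fine (mu A).
Proof.
move=> mA n0; have bI i : bounded_measurable (fun w => \1_A (Z i w) : R).
  exact: (bounded_measurable_comp (mZ i) (bounded_measurable_indic mA)).
rewrite expectZ; last by apply: bounded_measurable_sum => i.
rewrite expect_sum//.
under eq_bigr do rewrite (product_law_integral mZ lawZ _ (bounded_measurable_indic mA)) expect_indic//.
by have := mean_cst n0 (fine (mu A)).
Qed.

Lemma enorm_lt1_norm x : `|F x| <= 1.
Proof. by have [_ F1 _ _] := hF; exact: le_trans (norm_le_enorm _) (ltW (F1 x)). Qed.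

Lemma center_outward_potential : exists (G0 : set 'rV[R]_d) (phi : 'rV[R]_d -> R),
  [/\ measurable G0, mu (~` G0) = 0%E,
     forall x y, `|phi x - phi y| <= d%:R * `|x - y|,
     forall x y, G0 x -> phi x + dotp (F x) (y - x) <= phi y &
     forall x v e, G0 x -> 0 < e -> exists2 del, 0 < del & forall h, 0 < h < del ->
          phi (x + h *: v) <= phi x + h * dotp (F x) v + e * h].
Proof.
have [mF F1 [phi [cphi [A [mA A0 AE]]]] _] := hF.
have Gdiff x : (~` A) x -> is_diff x phi (dotp (F x)).
  by move=> Ax; apply: contrapT => H; apply: Ax; apply: AE.
have GN : ~` A !=set0.
  apply/set0P/eqP => A0'; have : mu A = 1%E.
    by rewrite -[A]setCK A0' setC0 probability_setT.
  by rewrite A0 => /eqP; rewrite eq_sym onee_eq0.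
have [psi [p1 p2 p3]] := lipschitz_convex_modification cphi Gdiff enorm_lt1_norm GN.
exists (~` A), psi; split => //; first exact: measurableC.
by rewrite setCK.
Qed.

Lemma lipschitz_measurable (f : 'rV[R]_d -> R) (L : R) : 0 <= L ->
  (forall x y, `|f x - f y| <= L * `|x - y|) -> measurable_fun setT f.
Proof. by move=> L0 fL; apply: continuous_measurable_mx; exact: lipschitz_continuous_mx L0 fL. Qed.

Lemma measurable_le_set d' (T : measurableType d') (f g : T -> R) :
  measurable_fun setT f -> measurable_fun setT g -> measurable [set x | f x <= g x].
Proof.
move=> mf mg.
have -> : [set x | f x <= g x] = (fun x => g x - f x) @^-1` `[0, +oo[.
  by apply/seteqP; split => x /=; rewrite in_itv/= andbT subr_ge0.
by rewrite -[X in measurable X]setTI; apply: (measurable_funB mg mf).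
Qed.

(** The assignment is quantified after the outcome, with no measurability, so its frequency of
    errors is dominated by a measurable [B] of small mean. The constants are chosen in the order
    [K], [eta], [K'], [eps], each making small a term of [transport_bound] whose coefficient
    involves earlier ones; [n] comes last. *)
Lemma transport_consistency (e' e0 : R) : 0 < e' -> 0 < e0 ->
  exists n0 : nat, forall n, (n0 <= n)%N -> exists2 B : Omega -> R,
    bounded_measurable B /\ \int[P]_w B w <= e0 &
    exists N : set Omega, [/\ measurable N, P N = 0%E &
      forall w, ~ N w -> forall (p : 'I_n -> 'rV[R]_d) (s : 'S_n),
        injective p -> range p = G n w ->
        (forall t : 'S_n, \sum_(i < n) dotp (Z i w) (p (t i)) <= \sum_(i < n) dotp (Z i w) (p (s i))) ->
        freq (fun i : 'I_n => e' < `|p (s i) - F (Z i w)|) <= B w].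
Proof.
move=> e'0 e00.
have [mF F1 _ lawF] := hF.
have [G0 [phi [mG0 muG0 phiL phis phid]]] := center_outward_potential.
have mphi := lipschitz_measurable (ler0n R d) phiL.
(* Five terms receive [a] each: the two tails, the irregular points, the cell diameter and the total
   cell error. *)
pose a := e0 / 5; have a0 : 0 < a by rewrite divr_gt0.
pose e1 := e' / 4; have e10 : 0 < e1 by rewrite divr_gt0.
pose big (K : R) : set 'rV[R]_d := [set x | K < `|x|].
have mbig K : measurable (big K).
  have -> : big K = ~` [set x | `|x| <= K].
    by apply/seteqP; split => x /=; rewrite /big/= ltNge => /negP.
  apply: measurableC; apply: measurable_le_set => //.
  apply: (@lipschitz_measurable _ 1) => // x y; rewrite mul1r; exact: ler_dist_dist.
have tail e : 0 < e -> forall K0 : R, 0 <= K0 -> exists2 K, K0 <= K & fine (mu (big K)) <= e.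
  move=> e_gt0 K0 K00.
  have ev x : setT x -> exists j0, forall j, (j0 <= j)%N -> (~` big (K0 + j%:R)) x.
    move=> _; exists (Num.truncn `|x|).+1 => j jx; apply/negP; rewrite -leNgt.
    apply: le_trans (ltW (truncnS_gt _)) _; apply: (@le_trans _ _ j%:R); first by rewrite ler_nat.
    by rewrite lerDr.
  have muT : mu (~` setT) = 0%E by rewrite setCT measure0.
  have [j] := exhausting_probability (fun j => measurableC (mbig (K0 + j%:R))) measurableT muT ev e_gt0.
  by rewrite setCK => H; exists (K0 + j%:R) => //; rewrite lerDl.
have [K K0 PK] := tail (a / 2) ltac:(by rewrite divr_gt0) 0 (lexx 0).
pose reg (eta : R) (k : 'I_d) : set 'rV[R]_d :=
  [set z | phi (z + eta *: delta_mx 0 k) <= phi z + eta * F z 0 k + e1 * eta] `&`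
  [set z | phi (z - eta *: delta_mx 0 k) <= phi z - eta * F z 0 k + e1 * eta].
have mphiD (v : 'rV[R]_d) : measurable_fun setT (fun z : 'rV[R]_d => phi (z + v)).
  apply: (lipschitz_measurable (ler0n R d)) => x y; apply: le_trans (phiL _ _) _.
  by rewrite opprD addrACA subrr addr0.
have mFk k : measurable_fun setT (fun z => F z 0 k).
  exact: (measurableT_comp (measurable_coord 0 k) mF).
have mreg eta k : measurable (reg eta k).
  apply: measurableI; apply: measurable_le_set; try exact: mphiD.
    apply: measurable_funD => //; apply: measurable_funD => //.
    by apply: measurable_funM.
  apply: measurable_funD => //; apply: measurable_funB => //.
  by apply: measurable_funM.
pose Reg j := \bigcap_(k in [set: 'I_d]) reg j.+1%:R^-1 k.
have mReg j : measurable (Reg j) by apply: fin_bigcap_measurable => // k _; exact: mreg.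
have regev z : G0 z -> exists j0, forall j, (j0 <= j)%N -> Reg j z.
  move=> Gz; have : \forall j \near \oo, forall k : 'I_d, reg j.+1%:R^-1 k z.
    apply: filter_forall => k.
    have [d1 d10 H1] := phid z (delta_mx 0 k) e1 Gz e10.
    have [d2 d20 H2] := phid z (- delta_mx 0 k) e1 Gz e10.
    have n1 := near_infty_natSinv_lt (PosNum d10).
    have n2 := near_infty_natSinv_lt (PosNum d20).
    near=> j.
    have j0 : 0 < j.+1%:R^-1 :> R by rewrite invr_gt0.
    split.
      have := H1 j.+1%:R^-1; rewrite j0 dotp_delta /=; apply.
      by near: j; exact: n1.
    have := H2 j.+1%:R^-1; rewrite j0 dotpNr dotp_delta scalerN mulrN /=; apply.
    by near: j; exact: n2.
  by move=> [j0 _ H]; exists j0 => j /H Hj k _; exact: Hj.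
have [j PReg] := exhausting_probability mReg mG0 muG0 regev a0.
set eta : R := j.+1%:R^-1 in PReg.
have eta0 : 0 < eta by rewrite invr_gt0.
pose cc := (eta * e1)^-1; have cc0 : 0 < cc by rewrite invr_gt0 mulr_gt0.
pose D1 := 16 * d%:R * K * cc; have D10 : 0 <= D1 by rewrite !mulr_ge0// ltW.
have D11 : 0 < D1 + 1 by lra.
(* The coefficient of this second tail contains the inverse of [eta], so [K'] can only be chosen
   after [eta]. *)
have [K' KK' PK'] := tail (a / (D1 + 1)) ltac:(by rewrite divr_gt0) K K0.
have K'0 := le_trans K0 KK'.
pose D2 := 2 * d%:R * K' * cc; have D20 : 0 <= D2 by rewrite !mulr_ge0// ltW.
have D21 : 0 < D2 + 1 by lra.
pose eps := Num.min (e' / 2) (a / (D2 + 1)).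
have eps0 : 0 < eps by rewrite lt_min !divr_gt0.
have epse' : eps + 2 * e1 <= e'.
  have : eps <= e' / 2 by rewrite ge_min lexx.
  by rewrite /e1; lra.
have epsD : eps * (D2 + 1) <= a by rewrite -ler_pdivlMr// ge_min lexx orbT.
have [I [chi [L [L0 chi01 chiL chi1 chieps]]]] := partition_of_unity d eps0.
pose D3 := 1 + 8 * d%:R * K * cc; have D30 : 0 < D3 by rewrite ltr_pwDl// !mulr_ge0// ltW.
(* Each of the [#|I|] cells brings a sampling error of mean at most [e3] and a grid error [e3],
   which keeps the mean of [del] below [a / D3]. *)
pose e3 := a / D3 / (2 * #|I|.+1%:R).
have e30 : 0 < e3 by rewrite !divr_gt0// mulr_gt0.
have Fmean c : \int[mu]_x chi c (F x) = ball_mean sigma (chi c).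
  exact: (center_outward_mean hsigma mF lawF L0 (chi01 c) (chiL c)).
have mchiF c : measurable_fun setT (chi c \o F).
  by apply: measurableT_comp => //; exact: lipschitz_measurable L0 (chiL c).
have lln : \forall n \near \oo, forall c,
    \int[P]_w `|n%:R^-1 * (\sum_(i < n) chi c (F (Z i w))) - ball_mean sigma (chi c)| <= e3.
  apply: filter_forall => c; rewrite -Fmean.
  exact: (law_of_large_numbers mZ lawZ (mchiF c) (fun x => chi01 c (F x)) e30).
have [n1 _ Hn1] := lln.
have grd c := cid (grid_mean_cvg L0 (chi01 c) (chiL c) hsigma hG e30).
pose n2 := (\max_c sval (grd c))%N.
exists (maxn 1 (maxn n1 n2)) => n; rewrite !geq_max => /and3P[n0 nn1 nn2].
pose vbar c w := n%:R^-1 * (\sum_(i < n) chi c (F (Z i w))).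
pose del w := \sum_c (`|vbar c w - ball_mean sigma (chi c)| + e3).
pose Rg := Reg j.
pose B w := del w + 2 * frequency (big K) n w + frequency (~` Rg) n w +
  cc * (2 * d%:R * eps * K' + 16 * d%:R * K * frequency (big K') n w + 8 * d%:R * K * del w).
have bv c : bounded_measurable (fun w => `|vbar c w - ball_mean sigma (chi c)|).
  apply: bounded_measurable_norm; apply: bounded_measurableB; last exact: bounded_measurable_cst.
  apply: bounded_measurableZ; apply: bounded_measurable_sum => i.
  apply: (bounded_measurable_comp (f := chi c \o F) (mZ i)); split => //.
  by exists 1 => x; have /andP[? ?] := chi01 c (F x); rewrite /= ger0_norm.
have bv3 c : bounded_measurable (fun w => `|vbar c w - ball_mean sigma (chi c)| + e3).
  by apply: bounded_measurableD => //; exact: bounded_measurable_cst.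
have bdel : bounded_measurable del by exact: bounded_measurable_sum.
have bfr A : measurable A -> bounded_measurable (frequency A n) by exact: bounded_measurable_frequency.
have Edel : \int[P]_w del w <= a / D3.
  rewrite expect_sum//; apply: (@le_trans _ _ (\sum_(c : I) (e3 + e3))).
    apply: ler_sum => c _; rewrite expectD//; last exact: bounded_measurable_cst.
    by rewrite expect_cst lerD2r; exact: Hn1.
  rewrite sumr_const -mulr_natr.
  have -> : (e3 + e3) * #|I|%:R = (a / D3) * (#|I|%:R / #|I|.+1%:R).
    have : 0 < #|I|.+1%:R :> R by rewrite ltr0n.
    by rewrite /e3; move: (#|I|.+1%:R) => q q0; field; rewrite !gt_eqF.
  apply: ler_piMr; first by rewrite divr_ge0 ?ltW.
  by rewrite ler_pdivrMr ?ltr0n// mul1r ler_nat.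
have mRgC : measurable (~` Rg) by apply: measurableC; exact: mReg.
have bB1 : bounded_measurable (fun w => 2 * frequency (big K) n w) by exact/bounded_measurableZ/bfr.
have bB2 : bounded_measurable (fun w => 16 * d%:R * K * frequency (big K') n w).
  exact/bounded_measurableZ/bfr.
have bB3 : bounded_measurable (fun w => 8 * d%:R * K * del w) by exact: bounded_measurableZ.
have bB4 : bounded_measurable (fun w => 2 * d%:R * eps * K' + 16 * d%:R * K * frequency (big K') n w).
  by apply: bounded_measurableD => //; exact: bounded_measurable_cst.
have bB5 : bounded_measurable (fun w => 2 * d%:R * eps * K' +
    16 * d%:R * K * frequency (big K') n w + 8 * d%:R * K * del w) by exact: bounded_measurableD.
have bB6 : bounded_measurable (fun w => del w + 2 * frequency (big K) n w).
  exact: bounded_measurableD.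
have bB7 : bounded_measurable (fun w => del w + 2 * frequency (big K) n w + frequency (~` Rg) n w).
  by apply: bounded_measurableD => //; exact: bfr.
exists B.
  split; first by apply: bounded_measurableD => //; exact: bounded_measurableZ.
  rewrite /B expectD//; last exact: bounded_measurableZ.
  rewrite expectD//; last exact: bfr.
  rewrite expectD// (expectZ P 2 (bfr _ (mbig K))) (expectZ P cc bB5) expectD//.
  rewrite expectD//; last exact: bounded_measurable_cst.
  rewrite expect_cst (expectZ P _ (bfr _ (mbig K'))) (expectZ P _ bdel) !expect_frequency//.
  have t1 : 16 * d%:R * K * cc * fine (mu (big K')) <= a.
    rewrite -/D1; apply: (@le_trans _ _ ((D1 + 1) * fine (mu (big K')))).
      by rewrite ler_wpM2r// ?lerDl// fine_ge0.
    by rewrite mulrC -ler_pdivlMr.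
  have t2 : cc * (2 * d%:R * eps * K') <= a.
    apply: le_trans epsD; have -> : cc * (2 * d%:R * eps * K') = eps * D2 by rewrite /D2; ring.
    by rewrite ler_pM2l// lerDl.
  have t3 : D3 * \int[P]_w del w <= a by rewrite mulrC -ler_pdivlMr.
  by move: PK PReg t1 t2 t3; rewrite /D3 -/Rg /a; lra.
(* The event that some observation misses the set on which [F] supports [phi]. *)
exists (\bigcup_i Z i @^-1` (~` G0)).
have mZG i : measurable (Z i @^-1` (~` G0)).
  by rewrite -[X in measurable X]setTI; apply: mZ => //; exact: measurableC.
split.
- exact: bigcupT_measurable.
- apply/eqP; rewrite eq_le measure_ge0 andbT.
  apply: le_trans (generalized_Boole_inequality P mZG (bigcupT_measurable _ mZG)) _.
  rewrite eseries0// => i _ _; rewrite -muG0.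
  by apply: (product_law1 lawZ); exact: measurableC.
move=> w Nw p s pinj pG popt.
have Gw (i : 'I_n) : G0 (Z i w).
  by apply: contrapT => H; apply: Nw; exists (i : nat).
pose z (i : 'I_n) := Z i w; pose u i := p (s i); pose v i := F (z i).
have p1 i : `|p i| <= 1.
  by apply: (grid_norm_le1 (w := w) hG n0); rewrite -pG; exists i.
have v1 i : `|v i| <= 1 by exact: enorm_lt1_norm.
apply: le_trans (_ : freq (fun i => eps + 2 * e1 < `|u i - v i|) <= _).
  rewrite /freq ler_wpM2l ?invr_ge0//; apply: ler_sum => i _; rewrite ler_nat.
  case: (ltP e' `|u i - v i|) => [lt|_] //.
  by rewrite (le_lt_trans epse' lt) leq_b1.
have deltaP : \sum_c `|mean (chi c \o u) - mean (chi c \o v)| <= del w.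
  apply: ler_sum => c _.
  have mu_ : mean (chi c \o u) = mean (chi c \o p).
    by rewrite /mean; congr (_ * _); rewrite [RHS](reindex_inj (@perm_inj _ s)).
  have nc : (sval (grd c) <= n)%N by apply: leq_trans nn2; exact: leq_bigmax.
  have H := svalP (grd c) n nc w p pinj pG.
  rewrite mu_; apply: le_trans (ler_distD (ball_mean sigma (chi c)) _ _) _.
  by rewrite addrC; apply: lerD => //; rewrite distrC.
have bigE (k : R) : freq (fun i => k < `|z i|) = frequency (big k) n w :> R.
  exact: (freqE (fun x => k < `|x|)).
have := @transport_bound R d n z u v phi n0 _ _ _ v1 I chi K K' eps e1 eta (del w)
  (fun i => `[< Rg (z i) >]) (fun c x => _) _ _ chieps e10 eta0 _ (ltW eps0) _ deltaP.
rewrite !bigE.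
have -> : freq (predC (fun i : 'I_n => `[< Rg (z i) >])) = frequency (~` Rg) n w :> R.
  rewrite /freq /frequency; congr (_ * _); apply: eq_bigr => i _; rewrite indicE /=.
  have -> // : (Z i w \in ~` Rg) = ~~ `[< Rg (z i) >].
  by apply/idP/idP => [|/asboolPn]; rewrite inE // => H; apply/asboolPn.
apply.
- by move=> i y; exact: (phis _ _ (Gw i)).
- move=> t; have := popt (t * s)%g; rewrite (eq_bigr (fun i => dotp (z i) (u (t i)))) => [|i _] //.
  by rewrite permM.
- by move=> i; exact: p1.
- by move=> c x; have /andP[] := chi01 c x.
- by move=> i; apply: chi1; exact: p1.
- by move=> i; apply: chi1; exact: v1.
- by rewrite K0.
- by move=> i /asboolP H k; have [] := H k Logic.I.
Unshelve. all: by end_near. Qed.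

End consistency.

(** Among the subsets of directions giving the same grid a canonical one is coded. The code is then
    a function of the grid, so its atoms are those on which independence is assumed. *)
Lemma grid_code (R : realType) d {dO} {Omega : measurableType dO} (P : probability Omega R)
    (sigma : probability 'rV[R]_d R) (G : nat -> Omega -> set 'rV[R]_d) n :
  grid_sequence P sigma G ->
  exists (code : Omega -> nat) (gr : nat -> set 'rV[R]_d),
    [/\ forall c, measurable [set w | code w = c], forall w, G n w = gr (code w) &
        forall w w', G n w = G n w' -> code w = code w'].
Proof.
rewrite /grid_sequence; case: ifP => [_ GE|_].
  exists (fun=> 0%N), (fun=> line_grid n); split => // c.
  have [->|c0] := eqVneq 0%N c; first by rewrite (_ : [set _ | _] = setT)//; apply/seteqP.
  by rewrite (_ : [set _ | _] = set0)//; apply/seteqP; split => // w /= /eqP; rewrite (negbTE c0).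
move=> [nR [nS [n0 [s [S [_ _ _ hS GE]]]]]].
pose gr A := sphere_grid (nR n) (@s (nS n)) A.
pose rep A := choose (fun A' => `[< gr A' = gr A >]) A.
have repE A : gr (rep A) = gr A.
  by apply/asboolP/(@chooseP _ (fun A' => `[< gr A' = gr A >])); apply/asboolP.
have repC A A' : gr A = gr A' -> rep A = rep A'.
  move=> E; rewrite /rep (@eq_choose _ _ (fun B => `[< gr B = gr A' >])) => [|B]; last by rewrite E.
  by apply: choose_id; apply/asboolP.
exists (fun w => choice.pickle (rep (S n w))), (fun c => if choice.unpickle c is Some A then gr A else set0).
split=> [c|w|w w'].
- have -> : [set w | choice.pickle (rep (S n w)) = c] =
      \bigcup_(A in [set A | choice.pickle (rep A) = c]) [set w | S n w = A].
    by apply/seteqP; split => [w /= H|w [A /= H ->]//]; exists (S n w).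
  by apply: fin_bigcup_measurable => // A _; have [_ /(_ A)[]] := hS n.
- by rewrite choice.pickleK GE repE.
- by rewrite !GE => /repC ->.
Qed.

(** * Rank statistics *)

Section strict_optimum.
Context {R : realType} {d n : nat}.
Implicit Types (p z : 'I_n -> 'rV[R]_d) (s t : 'S_n).

(** Expanding the squares, the transport cost of [s] is a constant minus twice its gain. *)
Definition gain p z s : R := \sum_i dotp (z i) (p (s i)).

Definition strict_opt p z s : bool :=
  [forall t : 'S_n, (t != s) ==> (gain p z t < gain p z s)].

Definition rank_perm p z : option 'S_n := [pick s | strict_opt p z s].

Lemma strict_optP p z s :
  reflect (forall t, t != s -> gain p z t < gain p z s) (strict_opt p z s).
Proof.
apply: (iffP forallP) => [H t ts|H t]; first by have /implyP := H t; apply.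
by apply/implyP; exact: H.
Qed.

Lemma strict_opt_unique p z s t : strict_opt p z s -> strict_opt p z t -> s = t.
Proof.
move=> /strict_optP hs /strict_optP ht; apply/eqP/contraT => st.
by have := lt_trans (hs t _) (ht s st); rewrite ltxx eq_sym st => /(_ isT).
Qed.

Lemma rank_perm_some p z s : strict_opt p z s -> rank_perm p z = Some s.
Proof.
rewrite /rank_perm; case: pickP => [t ht hs|/(_ s) ->//].
by congr Some; exact: strict_opt_unique ht hs.
Qed.

Lemma rank_perm_none p z : (forall s, ~~ strict_opt p z s) -> rank_perm p z = None.
Proof. by move=> H; rewrite /rank_perm; case: pickP => // s; rewrite (negbTE (H s)). Qed.

Lemma gain_perm p z (r s : 'S_n) : gain p (fun i => z (r i)) s = gain p z (r^-1 * s)%g.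
Proof.
rewrite /gain (reindex_inj (@perm_inj _ r^-1%g))/=; apply: eq_bigr => i _.
by rewrite permKV permM.
Qed.

Lemma strict_opt_perm p z (r s : 'S_n) :
  strict_opt p (fun i => z (r i)) s = strict_opt p z (r^-1 * s)%g.
Proof.
apply/strict_optP/strict_optP => H t ts.
  have := H (r * t)%g; rewrite !gain_perm mulgA mulVg mul1g; apply.
  by apply: contra ts => /eqP <-; rewrite mulgA mulVg mul1g.
by rewrite !gain_perm; apply: H; apply: contra ts => /eqP /mulgI ->.
Qed.

Variable m : nat.
Implicit Types (f : 'M[R]_(m, d) -> R) (g : {ffun 'I_m -> 'I_n}).

(* Without a strict optimum, an event of probability zero, the junk value is [0]: it keeps
   the rank map equivariant under relabelling of the sample. *)
Definition rank_val f p z g : R :=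
  if rank_perm p z is Some s then f (\matrix_(a < m) p (s (g a))) else 0.

(** Relabelling the observations by [r] turns an optimal [s] into [r * s], so ranks follow their
    observations. Through this equivariance a relabelling acts on the injections. *)
Lemma rank_val_perm f p z (r : 'S_n) g :
  rank_val f p (fun i => z (r i)) g = rank_val f p z (postcomp r g).
Proof.
rewrite /rank_val.
have [/existsP[s hs]|/existsPn no] := boolP [exists s, strict_opt p z s].
  have hs' : strict_opt p (fun i => z (r i)) (r * s)%g.
    by rewrite strict_opt_perm mulgA mulVg mul1g.
  rewrite (rank_perm_some hs) (rank_perm_some hs'); congr (f _).
  by apply/matrixP => a b; rewrite !mxE ffunE permM.
rewrite (rank_perm_none no) rank_perm_none// => s.
by rewrite strict_opt_perm no.
Qed.

Lemma rank_val_sum f p z g :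
  rank_val f p z g = \sum_(s : 'S_n) (strict_opt p z s)%:R * f (\matrix_(a < m) p (s (g a))).
Proof.
rewrite /rank_val; have [/existsP[s hs]|/existsPn no] := boolP [exists s, strict_opt p z s].
  rewrite (rank_perm_some hs) (bigD1 s)//= hs mul1r big1 ?addr0// => t ts.
  have -> : strict_opt p z t = false; last by rewrite mul0r.
  by apply/negbTE/negP => ht; move/eqP: ts; apply; exact: strict_opt_unique ht hs.
by rewrite (rank_perm_none no) big1// => s _; rewrite (negbTE (no s)) mul0r.
Qed.

Lemma rank_val_bounded f p z g M : (forall x, `|f x| <= M) -> `|rank_val f p z g| <= M.
Proof.
move=> fM; rewrite /rank_val; case: rank_perm => // .
by rewrite normr0; apply: le_trans (fM 0).
Qed.

Lemma rank_val_antisymmetrized (H : {set 'S_m}) f p z g :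
  rank_val (antisymmetrized H f) p z g =
  \sum_(t in H) (-1) ^+ (odd_perm t) * rank_val f p z (precomp g t).
Proof.
rewrite /rank_val; case: rank_perm => [s|]; last by rewrite big1// => t _; rewrite mulr0.
apply: eq_bigr => t _; congr (_ * f _).
by apply/matrixP => a b; rewrite !mxE ffunE.
Qed.

(** For a fixed grid the kernel is evaluated at finitely many points and enters as constants;
    measurability comes from the indicators of the optimal assignments. *)
Lemma measurable_rank_val {dS} {S : measurableType dS} (Z : 'I_n -> S -> 'rV[R]_d) f p g :
  (forall i, measurable_fun setT (Z i)) ->
  measurable_fun setT (fun w => rank_val f p (fun i => Z i w) g).
Proof.
move=> mZ; have -> : (fun w => rank_val f p (fun i => Z i w) g) =
   (fun w => \sum_(s : 'S_n) \1_[set w | strict_opt p (fun i => Z i w) s] w *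
     f (\matrix_(a < m) p (s (g a)))).
  apply/funext => w; rewrite rank_val_sum; apply: eq_bigr => s _; rewrite indicE.
  by have -> : (w \in [set w | strict_opt p (fun i => Z i w) s]) =
    strict_opt p (fun i => Z i w) s by apply/idP/idP; rewrite inE.
apply: measurable_sum => s; apply: measurable_funM => //; apply: measurable_indic.
have mg t : measurable_fun setT (fun w => gain p (fun i => Z i w) t).
  by apply: measurable_sum => i; exact: measurable_dotp.
have -> : [set w | strict_opt p (fun i => Z i w) s] =
    \bigcap_(t in [set t | t != s]) [set w | gain p (fun i => Z i w) t < gain p (fun i => Z i w) s].
  by apply/seteqP; split => w /= => [/strict_optP H t|H]; [exact: H|apply/strict_optP].
apply: fin_bigcap_measurable => [|t _]; first exact: finite_finset.
have -> : [set w | gain p (fun i => Z i w) t < gain p (fun i => Z i w) s] =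
    (fun w => gain p (fun i => Z i w) s - gain p (fun i => Z i w) t) @^-1` `]0, +oo[.
  by apply/seteqP; split => w /=; rewrite in_itv/= andbT subr_gt0.
by rewrite -[X in measurable X]setTI; apply: (measurable_funB (mg s) (mg t)).
Qed.

End strict_optimum.

Lemma measurable_by_code (R : realType) {dS} {S : measurableType dS} (code : S -> nat)
    (h : nat -> S -> R) : (forall c, measurable [set w | code w = c]) ->
  (forall c, measurable_fun setT (h c)) -> measurable_fun setT (fun w => h (code w) w).
Proof.
move=> mcode mh _ B mB; rewrite setTI.
have -> : (fun w => h (code w) w) @^-1` B = \bigcup_c ([set w | code w = c] `&` (h c @^-1` B)).
  by apply/seteqP; split => [w Bw|w [c _ [/= <-]]//]; exists (code w).
apply: bigcupT_measurable => c; apply: measurableI => //.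
by rewrite -[X in measurable X]setTI; exact: mh.
Qed.

(** * Mean-square closeness of ranks and oracles *)

Section continuity_set.
Context {R : realType} {m d : nat} (f : 'M[R]_(m, d) -> R).

(** [f] is arbitrary. Letting both [y] and [y'] range over an open ball around [x] makes the set
    closed, hence Borel. *)
Definition osc_set (e : R) (k : nat) : set 'M[R]_(m, d) :=
  [set x | forall y y', `|x - y| < k.+1%:R^-1 -> `|x - y'| < k.+1%:R^-1 -> `|f y - f y'| <= e].

Lemma measurable_osc_set e k : measurable (osc_set e k).
Proof.
apply: closed_measurable_mx.
have -> : osc_set e k = \bigcap_(yy in [set yy : 'M[R]_(m, d) * 'M[R]_(m, d) | e < `|f yy.1 - f yy.2|])
    ~` (ball yy.1 k.+1%:R^-1 `&` ball yy.2 k.+1%:R^-1).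
  apply/seteqP; split => [x xU [y y'] /= lt []|x xU y y' xy xy'].
    rewrite -!ball_normE /= => h1 h2; have := xU y y'; rewrite distrC => /(_ h1).
    by rewrite distrC => /(_ h2); rewrite leNgt lt.
  rewrite leNgt; apply/negP => lt; apply: (xU (y, y') lt).
  by rewrite -!ball_normE /=; split; rewrite distrC.
apply: closed_bigI => -[y y'] _; apply: open_closedC; apply: openI; exact: ball_open.
Qed.

Definition continuity_set : set 'M[R]_(m, d) :=
  \bigcap_j \bigcup_k osc_set j.+1%:R^-1 k.

Lemma measurable_continuity_set : measurable continuity_set.
Proof.
apply: bigcapT_measurable => j; apply: bigcupT_measurable => k; exact: measurable_osc_set.
Qed.

Lemma continuous_continuity_set x : {for x, continuous f} -> continuity_set x.
Proof.
move=> cf j _; have j0 : 0 < (j.+1%:R)^-1 / 2 :> R by rewrite divr_gt0 ?invr_gt0.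
have /nbhs_ballP[e /= e0 eP] : nbhs x (f @^-1` ball (f x) (j.+1%:R^-1 / 2)).
  by apply: cf; exact: nbhsx_ballx.
have [k [_ ke]] : exists k : nat, True /\ k.+1%:R^-1 < e.
  by have [k _ /(_ k (leqnn k))] := near_infty_natSinv_lt (PosNum e0); exists k.
exists k => // y y' xy xy'.
have H z : `|x - z| < k.+1%:R^-1 -> `|f x - f z| < j.+1%:R^-1 / 2.
  move=> xz; have : ball x e z by rewrite -ball_normE /=; exact: lt_trans ke.
  by move=> /eP; rewrite /= /ball/=.
have := ler_distD (f x) (f y) (f y'); have := H y xy; have := H y' xy'.
rewrite (distrC (f x) (f y)) => h1 h2 h3; apply: le_trans h3 _.
by rewrite [leRHS]splitr; apply: ltW; apply: ltrD.
Qed.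

Lemma continuity_set_osc x e : continuity_set x -> 0 < e ->
  exists k0, forall k, (k0 <= k)%N -> osc_set e k x.
Proof.
move=> Cx e0; have [j _ /(_ j (leqnn j)) je] := near_infty_natSinv_lt (PosNum e0).
have [k0 _ H] := Cx j Logic.I; exists k0 => k kk y y' xy xy'.
have kk' : k.+1%:R^-1 <= k0.+1%:R^-1 :> R by rewrite lef_pV2 ?posrE// ler_nat ltnS.
apply: le_trans (ltW je); apply: H; exact: lt_le_trans kk'.
Qed.

(** The kernel need not be Borel; set to 0 off its continuity points it becomes so, keeps its bound
    and can be integrated. *)
Definition borel_version (x : 'M[R]_(m, d)) : R := if `[< continuity_set x >] then f x else 0.

Lemma borel_versionE x : continuity_set x -> borel_version x = f x.
Proof. by move=> Cx; rewrite /borel_version asboolT. Qed.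

Lemma borel_version_bounded M : (forall x, `|f x| <= M) -> forall x, `|borel_version x| <= M.
Proof.
move=> fM x; rewrite /borel_version; case: asboolP => // _.
by rewrite normr0; apply: le_trans (fM x).
Qed.

(** Within the continuity set [t < f] is relatively open: the inequality persists at the continuity
    points nearby, and [O] is the union of the balls where it does. *)
Lemma measurable_borel_version : measurable_fun setT borel_version.
Proof.
apply: (measurability _ (RGenOInfty.measurableE R)).
move=> _ [_ [t ->] <-]; rewrite setTI.
pose O := \bigcup_(yk in [set yk : 'M[R]_(m, d) * nat |
   forall y, `|yk.1 - y| < yk.2.+1%:R^-1 -> continuity_set y -> t < f y]) ball yk.1 yk.2.+1%:R^-1.
have mO : measurable O by apply: open_measurable_mx; apply: bigcup_open => -[y k] _; exact: ball_open.
have key : continuity_set `&` [set x | t < f x] = continuity_set `&` O.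
  apply/seteqP; split => [x [Cx tx]|x [Cx [[y k] /= yP xy]]]; split => //.
    have e0 : 0 < (f x - t) / 2 by rewrite divr_gt0// subr_gt0.
    have [k /(_ k (leqnn k)) H] := continuity_set_osc Cx e0.
    exists (x, k) => /=; last exact: ballxx.
    move=> y xy _; have := H x y; rewrite subrr normr0 invr_gt0 ltr0n => /(_ isT xy).
    by rewrite ler_norml /=; move: tx => /=; lra.
  by apply: yP => //; move: xy; rewrite -ball_normE.
have -> : borel_version @^-1` `]t, +oo[ = (continuity_set `&` O) `|` (if t < 0 then ~` continuity_set else set0).
  rewrite -key; apply/seteqP; split => x /=; rewrite in_itv/= andbT /borel_version.
    case: asboolP => [Cx tx|Cx ->]; [by left|by right].
  move=> [[Cx tx]|]; first by rewrite asboolT.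
  by case: ifP => // t0 Cx; rewrite asboolF.
apply: measurableU; first by apply: measurableI => //; exact: measurable_continuity_set.
by case: ifP => // _; apply: measurableC; exact: measurable_continuity_set.
Qed.

End continuity_set.

Section enumeration.
Context {R : realType} {d : nat}.

(** The listing depends on the grid only as a set, hence on its code; 0 is the default for a set
    that cannot be listed by [n] distinct points. *)
Definition enumeration n (A : set 'rV[R]_d) : 'I_n -> 'rV[R]_d :=
  if pselect (exists p : 'I_n -> 'rV[R]_d, injective p /\ range p = A) is left H
  then sval (cid H) else fun=> 0.

Lemma enumerationP n (A : set 'rV[R]_d) :
  (exists p : 'I_n -> 'rV[R]_d, injective p /\ range p = A) ->
  injective (@enumeration n A) /\ range (@enumeration n A) = A.
Proof. by move=> H; rewrite /enumeration; case: pselect => // H'; case: cid. Qed.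

Lemma enorm_sqrB (x y : 'rV[R]_d) :
  enorm (x - y) ^+ 2 = dotp x x - 2 * dotp x y + dotp y y.
Proof.
rewrite /enorm sqr_sqrtr ?dotpp_ge0// dotpBr !dotpBl (dotpC y x); ring.
Qed.

Lemma strict_opt_exists n (p z : 'I_n -> 'rV[R]_d) :
  (forall s t : 'S_n, s != t -> gain p z s != gain p z t) -> exists s, strict_opt p z s.
Proof.
move=> noties.
have [s _ smax] := @Order.TotalTheory.arg_maxP _ _ 'S_n 1%g xpredT (gain p z) isT.
exists s; apply/strict_optP => t ts; rewrite lt_neqAle noties//.
exact: smax.
Qed.

(** On the sample [T] is a permutation of the grid points. Were it not the strict optimum, the
    optimal permutation would define a bijection [T'] of smaller cost. *)
Lemma empirical_strict_opt n (p z : 'I_n -> 'rV[R]_d) (T : 'rV[R]_d -> 'rV[R]_d) A :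
  injective z -> injective p -> range p = A -> empirical_center_outward z A T ->
  (forall s t : 'S_n, s != t -> gain p z s != gain p z t) ->
  exists2 s, strict_opt p z s & forall i, T (z i) = p (s i).
Proof.
move=> zinj pinj pA [[Tsub Tinj Tsurj] Tmin] noties.
have [s hs] := strict_opt_exists noties.
have Tp i : exists j, p j = T (z i).
  have : A (T (z i)) by apply: Tsub; exists i.
  by rewrite -pA => -[j _ <-]; exists j.
pose r0 i := sval (cid (Tp i)).
have r0E i : p (r0 i) = T (z i) by rewrite /r0; case: cid.
have r0inj : injective r0.
  move=> i j E; apply: zinj; apply: Tinj; rewrite ?inE; [by exists i|by exists j|].
  by rewrite -!r0E E.
pose r := perm r0inj.
have rE i : p (r i) = T (z i) by rewrite permE r0E.
suff rs : r = s by exists s => // i; rewrite -rs rE.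
apply/eqP/contraT => nrs.
have lt : gain p z r < gain p z s by move/strict_optP: hs; apply.
pose T' x := if pselect (exists i, z i = x) is left H then p (s (sval (cid H))) else 0.
have T'E i : T' (z i) = p (s i).
  rewrite /T'; case: pselect => [H|[]]; last by exists i.
  by congr (p (s _)); apply: zinj; case: cid.
have T'bij : set_bij (range z) A T'.
  split.
  - by move=> _ [i _ <-]; rewrite T'E -pA; exists (s i).
  - move=> _ _ /set_mem[i _ <-] /set_mem[j _ <-]; rewrite !T'E => /pinj /perm_inj ->//.
  - rewrite -pA => _ [j _ <-]; exists (z (s^-1%g j)); first by exists (s^-1%g j).
    by rewrite T'E permKV.
have := Tmin _ T'bij.
have cost (q : 'S_n) (S : 'rV[R]_d -> 'rV[R]_d) : (forall i, S (z i) = p (q i)) ->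
    \sum_(i < n) enorm (z i - S (z i)) ^+ 2 =
    \sum_i dotp (z i) (z i) - 2 * gain p z q + \sum_i dotp (p i) (p i).
  move=> SE; rewrite [X in _ + X](reindex_inj (@perm_inj _ q))/= /gain mulr_sumr -sumrB -big_split/=.
  by apply: eq_bigr => i _; rewrite SE enorm_sqrB.
rewrite (cost r T (fun i => esym (rE i))) (cost s T' T'E); lra.
Qed.

End enumeration.

Lemma null_bigcup (R : realType) {dO} {Omega : measurableType dO} (P : probability Omega R)
    (I : countType) (E : I -> set Omega) :
  (forall i, measurable (E i)) -> (forall i, P (E i) = 0%E) ->
  measurable (\bigcup_i E i) /\ P (\bigcup_i E i) = 0%E.
Proof.
move=> mE PE; pose E' k := if choice.unpickle k is Some i then E i else set0.
have -> : \bigcup_i E i = \bigcup_k E' k.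
  apply/seteqP; split => [w [i _ Ew]|w [k _]]; last by rewrite /E'; case: choice.unpickle => // i; exists i.
  by exists (choice.pickle i) => //; rewrite /E' choice.pickleK.
have mE' k : measurable (E' k) by rewrite /E'; case: choice.unpickle.
have mU := bigcupT_measurable _ mE'; split => //.
apply/eqP; rewrite eq_le measure_ge0 andbT.
apply: le_trans (generalized_Boole_inequality P mE' mU) _.
rewrite eseries0// => k _ _; rewrite /E'; case: choice.unpickle => [i|]; first exact: PE.
exact: measure0.
Qed.

(** * Almost sure uniqueness of the optimal assignment *)

Section no_ties.
Context {R : realType} {d : nat} {dO} {Omega : measurableType dO} (P : probability Omega R).
Context (mu : probability 'rV[R]_d R) (Z : nat -> Omega -> 'rV[R]_d).
Hypothesis d_gt0 : (0 < d)%N.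
Hypothesis mZ : forall i, measurable_fun setT (Z i).
Hypothesis lawZ : product_law P Z mu.
Hypothesis acmu : abs_continuous mu.

Lemma measurable_linear n (c : 'I_n -> 'rV[R]_d) t :
  measurable [set w | \sum_(i < n) dotp (Z i w) (c i) = t].
Proof.
rewrite -[X in measurable X]setTI.
have mf : measurable_fun setT (fun w => \sum_(i < n) dotp (Z i w) (c i)).
  by apply: measurable_sum => i; exact: measurable_dotp.
by apply: (mf measurableT [set t]); exact: measurable_set1.
Qed.

(** A tie [Z i = Z j] entails equality of the sums of the coordinates, a linear relation whose
    coefficients are the vectors of ones and of minus ones. *)
Lemma sample_injective n : exists N : set Omega, [/\ measurable N, P N = 0%E &
  forall w, ~ N w -> injective (fun i : 'I_n => Z i w)].
Proof.
pose c (i j k : 'I_n) : 'rV[R]_d := if k == i then const_mx 1 else if k == j then const_mx (-1) else 0.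
pose E (ij : 'I_n * 'I_n) := if ij.1 == ij.2 then set0 else
  [set w | \sum_(k < n) dotp (Z k w) (c ij.1 ij.2 k) = 0].
have mE ij : measurable (E ij) by rewrite /E; case: ifP => // _; exact: measurable_linear.
have c1 : const_mx 1 != 0 :> 'rV[R]_d.
  apply/eqP => /matrixP /(_ 0 (Ordinal d_gt0)); rewrite !mxE => /eqP.
  by rewrite oner_eq0.
have PE ij : P (E ij) = 0%E.
  rewrite /E; case: ifP => [_|ij0]; first exact: measure0.
  have c0 : c ij.1 ij.2 ij.1 != 0 by rewrite /c eqxx.
  exact: (linear_tie_negligible mZ lawZ (fun c t => @abs_continuous_hyperplane R d mu c t acmu) 0 c0).
have [mU PU] := null_bigcup mE PE.
exists (\bigcup_ij E ij); split => // w Nw i j Zij; apply: contrapT => /eqP ij.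
apply: Nw; exists (i, j) => //; rewrite /E /= (negbTE ij) /=.
rewrite (bigD1 i)//= (bigD1 j)//=; last by rewrite eq_sym.
rewrite big1 ?addr0 => [|k /andP[ki kj]]; last first.
  by rewrite /c (negbTE ki) (negbTE kj) /dotp big1// => l _; rewrite mxE mulr0.
rewrite /c !eqxx (eq_sym j) (negbTE ij) Zij -dotpDr.
by rewrite /dotp big1// => l _; rewrite !mxE subrr mulr0.
Qed.

(** Equal gains of [s] and [t] are a linear relation with coefficients [p c (s i) - p c (t i)], not
    all 0 when the grid points are distinct. Codes being countable, one null set serves the random
    grid. *)
Lemma sample_no_ties n (p : nat -> 'I_n -> 'rV[R]_d) : exists N : set Omega, [/\ measurable N, P N = 0%E &
  forall w, ~ N w -> forall c, injective (p c) -> forall s t : 'S_n, s != t ->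
    gain (p c) (fun i : 'I_n => Z i w) s != gain (p c) (fun i : 'I_n => Z i w) t].
Proof.
pose E (cst : nat * ('S_n * 'S_n)) :=
  if `[< injective (p cst.1) >] && (cst.2.1 != cst.2.2) then
  [set w | \sum_(i < n) dotp (Z i w) (p cst.1 (cst.2.1 i) - p cst.1 (cst.2.2 i)) = 0] else set0.
have mE cst : measurable (E cst) by rewrite /E; case: ifP => // _; exact: measurable_linear.
have PE cst : P (E cst) = 0%E.
  rewrite /E; case: ifP => [/andP[/asboolP pinj st]|_]; last exact: measure0.
  have [i si] : exists i, cst.2.1 i != cst.2.2 i.
    apply: contrapT => /forallNP H; move/eqP: st; apply; apply/permP => i.
    by have /negP := H i; rewrite negbK => /eqP.
  have c0 : p cst.1 (cst.2.1 i) - p cst.1 (cst.2.2 i) != 0.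
    by rewrite subr_eq0; apply: contra si => /eqP /pinj ->.
  exact: (linear_tie_negligible (c := fun i => p cst.1 (cst.2.1 i) - p cst.1 (cst.2.2 i)) mZ lawZ
    (fun c t => @abs_continuous_hyperplane R d mu c t acmu) 0 c0).
have [mU PU] := null_bigcup mE PE.
exists (\bigcup_cst E cst); split => // w Nw c pinj s t st; apply/negP => /eqP H.
apply: Nw; exists (c, (s, t)) => //; rewrite /E /= asboolT//= st /=.
under eq_bigr do rewrite dotpBr.
by rewrite sumrB -/(gain (p c) (fun i : 'I_n => Z i w) s) -/(gain (p c) (fun i : 'I_n => Z i w) t) H subrr.
Qed.

End no_ties.

Lemma null_union (R : realType) {dO} {Omega : measurableType dO} (P : probability Omega R)
    (A B : set Omega) : measurable A -> measurable B -> P A = 0%E -> P B = 0%E ->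
  measurable (A `|` B) /\ P (A `|` B) = 0%E.
Proof.
move=> mA mB PA PB; have mU := measurableU _ _ mA mB; split => //.
by apply/(negligibleP P mU)/negligibleU; apply/negligibleP.
Qed.

Section rank_oracle.
Context {R : realType} {d m : nat} {dO} {Omega : measurableType dO} (P : probability Omega R).
Context (mu sigma : probability 'rV[R]_d R) (F : 'rV[R]_d -> 'rV[R]_d).
Context (Z : nat -> Omega -> 'rV[R]_d) (G : nat -> Omega -> set 'rV[R]_d).
Context (f : 'M[R]_(m, d) -> R) (M : R).
Hypothesis d_gt0 : (0 < d)%N.
Hypothesis mZ : forall i, measurable_fun setT (Z i).
Hypothesis lawZ : product_law P Z mu.
Hypothesis acmu : abs_continuous mu.
Hypothesis hsigma : sphere_uniform sigma.
Hypothesis hF : center_outward mu sigma F.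
Hypothesis hG : grid_sequence P sigma G.
Hypothesis gridE : forall n w, (0 < n)%N -> injective (fun i : 'I_n => Z i w) ->
  exists p : 'I_n -> 'rV[R]_d, injective p /\ range p = G n w.
Hypothesis fM : forall x, `|f x| <= M.
Hypothesis f_cont : P [set w | ~ continuity_set f (\matrix_(a < m) F (Z a w))] = 0%E.

Definition oracle_val n (h : 'M[R]_(m, d) -> R) (z : 'I_n -> 'rV[R]_d) (g : {ffun 'I_m -> 'I_n}) : R :=
  h (\matrix_(a < m) F (z (g a))).

Let mF : measurable_fun setT F. Proof. by have [] := hF. Qed.

Lemma measurable_oracle_matrix {dS} {S : measurableType dS} k (Y : 'I_k -> S -> 'rV[R]_d) :
  (forall a, measurable_fun setT (Y a)) ->
  measurable_fun setT (fun w => \matrix_(a < k) F (Y a w) : 'M[R]_(k, d)).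
Proof.
move=> mY; apply: measurable_fun_mx => a j.
rewrite (_ : (fun _ => _) = (fun w => F (Y a w) 0 j)); last by apply/funext => w; rewrite mxE.
have mc := measurableT_comp (measurable_coord 0 j) mF.
exact: (measurableT_comp mc (mY a)).
Qed.

(** Both tuples consist of distinct observations, so their laws agree on rectangles. What is known
    of the first [m] observations thereby holds along every injection. *)
Lemma oracle_matrix_law (e1 e2 : 'I_m -> nat) (A : set 'M[R]_(m, d)) :
  injective e1 -> injective e2 -> measurable A ->
  \int[P]_w \1_A (\matrix_(a < m) F (Z (e1 a) w)) =
  \int[P]_w \1_A (\matrix_(a < m) F (Z (e2 a) w)) :> R.
Proof.
move=> i1 i2 mA.
pose X (e : 'I_m -> nat) w : sequence_space (T := 'rV[R]_d) m := fun a => Z (e a) w.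
rewrite /Rintegral; congr fine.
have pre (e : 'I_m -> nat) (B : 'I_m -> set 'rV[R]_d) :
  X e @^-1` [set z | forall i, B i (z i)] = [set w | forall a, B a (Z (e a) w)] by [].
have mX (e : 'I_m -> nat) E : rectangles m E -> measurable (X e @^-1` E).
  move=> [B mB ->]; rewrite pre.
  have -> : [set w | forall a, B a (Z (e a) w)] = \bigcap_(a in [set: 'I_m]) Z (e a) @^-1` B a.
    by apply/seteqP; split => [w H a _|w H a]; [exact: H|exact: (H a Logic.I)].
  apply: fin_bigcap_measurable => // a _.
  by rewrite -[X in measurable X]setTI; exact: mZ.
apply: (@eq_law_integral _ _ _ P _ (rectangles m) (@rectangles_setI _ _ m) (@rectangles_setT _ _ m)
   (X e1) (X e2) (fun z => \1_A (\matrix_(a < m) F (z a)))).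
- exact: mX.
- exact: mX.
- by move=> _ [B mB ->]; rewrite !pre !(lawZ _ mB).
- apply: (measurableT_comp (proj1 (bounded_measurable_indic (R := R) mA))).
  apply: measurable_oracle_matrix => a; exact: measurable_sequence_coord.
- by move=> z; rewrite indicE.
Qed.

Definition rank_oracle_gap n (g : {ffun 'I_m -> 'I_n}) (w : Omega) : R :=
  rank_val f (enumeration (G n w)) (fun i : 'I_n => Z i w) g -
  oracle_val (borel_version f) (fun i : 'I_n => Z i w) g.

Lemma bounded_measurable_rank n (h : 'M[R]_(m, d) -> R) (N : R) (g : {ffun 'I_m -> 'I_n}) :
  (forall x, `|h x| <= N) ->
  bounded_measurable (fun w => rank_val h (enumeration (G n w)) (fun i : 'I_n => Z i w) g).
Proof.
move=> hN; have [code [gr [mcode GE _]]] := grid_code n hG.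
split; last by exists N => w; exact: rank_val_bounded.
rewrite (_ : (fun _ => _) = (fun w =>
  (fun c w => rank_val h (enumeration (gr c)) (fun i : 'I_n => Z i w) g) (code w) w)); last first.
  by apply/funext => w; rewrite GE.
apply: (@measurable_by_code R _ _ code
  (fun c w => rank_val h (enumeration (gr c)) (fun i : 'I_n => Z i w) g)) => // c.
exact: measurable_rank_val.
Qed.

Lemma bounded_measurable_oracle n (h : 'M[R]_(m, d) -> R) (N : R) (g : {ffun 'I_m -> 'I_n}) :
  measurable_fun setT h -> (forall x, `|h x| <= N) ->
  bounded_measurable (fun w => oracle_val h (fun i : 'I_n => Z i w) g).
Proof.
move=> mh hN; split; last by exists N => w; exact: hN.
by apply: (measurableT_comp mh); apply: measurable_oracle_matrix.
Qed.

(** A squared gap exceeds [e ^ 2] only if one of the [m] arguments is badly transported or the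
    oracle point is outside [osc_set] or the continuity set, and then it is at most [D]. The first
    case is rare on average over the injections by [transport_consistency]; the second has the same
    small probability for all of them. *)
Lemma rank_oracle_L2 (e0 : R) : 0 < e0 -> exists n0 : nat, forall n, (n0 <= n)%N ->
  \int[P]_w ((@ninj m n)%:R^-1 *
    \sum_(g : {ffun 'I_m -> 'I_n} | injectiveb g) rank_oracle_gap g w ^+ 2) <= e0.
Proof.
move=> e00.
have M0 : 0 <= M by apply: le_trans (fM 0).
(* One third for the continuity error, one for the badly transported arguments, one for the
   exceptional oracle points. *)
pose a := e0 / 3; have a0 : 0 < a by rewrite divr_gt0.
pose D := 4 * M ^+ 2; have D0 : 0 <= D by rewrite mulr_ge0 ?sqr_ge0.
have D1 : 0 < D + 1 by lra.
pose e := Num.min 1 a; have ep : 0 < e by rewrite lt_min ltr01.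
have ee : e ^+ 2 <= a.
  have e1 : e <= 1 by rewrite ge_min lexx.
  have ea : e <= a by rewrite ge_min lexx orbT.
  by rewrite expr2; apply: le_trans ea; rewrite ler_piMl// ltW.
have mV : measurable_fun setT (fun w => \matrix_(a < m) F (Z a w) : 'M[R]_(m, d)).
  exact: (@measurable_oracle_matrix _ _ m (fun a w => Z a w)).
have mVi (A : set 'M[R]_(m, d)) : measurable A -> measurable [set w | A (\matrix_(a < m) F (Z a w))].
  by move=> mA; rewrite -[X in measurable X]setTI; exact: mV.
have [k Pk] := @exhausting_probability _ _ _ P
  (fun k => [set w | osc_set f e k (\matrix_(a < m) F (Z a w))])
  [set w | continuity_set f (\matrix_(a < m) F (Z a w))] (a / (D + 1))
  (fun k => mVi _ (measurable_osc_set f e k)) (mVi _ (measurable_continuity_set f)) f_cont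
  (fun w Cw => continuity_set_osc Cw ep) (divr_gt0 a0 D1).
(* Good arguments are within [e'] in the wide sense; [k.+2] puts them strictly inside the radius
   [k.+1%:R^-1] of [osc_set]. *)
pose e' : R := k.+2%:R^-1; have e'0 : 0 < e' by rewrite invr_gt0.
have e'k : e' < k.+1%:R^-1 by rewrite ltf_pV2 ?posrE// ltr_nat.
pose D2 := D * m%:R + 1; have D20 : 0 < D2 by rewrite ltr_wpDl// mulr_ge0.
have [n1 Hn1] := transport_consistency mZ lawZ hsigma hF hG e'0 (divr_gt0 a0 D20).
exists (maxn 1 n1) => n; rewrite geq_max => /andP[n0 nn1].
have [B [bB EB] [N1 [mN1 PN1 HB]]] := Hn1 n nn1.
have [code [gr [mcode GE _]]] := grid_code n hG.
have [N2 [mN2 PN2 Hinj]] := sample_injective d_gt0 mZ lawZ acmu n.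
have [N3 [mN3 PN3 Hties]] := sample_no_ties mZ lawZ acmu (fun c => @enumeration R d n (gr c)).
pose A := ~` (osc_set f e k `&` continuity_set f).
have mA : measurable A.
  apply: measurableC; apply: measurableI; first exact: measurable_osc_set.
  exact: measurable_continuity_set.
pose V (g : {ffun 'I_m -> 'I_n}) w : 'M[R]_(m, d) := \matrix_(a < m) F (Z (g a) w).
have bA g : bounded_measurable (fun w => \1_A (V g w) : R).
  apply: (bounded_measurable_comp _ (bounded_measurable_indic mA)).
  exact: (@measurable_oracle_matrix _ _ m (fun a w => Z (g a) w)).
pose iN : R := (@ninj m n)%:R^-1.
have iN0 : 0 <= iN by rewrite invr_ge0.
have iN1 : iN * (@ninj m n)%:R <= 1.
  rewrite /iN; have [->|Np] := posnP (@ninj m n); first by rewrite mulr0.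
  by rewrite mulVf// pnatr_eq0 -lt0n.
have bgap (g : {ffun 'I_m -> 'I_n}) : bounded_measurable (fun w => rank_oracle_gap g w ^+ 2).
  have bg : bounded_measurable (rank_oracle_gap g).
    apply: bounded_measurableB; first exact: bounded_measurable_rank fM.
    exact: bounded_measurable_oracle (measurable_borel_version f) (borel_version_bounded fM).
  exact: bounded_measurable_sqr.
pose bnd w := e ^+ 2 + (D * m%:R * B w + D * (iN * \sum_(g : {ffun 'I_m -> 'I_n} | injectiveb g) \1_A (V g w))).
have bS : bounded_measurable (fun w => iN * \sum_(g : {ffun 'I_m -> 'I_n} | injectiveb g) \1_A (V g w)).
  by apply: bounded_measurableZ; exact: bounded_measurable_sum.
have bDB : bounded_measurable (fun w => D * m%:R * B w) by exact: bounded_measurableZ.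
have bDS : bounded_measurable (fun w => D * (iN * \sum_(g : {ffun 'I_m -> 'I_n} | injectiveb g) \1_A (V g w))).
  exact: bounded_measurableZ.
have bsum : bounded_measurable (fun w => D * m%:R * B w +
    D * (iN * \sum_(g : {ffun 'I_m -> 'I_n} | injectiveb g) \1_A (V g w))) by exact: bounded_measurableD.
have bbnd : bounded_measurable bnd.
  by apply: bounded_measurableD => //; exact: bounded_measurable_cst.
apply: (@le_trans _ _ (\int[P]_w bnd w)).
  have [mN12 PN12] := null_union mN1 mN2 PN1 PN2.
  have [mN PN] := null_union mN12 mN3 PN12 PN3.
  apply: (expect_le_ae _ bbnd mN PN).
    by apply: bounded_measurableZ; exact: bounded_measurable_sum.
  move=> w /not_orP[/not_orP[w1 w2] w3].
  pose z (i : 'I_n) := Z i w.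
  have zinj : injective z := Hinj w w2.
  have [pinj pG] := enumerationP (gridE n0 zinj).
  set p := @enumeration R d n (G n w) in pinj pG.
  have [s hs] : exists s, strict_opt p z s.
    by apply: strict_opt_exists => s t st; have := Hties w w3 (code w); rewrite -GE => /(_ pinj s t st).
  have HBw := HB w w1 p s pinj pG.
  have {}HBw : freq (fun i : 'I_n => e' < `|p (s i) - F (Z i w)|) <= B w.
    apply: HBw => t; have [->//|ts] := eqVneq t s.
    by apply: ltW; move/strict_optP: hs; apply.
  pose bad i := e' < `|p (s i) - F (Z i w)|.
  have gap (g : {ffun 'I_m -> 'I_n}) : injectiveb g -> rank_oracle_gap g w ^+ 2 <=
      e ^+ 2 + (D * (\sum_(a < m) (bad (g a))%:R) + D * \1_A (V g w)).
    move=> _.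
    have rE : rank_oracle_gap g w = f (\matrix_(a < m) p (s (g a))) - borel_version f (V g w).
      by rewrite /rank_oracle_gap /rank_val (rank_perm_some hs).
    have gD : rank_oracle_gap g w ^+ 2 <= D.
      rewrite -(real_normK (num_real _)) rE.
      have : `|f (\matrix_(a < m) p (s (g a))) - borel_version f (V g w)| <= 2 * M.
        apply: le_trans (ler_normB _ _) _.
        by have := fM (\matrix_(a < m) p (s (g a))); have := borel_version_bounded fM (V g w); lra.
      by move=> H; rewrite /D (_ : 4 * M ^+ 2 = (2 * M) ^+ 2); [rewrite lerXn2r ?nnegrE ?mulr_ge0|ring].
    have sb0 : 0 <= \sum_(a < m) (bad (g a))%:R :> R by exact: sumr_ge0.
    have [Aw|nAw] := pselect (A (V g w)).
      rewrite indicE mem_set// mulr1; apply: le_trans gD _.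
      by rewrite addrA lerDr addr_ge0 ?sqr_ge0// mulr_ge0.
    rewrite indicE memNset// mulr0 addr0.
    have [[b bb]|nb] := pselect (exists b, bad (g b)).
      apply: le_trans gD _; apply: (@le_trans _ _ (D * \sum_(a < m) (bad (g a))%:R)); last by rewrite lerDr sqr_ge0.
      rewrite -[leLHS]mulr1 ler_wpM2l// (bigD1 b)//= bb lerDl; exact: sumr_ge0.
    move/contrapT: nAw => [Uw Cw].
    apply: (@le_trans _ _ (e ^+ 2)); last by rewrite lerDl mulr_ge0.
    rewrite -(real_normK (num_real _)) lerXn2r ?nnegrE// ?(ltW ep)//.
    rewrite rE (borel_versionE Cw); apply: Uw; last by rewrite subrr normr0 invr_gt0.
    apply: le_lt_trans e'k; apply: mx_norm_le (ltW e'0) _ => b j; rewrite !mxE.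
    move/forallNP: nb => /(_ b) /negP; rewrite /bad -leNgt => H.
    apply: le_trans H; rewrite distrC.
    by have := mx_norm_entry (p (s (g b)) - F (Z (g b) w)) 0 j; rewrite !mxE.
  apply: (@le_trans _ _ (iN * \sum_(g : {ffun 'I_m -> 'I_n} | injectiveb g)
     (e ^+ 2 + (D * (\sum_(a < m) (bad (g a))%:R) + D * \1_A (V g w))))).
    by apply: ler_wpM2l => //; apply: ler_sum => g; exact: gap.
  rewrite big_split/= mulrDr; apply: lerD.
    rewrite sumr_const -mulr_natr mulrCA -[leRHS]mulr1 ler_wpM2l ?sqr_ge0//.
  rewrite big_split/= mulrDr; apply: lerD; last first.
    by rewrite -mulr_sumr mulrCA.
  rewrite -mulr_sumr mulrCA -mulrA ler_wpM2l//.
  (* An index occupies a given position in at most a fraction [1 / n] of the injections, and there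
     are [m] positions. *)
  apply: (@le_trans _ _ (m%:R * freq bad)); last by rewrite ler_wpM2l.
  rewrite exchange_big/= mulr_sumr -[X in _ <= X%:R * _](card_ord m) mulr_natl -sumr_const.
  apply: ler_sum => a' _.
  have -> : \sum_(g : {ffun 'I_m -> 'I_n} | injectiveb g) (bad (g a'))%:R =
     \sum_(i < n) (bad i)%:R * (#|[pred g : {ffun 'I_m -> 'I_n} | injectiveb g & g a' == i]|)%:R :> R.
    rewrite (partition_big (fun g : {ffun 'I_m -> 'I_n} => g a') xpredT)//=.
    apply: eq_bigr => i _; rewrite (eq_bigr (fun=> (bad i)%:R)) => [|g /andP[_ /eqP ->]//].
    by rewrite sumr_const mulr_natr.
  rewrite /freq mulr_sumr mulr_sumr; apply: ler_sum => i _.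
  rewrite mulrCA [leRHS]mulrC ler_wpM2l//.
  have nR0 : 0 < n%:R :> R by rewrite ltr0n.
  rewrite -(ler_pM2r nR0) mulVf ?gt_eqF// -mulrA -natrM mulnC.
  by apply: le_trans iN1; rewrite ler_wpM2l// ler_nat count_fixed1.
rewrite expectD//; last exact: bounded_measurable_cst.
rewrite expect_cst expectD// (expectZ P _ bB) (expectZ P _ bS).
have ES : \int[P]_w (iN * \sum_(g : {ffun 'I_m -> 'I_n} | injectiveb g) \1_A (V g w)) <= a / (D + 1).
  rewrite expectZ; last exact: bounded_measurable_sum.
  rewrite expect_sum//.
  have Pg (g : {ffun 'I_m -> 'I_n}) : injectiveb g -> \int[P]_w \1_A (V g w) <= a / (D + 1).
    move=> /injectiveP ginj.
    rewrite (@oracle_matrix_law (fun a => g a) (fun a => a))//; last first.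
    - exact: val_inj.
    - by move=> x y /val_inj /ginj.
    have mVA : measurable [set w | A (\matrix_(a < m) F (Z a w))] by exact: mVi.
    rewrite (_ : (fun _ => _) = \1_[set w | A (\matrix_(a < m) F (Z a w))]); last first.
      by apply/funext => w; rewrite !indicE; congr (nat_of_bool _)%:R; apply/idP/idP; rewrite !inE.
    rewrite expect_indic//.
    have mO := mVi _ (measurable_osc_set f e k).
    have mC := mVi _ (measurable_continuity_set f).
    apply: le_trans Pk.
    rewrite fine_le ?fin_num_measure//; try exact: measurableC.
    apply: (@le_trans _ _ (P (~` [set w | osc_set f e k (\matrix_(a < m) F (Z a w))] `|`
        [set w | ~ continuity_set f (\matrix_(a < m) F (Z a w))]))).
      apply: le_measure; rewrite ?inE//.
        by apply: measurableU; exact: measurableC.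
      by move=> w /= /not_andP.
    have := measureU2 P (measurableC mO) (measurableC mC).
    move=> U; apply: (le_trans U); rewrite -[leRHS]adde0; apply: leeD => //.
    have Q (x y : \bar R) : x = y -> (x <= y)%E by move=> ->.
    exact: (Q _ _ f_cont).
  apply: (@le_trans _ _ (iN * \sum_(g : {ffun 'I_m -> 'I_n} | injectiveb g) (a / (D + 1)))).
    by rewrite ler_wpM2l//; apply: ler_sum.
  rewrite sumr_const -mulr_natr mulrCA -[leRHS]mulr1 ler_wpM2l// divr_ge0 ?ltW//.
have t1 : D * m%:R * \int[P]_w B w <= a.
  apply: (@le_trans _ _ (D2 * (a / D2))); last by rewrite mulrC divfK ?gt_eqF.
  apply: (@le_trans _ _ (D * m%:R * (a / D2))); first by rewrite ler_wpM2l// mulr_ge0.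
  by rewrite ler_wpM2r ?lerDl// divr_ge0 ?ltW.
have t2 : D * \int[P]_w (iN * \sum_(g : {ffun 'I_m -> 'I_n} | injectiveb g) \1_A (V g w)) <= a.
  apply: (@le_trans _ _ ((D + 1) * (a / (D + 1)))); last by rewrite mulrC divfK ?gt_eqF.
  apply: (@le_trans _ _ (D * (a / (D + 1)))); first by rewrite ler_wpM2l.
  by rewrite ler_wpM2r ?lerDl// divr_ge0 ?ltW.
by rewrite /a in ee t1 t2 *; lra.
Qed.

End rank_oracle.

(** * Scores absorbed into the kernel *)

Section score_kernel.
Context {R : realType} {d m : nat}.

Lemma continuous_enorm : continuous (@enorm R d).
Proof.
move=> x; apply: (@continuous_comp _ _ _ (fun x : 'rV[R]_d => dotp x x) Num.sqrt); last first.
  exact: sqrt_continuous.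
apply: (@continuous_big _ _ _ _ _ _ _ _ _); first exact: add_continuous.
by move=> i _ y; apply: continuousM; exact: coord_continuous.
Qed.

(** The direction is undefined at 0, and [J] is controlled below 1 only; both are avoided almost
    surely by the population transport. *)
Lemma continuous_score (J : R -> R) (v : 'rV[R]_d) : weakly_regular J ->
  v != 0 -> enorm v < 1 -> {for v, continuous (score J)}.
Proof.
move=> [_ cJ _] v0 v1.
have e0 : 0 < enorm v.
  rewrite lt_neqAle sqrtr_ge0 andbT eq_sym; apply: contra v0 => /eqP H.
  by apply/eqP; exact: enorm_eq0.
have cJv : {for enorm v, continuous J}.
  have : {within [set` `]0, 1[], continuous J}.
    apply: continuous_subspaceW cJ => t /=; rewrite !in_itv/= => /andP[t0 ->].
    by rewrite ltW.
  rewrite continuous_open_subspace; last exact: interval_open.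
  by apply; rewrite inE/= in_itv/= e0 v1.
have cg : {for v, continuous (fun x => (J (enorm x) / enorm x) *: x)}.
  have cEv : {for v, continuous (@enorm R d)} by exact: continuous_enorm.
  apply: continuousZ; last exact: cvg_id.
  apply: continuousM; first exact: (continuous_comp cEv cJv).
  by apply: continuousV => //; rewrite gt_eqF.
have E : \forall x \near v, (J (enorm x) / enorm x) *: x = score J x.
  have : \forall x \near v, 0 < enorm x.
    exact: (@cvgr_gt _ _ _ _ (@enorm R d) (enorm v) (@continuous_enorm v) 0 e0).
  apply: filterS => x x0; rewrite /score; case: eqVneq => // xE.
  by rewrite xE enorm0 ltxx in x0.
have Ev : (J (enorm v) / enorm v) *: v = score J v := nbhs_singleton E.
have cg' : (J (enorm x) / enorm x) *: x @[x --> v] --> (J (enorm v) / enorm v) *: v by exact: cg.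
rewrite Ev in cg'; apply: cvg_trans cg'.
exact: near_eq_cvg E.
Qed.

(** Ranks and oracles can now be compared as points of the unit ball, and the bound of [f] survives
    however large [J] becomes near 1. *)
Definition score_kernel (J : R -> R) (f : 'M[R]_(m, d) -> R) (x : 'M[R]_(m, d)) : R :=
  f (\matrix_(a < m) score J (row a x)).

Lemma continuous_row (a : 'I_m) : continuous (row a : 'M[R]_(m, d) -> 'rV[R]_d).
Proof.
move=> x B /nbhs_ballP[e /= e0 eB]; apply/nbhs_ballP; exists e => // y [_ xy]; apply: eB; split => // i j.
by rewrite !mxE; exact: xy.
Qed.

Lemma continuous_score_kernel (J : R -> R) (f : 'M[R]_(m, d) -> R) (V : 'I_m -> 'rV[R]_d) :
  weakly_regular J -> (forall a, V a != 0) -> (forall a, enorm (V a) < 1) ->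
  {for (\matrix_(a < m) score J (V a)), continuous f} ->
  {for (\matrix_(a < m) V a), continuous (score_kernel J f)}.
Proof.
move=> wJ V0 V1 cf.
have E : \matrix_(a < m) score J (row a (\matrix_(a < m) V a)) = \matrix_(a < m) score J (V a).
  by apply/matrixP => a j; rewrite !mxE rowK.
apply: (@continuous_comp _ _ _ (fun x : 'M[R]_(m, d) => \matrix_(a < m) score J (row a x)) f); last first.
  by rewrite /continuous_at E.
have crow a : {for (\matrix_(a < m) V a), continuous (fun x : 'M[R]_(m, d) => score J (row a x))}.
  apply: (@continuous_comp _ _ _ (row a) (score J)); last by rewrite rowK; exact: continuous_score.
  exact: continuous_row.
move=> B /nbhs_ballP[e /= e0 eB].
suff H : \forall x \near \matrix_(a < m) V a, forall a,
    ball (score J (row a (\matrix_(a < m) V a))) e (score J (row a x)).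
  apply: filterS H => x H; apply: eB; split => // a j; rewrite !mxE.
  by have [_ /(_ 0 j)] := H a.
have := @filter_forall _ 'I_m (fun a x => ball (score J (row a (\matrix_(a < m) V a))) e (score J (row a x)))
  (nbhs (\matrix_(a < m) V a)) _.
apply => a; apply: (crow a); exact: nbhsx_ballx.
Qed.

End score_kernel.

Section antisymmetrized_values.
Context {R : realType} {d m n : nat} (H : {set 'S_m}) (f : 'M[R]_(m, d) -> R).

Lemma antisymmetrized_bounded (M : R) x : (forall x, `|f x| <= M) ->
  `|antisymmetrized H f x| <= #|H|%:R * M.
Proof.
move=> fM; apply: le_trans (ler_norm_sum _ _ _) _.
rewrite mulr_natl -sumr_const; apply: ler_sum => s _.
by rewrite normrM normr_sign mul1r.
Qed.

Lemma oracle_val_antisymmetrized (F : 'rV[R]_d -> 'rV[R]_d) (z : 'I_n -> 'rV[R]_d)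
    (g : {ffun 'I_m -> 'I_n}) : oracle_val F (antisymmetrized H f) z g =
  \sum_(t in H) (-1) ^+ (odd_perm t) * oracle_val F f z (precomp g t).
Proof.
apply: eq_bigr => t _; congr (_ * f _).
by apply/matrixP => a b; rewrite !mxE ffunE.
Qed.

Lemma rank_val_flip (t : 'S_m) p (z : 'I_n -> 'rV[R]_d) (g : {ffun 'I_m -> 'I_n}) :
  odd_perm t -> (forall s, ((s * t)%g \in H) = (s \in H)) ->
  rank_val (antisymmetrized H f) p z (precomp g t) = - rank_val (antisymmetrized H f) p z g.
Proof.
move=> ot Ht; rewrite /rank_val; case: rank_perm => [s|]; last by rewrite oppr0.
rewrite -(antisymmetrized_flip f _ ot Ht); congr antisymmetrized.
by apply/matrixP => a b; rewrite !mxE ffunE.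
Qed.

Lemma oracle_val_flip (t : 'S_m) (F : 'rV[R]_d -> 'rV[R]_d) (z : 'I_n -> 'rV[R]_d)
    (g : {ffun 'I_m -> 'I_n}) :
  odd_perm t -> (forall s, ((s * t)%g \in H) = (s \in H)) ->
  oracle_val F (antisymmetrized H f) z (precomp g t) = - oracle_val F (antisymmetrized H f) z g.
Proof.
move=> ot Ht; rewrite /oracle_val -(antisymmetrized_flip f _ ot Ht); congr antisymmetrized.
by apply/matrixP => a b; rewrite !mxE ffunE.
Qed.

Lemma oracle_val_perm (F : 'rV[R]_d -> 'rV[R]_d) (z : 'I_n -> 'rV[R]_d) (r : 'S_n)
    (g : {ffun 'I_m -> 'I_n}) :
  oracle_val F f (fun i => z (r i)) g = oracle_val F f z (postcomp r g).
Proof. by congr f; apply/matrixP => a b; rewrite !mxE ffunE. Qed.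

End antisymmetrized_values.

Section antisymmetrized_gap.
Context {R : realType} {d m : nat} {dO} {Omega : measurableType dO} (P : probability Omega R).
Context (mu sigma : probability 'rV[R]_d R) (F : 'rV[R]_d -> 'rV[R]_d).
Context (Z : nat -> Omega -> 'rV[R]_d) (G : nat -> Omega -> set 'rV[R]_d).
Context (f : 'M[R]_(m, d) -> R) (J : R -> R) (M : R) (H : {set 'S_m}).
Hypothesis d_gt0 : (0 < d)%N.
Hypothesis mZ : forall i, measurable_fun setT (Z i).
Hypothesis lawZ : product_law P Z mu.
Hypothesis acmu : abs_continuous mu.
Hypothesis hsigma : sphere_uniform sigma.
Hypothesis hF : center_outward mu sigma F.
Hypothesis hG : grid_sequence P sigma G.
Hypothesis gridE : forall n w, (0 < n)%N -> injective (fun i : 'I_n => Z i w) ->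
  exists p : 'I_n -> 'rV[R]_d, injective p /\ range p = G n w.
Hypothesis wJ : weakly_regular J.
Hypothesis fM : forall x, `|f x| <= M.
Hypothesis cf : ae_continuous_along P f (fun i w => score J (F (Z i w))).

Let mF : measurable_fun setT F. Proof. by have [] := hF. Qed.
Let F1 x : enorm (F x) < 1. Proof. by have [_ F1 _ _] := hF. Qed.

Let fJ := score_kernel J f.

Let fJM x : `|fJ x| <= M. Proof. exact: fM. Qed.

(** Continuity of [f] at the scores passes to the composed kernel, off the null event that one of
    the first [m] observations is transported to 0. *)
Lemma oracle_continuity_set :
  P [set w | ~ continuity_set fJ (\matrix_(a < m) F (Z a w))] = 0%E.
Proof.
have mE : measurable [set w | ~ continuity_set fJ (\matrix_(a < m) F (Z a w))].
  apply: measurableC; rewrite -[X in measurable X]setTI.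
  have mV : measurable_fun setT (fun w => \matrix_(a < m) F (Z a w) : 'M[R]_(m, d)).
    exact: (measurable_oracle_matrix hF (Y := fun a : 'I_m => Z a)).
  by apply: mV => //; exact: measurable_continuity_set.
have [N [mN PN NE]] := cf.
have m0 : measurable (F @^-1` [set 0]).
  by rewrite -[X in measurable X]setTI; apply: mF => //; exact: measurable_set1_mx.
have [mB PB] := @null_bigcup R _ _ P 'I_m (fun a => Z a @^-1` (F @^-1` [set 0]))
  (fun a => ltac:(by rewrite -[X in measurable X]setTI; exact: mZ))
  (fun a => etrans (product_law1 lawZ a m0) (center_outward_neq0 hsigma (let: And4 _ _ _ l := hF in l))).
have [mU PU] := null_union mN mB PN PB.
apply/(negligibleP P mE); apply: (@negligibleS _ _ _ _ (N `|` \bigcup_(a : 'I_m) Z a @^-1` (F @^-1` [set 0]))); last first.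
  exact/negligibleP.
move=> w /= nC; apply: contrapT => /not_orP[nN nB]; apply: nC.
apply: continuous_continuity_set; apply: continuous_score_kernel => //.
  by move=> a; apply/eqP => F0; apply: nB; exists a.
by apply: contrapT => nc; apply: nN; exact: NE.
Qed.

Definition antisymmetrized_gap n (g : {ffun 'I_m -> 'I_n}) (w : Omega) : R :=
  rank_val (antisymmetrized H fJ) (enumeration (G n w)) (fun i : 'I_n => Z i w) g -
  oracle_val F (antisymmetrized H (borel_version fJ)) (fun i : 'I_n => Z i w) g.

Lemma antisymmetrized_gapE n (g : {ffun 'I_m -> 'I_n}) w : antisymmetrized_gap g w =
  \sum_(t in H) (-1) ^+ (odd_perm t) * rank_oracle_gap F Z G fJ (precomp g t) w.
Proof.
rewrite /antisymmetrized_gap rank_val_antisymmetrized -sumrB; apply: eq_bigr => t _.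
rewrite -mulrBr; congr (_ * (_ - borel_version fJ _)).
by apply/matrixP => a b; rewrite !mxE ffunE.
Qed.

Lemma sqr_sum_le (I : finType) (p : pred I) (x : I -> R) :
  (\sum_(i | p i) x i) ^+ 2 <= #|p|%:R * \sum_(i | p i) x i ^+ 2.
Proof.
have -> : #|p|%:R * \sum_(i | p i) x i ^+ 2 =
    \sum_(i | p i) \sum_(j | p j) (x i ^+ 2 + x j ^+ 2) / 2.
  under [RHS]eq_bigr => i pi.
    rewrite -mulr_suml big_split/= sumr_const.
    over.
  rewrite -mulr_suml big_split/= sumr_const sumrMnl -(mulr_natr (\sum_(i | p i) x i ^+ 2)).
  by move: (\sum_(i | p i) _) (#|p|%:R : R) => u v; lra.
rewrite expr2 mulr_suml; apply: ler_sum => i pi.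
rewrite mulr_sumr; apply: ler_sum => j pj.
by have := sqr_ge0 (x i - x j); rewrite sqrrB; lra.
Qed.

(** The Cauchy-Schwarz inequality over [H] costs one factor [#|H|]; the other counts the
    permutations, each of which permutes the injections. *)
Lemma sum_antisymmetrized_gap n w :
  \sum_(g : {ffun 'I_m -> 'I_n} | injectiveb g) antisymmetrized_gap g w ^+ 2 <=
  #|H|%:R ^+ 2 * \sum_(g : {ffun 'I_m -> 'I_n} | injectiveb g) rank_oracle_gap F Z G fJ g w ^+ 2.
Proof.
apply: (@le_trans _ _ (\sum_(g : {ffun 'I_m -> 'I_n} | injectiveb g)
   #|H|%:R * \sum_(t in H) rank_oracle_gap F Z G fJ (precomp g t) w ^+ 2)).
  apply: ler_sum => g _; rewrite antisymmetrized_gapE; apply: le_trans (sqr_sum_le _ _) _.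
  rewrite ler_wpM2l//; apply: ler_sum => t _.
  by rewrite exprMn sqrr_sign mul1r.
rewrite -mulr_sumr exchange_big/= expr2 -mulrA ler_wpM2l//.
rewrite mulr_natl -sumr_const; apply: ler_sum => t _.
have pinj : injective (fun g : {ffun 'I_m -> 'I_n} => precomp g t).
  move=> g g' /ffunP E; apply/ffunP => a; have := E ((t^-1)%g a).
  by rewrite !ffunE permKV.
rewrite [leRHS](reindex_inj pinj)/=.
by under [leRHS]eq_bigl do rewrite precomp_injectiveb.
Qed.

Lemma bounded_measurable_antisymmetrized_rank n (g : {ffun 'I_m -> 'I_n}) :
  bounded_measurable (fun w => rank_val (antisymmetrized H fJ) (enumeration (G n w))
    (fun i : 'I_n => Z i w) g).
Proof. by apply: (bounded_measurable_rank mZ hG) => x; exact: antisymmetrized_bounded fJM. Qed.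

Lemma bounded_measurable_antisymmetrized_oracle n (g : {ffun 'I_m -> 'I_n}) :
  bounded_measurable (fun w => oracle_val F (antisymmetrized H (borel_version fJ))
    (fun i : 'I_n => Z i w) g).
Proof.
rewrite (_ : (fun _ => _) = fun w => \sum_(t in H) (-1) ^+ (odd_perm t) *
    oracle_val F (borel_version fJ) (fun i : 'I_n => Z i w) (precomp g t)); last first.
  by apply/funext => w; exact: oracle_val_antisymmetrized.
apply: bounded_measurable_sum => t; apply: bounded_measurableZ.
exact: (bounded_measurable_oracle mZ hF _ (measurable_borel_version fJ) (borel_version_bounded fJM)).
Qed.

Lemma antisymmetrized_gap_L2 (e0 : R) : 0 < e0 -> exists n0 : nat, forall n, (n0 <= n)%N ->
  \int[P]_w ((@ninj m n)%:R^-1 *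
    \sum_(g : {ffun 'I_m -> 'I_n} | injectiveb g) antisymmetrized_gap g w ^+ 2) <= e0.
Proof.
move=> e00; pose c : R := #|H|%:R ^+ 2 + 1.
have c0 : 0 < c by rewrite ltr_wpDl// sqr_ge0.
have [n0 Hn] := rank_oracle_L2 d_gt0 mZ lawZ acmu hsigma hF hG gridE fJM oracle_continuity_set
  (divr_gt0 e00 c0).
exists n0 => n /Hn Hb.
have b1 : bounded_measurable (fun w => (@ninj m n)%:R^-1 *
    \sum_(g : {ffun 'I_m -> 'I_n} | injectiveb g) rank_oracle_gap F Z G fJ g w ^+ 2).
  apply: bounded_measurableZ; apply: bounded_measurable_sum => g; apply: bounded_measurable_sqr.
  apply: bounded_measurableB; first exact: (bounded_measurable_rank mZ hG _ fJM).
  exact: (bounded_measurable_oracle mZ hF _ (measurable_borel_version fJ) (borel_version_bounded fJM)).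
have b2 : bounded_measurable (fun w => (@ninj m n)%:R^-1 *
    \sum_(g : {ffun 'I_m -> 'I_n} | injectiveb g) antisymmetrized_gap g w ^+ 2).
  apply: bounded_measurableZ; apply: bounded_measurable_sum => g; apply: bounded_measurable_sqr.
  apply: bounded_measurableB; first exact: bounded_measurable_antisymmetrized_rank.
  exact: bounded_measurable_antisymmetrized_oracle.
apply: (@le_trans _ _ (\int[P]_w (c * ((@ninj m n)%:R^-1 *
    \sum_(g : {ffun 'I_m -> 'I_n} | injectiveb g) rank_oracle_gap F Z G fJ g w ^+ 2)))).
  apply: expect_le => //; first exact: bounded_measurableZ.
  move=> w; rewrite mulrCA ler_wpM2l ?invr_ge0//.
  apply: le_trans (sum_antisymmetrized_gap _ _) _.
  by rewrite ler_wpM2r ?lerDl// sumr_ge0// => g _; exact: sqr_ge0.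
rewrite (expectZ P _ b1); apply: (@le_trans _ _ (c * (e0 / c))).
  by rewrite ler_wpM2l// ltW.
by rewrite mulrC divfK ?gt_eqF.
Qed.

Lemma oracle_discontinuity_null n (g : {ffun 'I_m -> 'I_n}) : injectiveb g ->
  measurable [set w | ~ continuity_set fJ (\matrix_(a < m) F (Z (g a) w))] /\
  P [set w | ~ continuity_set fJ (\matrix_(a < m) F (Z (g a) w))] = 0%E.
Proof.
move=> /injectiveP ginj.
have mA : measurable (~` continuity_set fJ) by apply: measurableC; exact: measurable_continuity_set.
have mE (e : 'I_m -> nat) :
    measurable [set w | ~ continuity_set fJ (\matrix_(a < m) F (Z (e a) w))].
  have mV : measurable_fun setT (fun w => \matrix_(a < m) F (Z (e a) w) : 'M[R]_(m, d)).
    exact: (measurable_oracle_matrix hF (Y := fun a : 'I_m => Z (e a))).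
  by rewrite -[X in measurable X]setTI; exact: (mV measurableT _ mA).
have IE (e : 'I_m -> nat) : \int[P]_w \1_(~` continuity_set fJ) (\matrix_(a < m) F (Z (e a) w)) =
    fine (P [set w | ~ continuity_set fJ (\matrix_(a < m) F (Z (e a) w))]).
  by have <- := expect_indic P (mE e); congr fine; apply: eq_integral => w _; rewrite !indicE.
split; first exact: (mE (fun a => g a)).
have gi : injective (fun a : 'I_m => g a : nat) by move=> x y /val_inj /ginj.
have E := oracle_matrix_law mZ lawZ hF gi val_inj mA.
rewrite (IE (fun a => g a)) (IE val) in E.
have f0 : fine (P [set w | ~ continuity_set fJ (\matrix_(a < m) F (Z (val a) w))]) = 0.
  exact: (congr1 fine oracle_continuity_set).
have fin : P [set w | ~ continuity_set fJ (\matrix_(a < m) F (Z (g a) w))] \is a fin_num.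
  by apply: fin_num_measure; exact: (mE (fun a => g a)).
by rewrite -(fineK fin) (etrans E f0).
Qed.

(** Joins the canonical terms to those of the statistics. Off one null set the observations are
    distinct, the optimum is strict, so that any empirical transport realizes it, and the oracle
    arguments are continuity points. *)
Lemma sample_terms n : (0 < n)%N -> exists N : set Omega, [/\ measurable N, P N = 0%E &
  forall w, ~ N w -> injective (fun i : 'I_n => Z i w) /\
  forall (T : 'rV[R]_d -> 'rV[R]_d) (g : {ffun 'I_m -> 'I_n}),
    empirical_center_outward (fun i : 'I_n => Z i w) (G n w) T -> injectiveb g ->
    rank_val (antisymmetrized H fJ) (enumeration (G n w)) (fun i : 'I_n => Z i w) g =
      antisymmetrized H f (rowsub g (\matrix_(i < n) score J (T (Z i w)))) /\
    oracle_val F (antisymmetrized H (borel_version fJ)) (fun i : 'I_n => Z i w) g =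
      antisymmetrized H f (rowsub g (\matrix_(i < n) score J (F (Z i w))))].
Proof.
move=> n0.
have [code [gr [mcode GE _]]] := grid_code n hG.
have [N1 [mN1 PN1 Hinj]] := sample_injective d_gt0 mZ lawZ acmu n.
have [N2 [mN2 PN2 Hties]] := sample_no_ties mZ lawZ acmu (fun c => @enumeration R d n (gr c)).
pose E (g : {ffun 'I_m -> 'I_n}) := if injectiveb g then
  [set w | ~ continuity_set fJ (\matrix_(a < m) F (Z (g a) w))] else set0.
have [mN3 PN3] : measurable (\bigcup_g E g) /\ P (\bigcup_g E g) = 0%E.
  by apply: null_bigcup => g; rewrite /E; case: ifPn => [/oracle_discontinuity_null[]//|_]; rewrite ?measure0.
have [mN12 PN12] := null_union mN1 mN2 PN1 PN2.
have [mN PN] := null_union mN12 mN3 PN12 PN3.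
exists (N1 `|` N2 `|` \bigcup_g E g); split => // w /not_orP[/not_orP[w1 w2] w3].
have zinj := Hinj w w1; split => // T g emp ginj.
have [pinj pG] := enumerationP (gridE n0 zinj).
have noties (s t : 'S_n) : s != t ->
    gain (enumeration (G n w)) (fun i : 'I_n => Z i w) s !=
    gain (enumeration (G n w)) (fun i : 'I_n => Z i w) t.
  by move=> st; have := Hties w w2 (code w); rewrite -GE => /(_ pinj s t st).
have [s hs Ts] := empirical_strict_opt zinj pinj pG emp noties.
split.
  rewrite /rank_val (rank_perm_some hs); apply: eq_bigr => t _; congr (_ * f _).
  apply/matrixP => a b; rewrite !mxE Ts; congr (score J _ _ _).
  by apply/matrixP => x y; rewrite !mxE (ord1 x).
rewrite oracle_val_antisymmetrized; apply: eq_bigr => t _; congr (_ * _).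
rewrite /oracle_val borel_versionE.
  congr f; apply/matrixP => a b; rewrite !mxE; congr (score J _ _ _).
  by apply/matrixP => x y; rewrite !mxE (ord1 x) ffunE.
apply: contrapT => nC; apply: w3; exists (precomp g t) => //.
by rewrite /E precomp_injectiveb ginj.
Qed.

End antisymmetrized_gap.

(** * Relabelling one sample *)

Section expected_second_moment.
Context {R : realType} {m n : nat} {dO} {Omega : measurableType dO} (P : probability Omega R).
Context (A D : Omega -> {ffun 'I_m -> 'I_n} -> R) (S : {set {ffun 'I_m -> 'I_n}}) (K : R).
Context (o1 o2 o3 o4 : 'I_m).
Hypothesis uo : uniq [:: o1; o2; o3; o4].
Hypothesis S_inj : forall g, g \in S -> injectiveb g.
Hypothesis A14 : forall w h, A w (precomp h (tperm o1 o4)) = - A w h.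
Hypothesis A23 : forall w h, A w (precomp h (tperm o2 o3)) = - A w h.
Hypothesis AK : forall w h, `|A w h| <= K.
Hypothesis bA : forall g, bounded_measurable (A ^~ g).
Hypothesis bD : forall g, bounded_measurable (D ^~ g).
Hypothesis exchangeable : forall s : 'S_n,
  \int[P]_w (\sum_(g in S) A w (postcomp s g) * D w g) ^+ 2 =
  \int[P]_w (\sum_(g in S) A w g * D w g) ^+ 2.

(** By exchangeability the expected square equals its mean over the [n!] relabellings of [A] with
    [D] held fixed, and [permutation_second_moment] applies outcome by outcome. *)
Lemma expected_second_moment : (1 < n)%N ->
  n%:R * n.-1%:R * \int[P]_w ((@ninj m n)%:R^-1 * \sum_(g in S) A w g * D w g) ^+ 2 <=
  K ^+ 2 * (m ^ 4)%:R * \int[P]_w ((@ninj m n)%:R^-1 * \sum_(g : {ffun 'I_m -> 'I_n} | injectiveb g) D w g ^+ 2).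
Proof.
move=> n1; set N := (@ninj m n)%:R : R.
have bAD s : bounded_measurable (fun w => (\sum_(g in S) A w (postcomp s g) * D w g) ^+ 2).
  apply: bounded_measurable_sqr; apply: bounded_measurable_sum => g; exact: bounded_measurableM.
have bADg : bounded_measurable (fun w => (\sum_(g in S) A w g * D w g) ^+ 2).
  apply: bounded_measurable_sqr; apply: bounded_measurable_sum => g; exact: bounded_measurableM.
have bDD : bounded_measurable (fun w => \sum_(g : {ffun 'I_m -> 'I_n} | injectiveb g) D w g ^+ 2).
  by apply: bounded_measurable_sum => g; exact: bounded_measurable_sqr.
have n0 : (0 < n)%N by exact: ltnW.
have nn : 0 < n%:R * n.-1%:R :> R by rewrite mulr_gt0 ?ltr0n// -subn1 subn_gt0.
have nf : 0 < n`!%:R :> R by rewrite ltr0n fact_gt0.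
pose I := \int[P]_w (\sum_(g in S) A w g * D w g) ^+ 2.
pose ID := \int[P]_w (\sum_(g : {ffun 'I_m -> 'I_n} | injectiveb g) D w g ^+ 2).
have key : n%:R * n.-1%:R * I <= K ^+ 2 * (m ^ 4)%:R * N * ID.
  pose c := n`!%:R * K ^+ 2 * (m ^ 4)%:R * N / (n%:R * n.-1%:R).
  have H : n`!%:R * I <= c * ID.
    have -> : n`!%:R * I = \int[P]_w (\sum_(s : 'S_n) (\sum_(g in S) A w (postcomp s g) * D w g) ^+ 2).
      rewrite expect_sum//; under [RHS]eq_bigr => s _ do rewrite exchangeable.
      by rewrite sumr_const card_Sn mulr_natl.
    rewrite -(expectZ P c bDD); apply: expect_le.
    - exact: bounded_measurable_sum.
    - exact: bounded_measurableZ.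
    - by move=> w; apply: (permutation_second_moment _ uo).
  rewrite -(ler_pM2l nf) mulrCA.
  apply: le_trans (ler_wpM2l (ltW nn) H) _.
  rewrite /c (_ : n%:R * n.-1%:R * _ = n`!%:R * (K ^+ 2 * (m ^ 4)%:R * N * ID) *
    (n%:R * n.-1%:R / (n%:R * n.-1%:R))); last by ring.
  by rewrite mulfV ?gt_eqF// mulr1.
have NN : N^-1 ^+ 2 * N = N^-1.
  have [->|N0] := eqVneq N 0; first by rewrite mulr0 invr0.
  by rewrite expr2 -mulrA mulVf// mulr1.
have -> : \int[P]_w (N^-1 * \sum_(g in S) A w g * D w g) ^+ 2 = N^-1 ^+ 2 * I.
  by rewrite -(expectZ P _ bADg); congr fine; apply: eq_integral => w _; rewrite exprMn.
rewrite (expectZ P _ bDD) -/ID.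
rewrite (_ : K ^+ 2 * _ * (N^-1 * ID) = N^-1 ^+ 2 * (K ^+ 2 * (m ^ 4)%:R * N * ID)); last first.
  by rewrite -[in LHS]NN; ring.
by rewrite mulrCA ler_wpM2l// sqr_ge0.
Qed.

End expected_second_moment.

Section resampling.
Context {R : realType} {dO} {Omega : measurableType dO} (P : probability Omega R).
Context {e1 e2} {T1 : measurableType e1} {T2 : measurableType e2} (n : nat).

(* Independence from the grids is assumed on their atoms only, so that the pi-system below
   restricts the code of the grids to at most one value, or not at all. *)
Definition atomic (C : set nat) : Prop := C = setT \/ exists c, C `<=` [set c].

Definition coded_rectangles : set (set (nat * (('I_n -> T1) * ('I_n -> T2)))) :=
  [set E | exists C A1 A2, [/\ atomic C, rectangles n A1, rectangles n A2 &
    E = [set x | C x.1 /\ A1 x.2.1 /\ A2 x.2.2]]].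

Lemma coded_rectangles_setI : setI_closed coded_rectangles.
Proof.
move=> _ _ [C [A1 [A2 [aC rA1 rA2 ->]]]] [C' [B1 [B2 [aC' rB1 rB2 ->]]]].
exists (C `&` C'), (A1 `&` B1), (A2 `&` B2); split.
- case: aC => [->|[c Cc]]; first by rewrite setTI.
  by right; exists c => x [/Cc].
- exact: rectangles_setI.
- exact: rectangles_setI.
- by apply/seteqP; split => x /=; tauto.
Qed.

Lemma coded_rectangles_setT : coded_rectangles setT.
Proof.
exists setT, setT, setT; split; [by left|exact: rectangles_setT|exact: rectangles_setT|].
by apply/seteqP; split.
Qed.

Definition coded_space := g_sigma_algebraType coded_rectangles.

Lemma measurable_code_atom c : measurable [set x : coded_space | x.1 = c].
Proof.
apply: sub_sigma_algebra; exists [set c], setT, setT.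
split; [by right; exists c|exact: rectangles_setT|exact: rectangles_setT|].
by apply/seteqP; split => x //= [].
Qed.

Lemma measurable_first_sample :
  measurable_fun setT (fun x : coded_space => x.2.1 : sequence_space (T := T1) n).
Proof.
apply: (@measurability _ _ coded_space (sequence_space (T := T1) n) setT _ (rectangles n) erefl).
move=> _ [E rE <-]; rewrite setTI; apply: sub_sigma_algebra; exists setT, E, setT.
split; [by left|by []|exact: rectangles_setT|].
by apply/seteqP; split => x //= -[_ []].
Qed.

Lemma measurable_second_sample :
  measurable_fun setT (fun x : coded_space => x.2.2 : sequence_space (T := T2) n).
Proof.
apply: (@measurability _ _ coded_space (sequence_space (T := T2) n) setT _ (rectangles n) erefl).
move=> _ [E rE <-]; rewrite setTI; apply: sub_sigma_algebra; exists setT, setT, E.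
split; [by left|exact: rectangles_setT|by []|].
by apply/seteqP; split => x //= -[_ []].
Qed.

Context (Z1 : nat -> Omega -> T1) (Z2 : nat -> Omega -> T2) (code : Omega -> nat).
Context (mu1 : set T1 -> \bar R) (mu2 : set T2 -> \bar R).
Hypothesis mZ1 : forall i, measurable_fun setT (Z1 i).
Hypothesis mZ2 : forall i, measurable_fun setT (Z2 i).
Hypothesis mcode : forall c, measurable [set w | code w = c].

Definition coded_product_law : Prop :=
  forall C (A1 : 'I_n -> set T1) (A2 : 'I_n -> set T2), atomic C ->
  (forall i, measurable (A1 i)) -> (forall i, measurable (A2 i)) ->
  P [set w | C (code w) /\ (forall i : 'I_n, A1 i (Z1 i w)) /\ (forall i : 'I_n, A2 i (Z2 i w))] =
  (P (code @^-1` C) * (\prod_i mu1 (A1 i) * \prod_i mu2 (A2 i)))%E.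

Hypothesis joint : coded_product_law.

(** On a coded rectangle the probability is a product over the indices, unchanged when the factors
    of either sample are permuted. The two permutations may differ because the samples are
    independent. *)
Lemma resampling_integral (s1 s2 : 'S_n) (f : coded_space -> R) :
  measurable_fun setT f -> (forall x, 0 <= f x) ->
  \int[P]_w f (code w, (fun i => Z1 (s1 i) w, fun i => Z2 (s2 i) w)) =
  \int[P]_w f (code w, (fun i : 'I_n => Z1 i w, fun i : 'I_n => Z2 i w)).
Proof.
move=> mf f0; rewrite /Rintegral; congr fine.
pose X (t1 t2 : 'S_n) w : coded_space := (code w, (fun i => Z1 (t1 i) w, fun i => Z2 (t2 i) w)).
have -> : (\int[P]_w (f (code w, (fun i : 'I_n => Z1 i w, fun i : 'I_n => Z2 i w)))%:E =
    \int[P]_w (f (X 1%g 1%g w))%:E)%E.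
  apply: eq_integral => w _; congr (f (_, (_, _)))%:E; apply/funext => i; by rewrite perm1.
have inv_inj (t : 'S_n) : injective (t^-1)%g := @perm_inj _ (t^-1)%g.
have XE (t1 t2 : 'S_n) C (A1 : 'I_n -> set T1) (A2 : 'I_n -> set T2) :
    X t1 t2 @^-1` [set x | C x.1 /\ [set z | forall i, A1 i (z i)] x.2.1 /\
      [set z | forall i, A2 i (z i)] x.2.2] =
    [set w | C (code w) /\ (forall i : 'I_n, A1 ((t1^-1)%g i) (Z1 i w)) /\
      (forall i : 'I_n, A2 ((t2^-1)%g i) (Z2 i w))].
  apply/seteqP; split => w /= [Cw [H1 H2]]; split => //; split => i.
  - by have := H1 ((t1^-1)%g i); rewrite permKV.
  - by have := H2 ((t2^-1)%g i); rewrite permKV.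
  - by have := H1 (t1 i); rewrite permK.
  - by have := H2 (t2 i); rewrite permK.
have matomic C : atomic C -> measurable (code @^-1` C).
  move=> _; have -> : code @^-1` C = \bigcup_(c in C) [set w | code w = c].
    by apply/seteqP; split => [w Cw|w [c Cc /= ->]//]; exists (code w).
  by apply: bigcup_measurable => c _.
have mX (t1 t2 : 'S_n) E : coded_rectangles E -> measurable (X t1 t2 @^-1` E).
  move=> [C [_ [_ [aC [A1 mA1 ->] [A2 mA2 ->] ->]]]]; rewrite XE.
  have -> : [set w | C (code w) /\ (forall i : 'I_n, A1 ((t1^-1)%g i) (Z1 i w)) /\
      (forall i : 'I_n, A2 ((t2^-1)%g i) (Z2 i w))] = code @^-1` C `&`
      (\bigcap_(i in [set: 'I_n]) (Z1 i @^-1` A1 ((t1^-1)%g i) `&` Z2 i @^-1` A2 ((t2^-1)%g i))).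
    apply/seteqP; split => [w /= [Cw [H1 H2]]|w /= [Cw H]].
      by split => // i _; split; [exact: H1|exact: H2].
    by split => //; split => i; have [] := H i Logic.I.
  apply: measurableI; first exact: matomic.
  apply: fin_bigcap_measurable => // i _; apply: measurableI.
    by rewrite -[X in measurable X]setTI; exact: mZ1.
  by rewrite -[X in measurable X]setTI; exact: mZ2.
apply: (eq_law_integral coded_rectangles_setI coded_rectangles_setT (X := X s1 s2) (Y := X 1%g 1%g)) => //.
- exact: mX.
- exact: mX.
- move=> _ [C [_ [_ [aC [A1 mA1 ->] [A2 mA2 ->] ->]]]]; rewrite !XE.
  refine (etrans (joint aC (fun i => mA1 _) (fun i => mA2 _))
    (etrans _ (esym (joint aC (fun i => mA1 _) (fun i => mA2 _))))).
  have inv (T : Type) (mu : set T -> \bar R) (A : 'I_n -> set T) (t : 'S_n) :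
      (\prod_i mu (A ((t^-1)%g i)) = \prod_i mu (A i))%E.
    by rewrite [LHS](reindex_inj (@perm_inj _ t))/=; apply: eq_bigr => i _; rewrite permK.
  congr (_ * (_ * _))%E.
    exact: (etrans (inv _ mu1 A1 s1) (esym (inv _ mu1 A1 1%g))).
  exact: (etrans (inv _ mu2 A2 s2) (esym (inv _ mu2 A2 1%g))).
Qed.

Variable m : nat.
Context (a : nat -> ('I_n -> T1) -> {ffun 'I_m -> 'I_n} -> R).
Context (b : nat -> ('I_n -> T2) -> {ffun 'I_m -> 'I_n} -> R).
Context (S : {set {ffun 'I_m -> 'I_n}}).
Hypothesis ma : forall g, measurable_fun setT (fun x : coded_space => a x.1 x.2.1 g).
Hypothesis mb : forall g, measurable_fun setT (fun x : coded_space => b x.1 x.2.2 g).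

Let z1 w (i : 'I_n) := Z1 i w.
Let z2 w (i : 'I_n) := Z2 i w.

Let mab : measurable_fun setT (fun x : coded_space =>
  (\sum_(g in S) a x.1 x.2.1 g * b x.1 x.2.2 g) ^+ 2).
Proof.
apply: measurable_funX.
rewrite (_ : (fun _ => _) = fun x : coded_space => \sum_(g <- enum S) a x.1 x.2.1 g * b x.1 x.2.2 g); last first.
  by apply/funext => x; rewrite big_enum.
by apply: measurable_sum => g; exact: measurable_funM.
Qed.

(** Only the first sample is relabelled: equivariance of [a] moves the permutation onto the
    injection, and [b] stays as it is. *)
Lemma exchange_first (s : 'S_n) : (forall c z g, a c (fun i => z (s i)) g = a c z (postcomp s g)) ->
  \int[P]_w (\sum_(g in S) a (code w) (z1 w) (postcomp s g) * b (code w) (z2 w) g) ^+ 2 =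
  \int[P]_w (\sum_(g in S) a (code w) (z1 w) g * b (code w) (z2 w) g) ^+ 2.
Proof.
move=> aE; have := resampling_integral s 1%g mab (fun x => sqr_ge0 _) => /= <-.
congr fine; apply: eq_integral => w _; congr (_ ^+ 2)%:E.
apply: eq_bigr => g _; rewrite -aE; congr (_ * b _ _ _).
by apply/funext => i; rewrite perm1.
Qed.

Lemma exchange_second (s : 'S_n) : (forall c z g, b c (fun i => z (s i)) g = b c z (postcomp s g)) ->
  \int[P]_w (\sum_(g in S) b (code w) (z2 w) (postcomp s g) * a (code w) (z1 w) g) ^+ 2 =
  \int[P]_w (\sum_(g in S) b (code w) (z2 w) g * a (code w) (z1 w) g) ^+ 2.
Proof.
move=> bE; transitivity (\int[P]_w (\sum_(g in S) a (code w) (z1 w) g * b (code w) (z2 w) g) ^+ 2); last first.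
  by congr fine; apply: eq_integral => w _; congr (_ ^+ 2)%:E; apply: eq_bigr => g _; rewrite mulrC.
have := resampling_integral 1%g s mab (fun x => sqr_ge0 _) => /= <-.
congr fine; apply: eq_integral => w _; congr (_ ^+ 2)%:E.
apply: eq_bigr => g _; rewrite -bE mulrC; congr (a _ _ _ * _).
by apply/funext => i; rewrite perm1.
Qed.

End resampling.

Section pair_law.
Context {R : realType} {dO} {Omega : measurableType dO} (P : probability Omega R).
Context {e1 e2} {T1 : measurableType e1} {T2 : measurableType e2}.
Context (X1 : Omega -> T1) (X2 : Omega -> T2) (Z1 : nat -> Omega -> T1) (Z2 : nat -> Omega -> T2).
Hypothesis H0 : independent2 P X1 X2.
Hypothesis iid : iid_copies P (fun i w => (Z1 i w, Z2 i w)) (fun w => (X1 w, X2 w)).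

(** Here the null hypothesis enters: it splits the law of each pair, so that the two samples become
    independent of each other. *)
Lemma pair_rectangle_law k (e : 'I_k -> nat) (A1 : 'I_k -> set T1) (A2 : 'I_k -> set T2) :
  injective e -> (forall i, measurable (A1 i)) -> (forall i, measurable (A2 i)) ->
  P [set w | (forall i, A1 i (Z1 (e i) w)) /\ (forall i, A2 i (Z2 (e i) w))] =
  (\prod_i P (X1 @^-1` A1 i) * \prod_i P (X2 @^-1` A2 i))%E.
Proof.
move=> einj mA1 mA2.
have mA i : measurable (A1 i `*` A2 i) by exact: measurableX.
have := iid_product_law iid einj mA.
have -> : [set w | forall a, (A1 a `*` A2 a) (Z1 (e a) w, Z2 (e a) w)] =
    [set w | (forall i, A1 i (Z1 (e i) w)) /\ (forall i, A2 i (Z2 (e i) w))].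
  by apply/seteqP; split => w /= => [H|[H1 H2] i//]; split => i; have [] := H i.
move=> H; refine (etrans H _); rewrite -big_split/=; apply: eq_bigr => i _.
exact: H0.
Qed.

Lemma first_product_law : product_law P Z1 (fun A => P (X1 @^-1` A)).
Proof.
move=> k e A einj mA.
have := pair_rectangle_law einj mA (fun=> measurableT).
have -> : [set w | (forall i, A i (Z1 (e i) w)) /\ (forall i : 'I_k, [set: T2] (Z2 (e i) w))] =
    [set w | forall i, A i (Z1 (e i) w)].
  by apply/seteqP; split => w /= => [[]|].
move=> H; refine (etrans H _); rewrite [X in (_ * X)%E]big1 ?mule1// => i _.
by rewrite preimage_setT; exact: probability_setT.
Qed.

Lemma second_product_law : product_law P Z2 (fun A => P (X2 @^-1` A)).
Proof.
move=> k e A einj mA.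
have := pair_rectangle_law einj (fun=> measurableT) mA.
have -> : [set w | (forall i : 'I_k, [set: T1] (Z1 (e i) w)) /\ (forall i, A i (Z2 (e i) w))] =
    [set w | forall i, A i (Z2 (e i) w)].
  by apply/seteqP; split => w /= => [[]|].
move=> H; refine (etrans H _); rewrite [X in (X * _)%E]big1 ?mul1e// => i _.
by rewrite preimage_setT; exact: probability_setT.
Qed.

Lemma pair_coded_product_law n (code : Omega -> nat) :
  (forall c E, generated_events (fun i w => (Z1 i w, Z2 i w)) E ->
    P ([set w | code w = c] `&` E) = (P [set w | code w = c] * P E)%E) ->
  @coded_product_law _ _ _ P _ _ _ _ n Z1 Z2 code (fun A => P (X1 @^-1` A)) (fun A => P (X2 @^-1` A)).
Proof.
move=> indep C A1 A2 aC mA1 mA2.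
pose E := [set w | (forall i : 'I_n, A1 i (Z1 i w)) /\ (forall i : 'I_n, A2 i (Z2 i w))].
have PE := pair_rectangle_law (e := val) val_inj mA1 mA2.
have gE : generated_events (fun i w => (Z1 i w, Z2 i w)) E.
  pose U := \bigcup_i preimage_set_system setT (fun w => (Z1 i w, Z2 i w)) measurable.
  have -> : E = \bigcap_(i in [set: 'I_n]) ((fun w => (Z1 i w, Z2 i w)) @^-1` (A1 i `*` A2 i)).
    apply/seteqP; split => [w [H1 H2] i _|w H]; first by split; [exact: H1|exact: H2].
    by split => i; have [] := H i Logic.I.
  apply: (@fin_bigcap_measurable _ (g_sigma_algebraType U)) => // i _.
  apply: sub_sigma_algebra; exists (val i) => //; exists (A1 i `*` A2 i); last by rewrite setTI.
  exact: measurableX.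
transitivity (P (code @^-1` C `&` E)) => //.
transitivity (P (code @^-1` C) * P E)%E; last by congr (_ * _)%E; exact: PE.
(* An atomic [C] is everything, a single code, or empty. *)
case: aC => [->|[c Cc]].
  rewrite preimage_setT setTI.
  refine (esym (etrans (congr1 (fun x => x * P E)%E (probability_setT P)) _)).
  exact: mul1e.
have [Ccc|nC] := pselect (C c).
  have -> : code @^-1` C = [set w | code w = c].
    by apply/seteqP; split => w /= => [/Cc|->].
  exact: indep.
have -> : code @^-1` C = set0.
  by apply/seteqP; split => w //= Cw; apply: nC; rewrite -(Cc _ Cw).
by rewrite set0I measure0 mul0e.
Qed.

End pair_law.

(** The two codes are paired into one integer. As each grid determines its code, the atoms of the
    pair are the atoms of the two grids. *)
Lemma joint_grid_code (R : realType) d1 d2 {dO} {Omega : measurableType dO} (P : probability Omega R)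
    (sigma1 : probability 'rV[R]_d1 R) (sigma2 : probability 'rV[R]_d2 R)
    (G1 : nat -> Omega -> set 'rV[R]_d1) (G2 : nat -> Omega -> set 'rV[R]_d2)
    {dT} {T : measurableType dT} (Z : nat -> Omega -> T) n :
  grid_sequence P sigma1 G1 -> grid_sequence P sigma2 G2 -> grids_independent P G1 G2 Z ->
  exists (code : Omega -> nat) (gr1 : nat -> set 'rV[R]_d1) (gr2 : nat -> set 'rV[R]_d2),
    [/\ forall c, measurable [set w | code w = c],
        forall w, G1 n w = gr1 (code w), forall w, G2 n w = gr2 (code w) &
        forall c E, generated_events Z E ->
          P ([set w | code w = c] `&` E) = (P [set w | code w = c] * P E)%E].
Proof.
move=> hG1 hG2 hG.
have [code1 [gr1 [m1 E1 I1]]] := grid_code n hG1.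
have [code2 [gr2 [m2 E2 I2]]] := grid_code n hG2.
pose code w := choice.pickle (code1 w, code2 w).
pose dec c : nat * nat := odflt (0%N, 0%N) (choice.unpickle c).
have decE w : dec (code w) = (code1 w, code2 w) by rewrite /dec /code choice.pickleK.
exists code, (fun c => gr1 (dec c).1), (fun c => gr2 (dec c).2); split.
- move=> c; have [[w0 w0c]|no] := pselect (exists w, code w = c); last first.
    by rewrite (_ : [set w | _] = set0)//; apply/seteqP; split => // w wc; apply: no; exists w.
  have -> : [set w | code w = c] = [set w | code1 w = code1 w0] `&` [set w | code2 w = code2 w0].
    apply/seteqP; split => w /=.
      by move=> wc; have := congr1 dec (etrans wc (esym w0c)); rewrite !decE => -[].
    by move=> [c1 c2]; rewrite -w0c /code c1 c2.
  exact: measurableI.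
- by move=> w; rewrite decE E1.
- by move=> w; rewrite decE E2.
- move=> c E gE; have [[w0 w0c]|no] := pselect (exists w, code w = c); last first.
    rewrite (_ : [set w | _] = set0); first by rewrite set0I measure0 mul0e.
    by apply/seteqP; split => // w wc; apply: no; exists w.
  have -> : [set w | code w = c] = [set w | G1 n w = G1 n w0 /\ G2 n w = G2 n w0].
    apply/seteqP; split => w /=.
      move=> wc; have := congr1 dec (etrans wc (esym w0c)); rewrite !decE => -[c1 c2].
      by rewrite !E1 !E2 c1 c2.
    by move=> [/I1 c1 /I2 c2]; rewrite -w0c /code c1 c2.
  exact: hG.
Qed.

(** * The two statistics *)

Section two_samples.
Context {R : realType} {d1 d2 m : nat} (hm : (4 <= m)%N).
Context {dO} {Omega : measurableType dO} (P : probability Omega R).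
Context (mu1 sigma1 : probability 'rV[R]_d1 R) (mu2 sigma2 : probability 'rV[R]_d2 R).
Context (F1 : 'rV[R]_d1 -> 'rV[R]_d1) (F2 : 'rV[R]_d2 -> 'rV[R]_d2).
Context (Z1 : nat -> Omega -> 'rV[R]_d1) (Z2 : nat -> Omega -> 'rV[R]_d2).
Context (G1 : nat -> Omega -> set 'rV[R]_d1) (G2 : nat -> Omega -> set 'rV[R]_d2).
Context (f1 : 'M[R]_(m, d1) -> R) (f2 : 'M[R]_(m, d2) -> R) (J1 J2 : R -> R) (M1 M2 : R).
Hypothesis d1_gt0 : (0 < d1)%N.
Hypothesis d2_gt0 : (0 < d2)%N.
Hypothesis mZ1 : forall i, measurable_fun setT (Z1 i).
Hypothesis mZ2 : forall i, measurable_fun setT (Z2 i).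
Hypothesis lawZ1 : product_law P Z1 mu1.
Hypothesis lawZ2 : product_law P Z2 mu2.
Hypothesis jointZ : forall n (code : Omega -> nat),
  (forall c E, generated_events (fun i w => (Z1 i w, Z2 i w)) E ->
    P ([set w | code w = c] `&` E) = (P [set w | code w = c] * P E)%E) ->
  @coded_product_law _ _ _ P _ _ _ _ n Z1 Z2 code mu1 mu2.
Hypothesis ac1 : abs_continuous mu1.
Hypothesis ac2 : abs_continuous mu2.
Hypothesis hsigma1 : sphere_uniform sigma1.
Hypothesis hsigma2 : sphere_uniform sigma2.
Hypothesis hF1 : center_outward mu1 sigma1 F1.
Hypothesis hF2 : center_outward mu2 sigma2 F2.
Hypothesis hG1 : grid_sequence P sigma1 G1.
Hypothesis hG2 : grid_sequence P sigma2 G2.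
Hypothesis hG : grids_independent P G1 G2 (fun i w => (Z1 i w, Z2 i w)).
Hypothesis gridE1 : forall n w, (0 < n)%N -> injective (fun i : 'I_n => Z1 i w) ->
  exists p : 'I_n -> 'rV[R]_d1, injective p /\ range p = G1 n w.
Hypothesis gridE2 : forall n w, (0 < n)%N -> injective (fun i : 'I_n => Z2 i w) ->
  exists p : 'I_n -> 'rV[R]_d2, injective p /\ range p = G2 n w.
Hypothesis wJ1 : weakly_regular J1.
Hypothesis wJ2 : weakly_regular J2.
Hypothesis fM1 : forall x, `|f1 x| <= M1.
Hypothesis fM2 : forall x, `|f2 x| <= M2.
Hypothesis cf1 : ae_continuous_along P f1 (fun i w => score J1 (F1 (Z1 i w))).
Hypothesis cf2 : ae_continuous_along P f2 (fun i w => score J2 (F2 (Z2 i w))).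

Let H := Hstar hm.

Definition rank_term d (f : 'M[R]_(m, d) -> R) J (G : nat -> Omega -> set 'rV[R]_d)
    (Z : nat -> Omega -> 'rV[R]_d) n w (g : {ffun 'I_m -> 'I_n}) : R :=
  rank_val (antisymmetrized H (score_kernel J f)) (enumeration (G n w)) (fun i : 'I_n => Z i w) g.

Definition oracle_term d (f : 'M[R]_(m, d) -> R) J (F : 'rV[R]_d -> 'rV[R]_d)
    (Z : nat -> Omega -> 'rV[R]_d) n w (g : {ffun 'I_m -> 'I_n}) : R :=
  oracle_val F (antisymmetrized H (borel_version (score_kernel J f))) (fun i : 'I_n => Z i w) g.

Definition statistic_gap n w : R := (@ninj m n)%:R^-1 *
  \sum_(g in @ordered_injections m n)
    (rank_term f1 J1 G1 Z1 w g * rank_term f2 J2 G2 Z2 w g -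
     oracle_term f1 J1 F1 Z1 w g * oracle_term f2 J2 F2 Z2 w g).

Lemma measurable_antisymmetrized_oracle d (mu sigma : probability 'rV[R]_d R)
    (F : 'rV[R]_d -> 'rV[R]_d) (f : 'M[R]_(m, d) -> R) n
    {dS} {S : measurableType dS} (Y : S -> 'I_n -> 'rV[R]_d) (g : {ffun 'I_m -> 'I_n}) :
  center_outward mu sigma F -> (forall i, measurable_fun setT (Y ^~ i)) ->
  measurable_fun setT (fun x => oracle_val F (antisymmetrized H (borel_version f)) (Y x) g).
Proof.
move=> hF mY; rewrite (_ : (fun _ => _) = fun w => \sum_(t <- enum H) (-1) ^+ (odd_perm t) *
    oracle_val F (borel_version f) (Y w) (precomp g t)); last first.
  by apply/funext => w; rewrite big_enum; exact: oracle_val_antisymmetrized.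
apply: measurable_sum => t; apply: measurable_funM => //.
apply: (measurableT_comp (measurable_borel_version f)).
exact: (measurable_oracle_matrix hF (Y := fun a => Y ^~ (precomp g t a))).
Qed.

(** The scale [n * n.-1] is, up to a constant, the reciprocal of the fraction of overlapping pairs
    of injections; what makes the bound small is the mean-square gap of the factor that is not
    relabelled. *)
Lemma statistic_gap_L2 (e : R) : 0 < e -> exists n0 : nat, forall n, (n0 <= n)%N ->
  bounded_measurable (@statistic_gap n) /\
  n%:R * n.-1%:R * \int[P]_w statistic_gap n w ^+ 2 <= e.
Proof.
move=> e0.
pose K1 := #|H|%:R * M1; pose K2 := #|H|%:R * M2.
(* The factor 2 comes from splitting the square of [T1 + T2]; the 1 keeps [c] positive. *)
pose c := 2 * (K1 ^+ 2 + K2 ^+ 2) * (m ^ 4)%:R + 1.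
have K0 : 0 <= K1 ^+ 2 + K2 ^+ 2 by rewrite addr_ge0 ?sqr_ge0.
have c0 : 0 < c by rewrite ltr_wpDl// !mulr_ge0.
have e'0 : 0 < e / c by rewrite divr_gt0.
have [n1 H1] := antisymmetrized_gap_L2 H d1_gt0 mZ1 lawZ1 ac1 hsigma1 hF1 hG1 gridE1 wJ1 fM1 cf1 e'0.
have [n2 H2] := antisymmetrized_gap_L2 H d2_gt0 mZ2 lawZ2 ac2 hsigma2 hF2 hG2 gridE2 wJ2 fM2 cf2 e'0.
exists (maxn 2 (maxn n1 n2)) => n; rewrite !geq_max => /and3P[n_gt1 /H1 {}H1 /H2 {}H2].
have [code [gr1 [gr2 [mcode GE1 GE2 indep]]]] := joint_grid_code n hG1 hG2 hG.
have jl := jointZ indep.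
pose A1 w g := @rank_term _ f1 J1 G1 Z1 n w g; pose A2 w g := @rank_term _ f2 J2 G2 Z2 n w g.
pose B1 w g := @oracle_term _ f1 J1 F1 Z1 n w g; pose B2 w g := @oracle_term _ f2 J2 F2 Z2 n w g.
pose D1 w g := A1 w g - B1 w g; pose D2 w g := A2 w g - B2 w g.
have bA1 g : bounded_measurable (A1 ^~ g).
  exact: (bounded_measurable_antisymmetrized_rank J1 H mZ1 hG1 fM1).
have bA2 g : bounded_measurable (A2 ^~ g).
  exact: (bounded_measurable_antisymmetrized_rank J2 H mZ2 hG2 fM2).
have bB1 g : bounded_measurable (B1 ^~ g).
  exact: (bounded_measurable_antisymmetrized_oracle J1 H mZ1 hF1 fM1).
have bB2 g : bounded_measurable (B2 ^~ g).
  exact: (bounded_measurable_antisymmetrized_oracle J2 H mZ2 hF2 fM2).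
have bD1 g : bounded_measurable (D1 ^~ g) by exact: bounded_measurableB.
have bD2 g : bounded_measurable (D2 ^~ g) by exact: bounded_measurableB.
pose N : R := (@ninj m n)%:R.
pose T1 w := N^-1 * \sum_(g in @ordered_injections m n) A1 w g * D2 w g.
(* The bounded alternating factor is now an oracle term of the second sample, so that sample is the
   one to be relabelled. *)
pose T2 w := N^-1 * \sum_(g in @ordered_injections m n) B2 w g * D1 w g.
have bT1 : bounded_measurable T1.
  by apply: bounded_measurableZ; apply: bounded_measurable_sum => g; exact: bounded_measurableM.
have bT2 : bounded_measurable T2.
  by apply: bounded_measurableZ; apply: bounded_measurable_sum => g; exact: bounded_measurableM.
have TE w : statistic_gap n w = T1 w + T2 w.
  rewrite /statistic_gap /T1 /T2 -mulrDr -big_split/=; congr (_ * _).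
  by apply: eq_bigr => g _; rewrite /D1 /D2 /A1 /A2 /B1 /B2; ring.
have bT : bounded_measurable (@statistic_gap n).
  rewrite (_ : @statistic_gap n = fun w => T1 w + T2 w); last exact/funext.
  exact: bounded_measurableD.
split => //.
pose h1 := antisymmetrized H (score_kernel J1 f1); pose h2 := antisymmetrized H (score_kernel J2 f2).
pose k1 := antisymmetrized H (borel_version (score_kernel J1 f1)).
pose k2 := antisymmetrized H (borel_version (score_kernel J2 f2)).
pose p1 c := @enumeration R d1 n (gr1 c); pose p2 c := @enumeration R d2 n (gr2 c).
pose a1 c (z : 'I_n -> 'rV[R]_d1) (g : {ffun 'I_m -> 'I_n}) := rank_val h1 (p1 c) z g.
pose a2 c (z : 'I_n -> 'rV[R]_d2) (g : {ffun 'I_m -> 'I_n}) := rank_val h2 (p2 c) z g.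
pose b1 (z : 'I_n -> 'rV[R]_d1) (g : {ffun 'I_m -> 'I_n}) := oracle_val F1 k1 z g.
pose b2 (z : 'I_n -> 'rV[R]_d2) (g : {ffun 'I_m -> 'I_n}) := oracle_val F2 k2 z g.
pose X := @coded_space _ _ 'rV[R]_d1 'rV[R]_d2 n.
have mX1 (i : 'I_n) : measurable_fun setT (fun x : X => x.2.1 i).
  have ms := @measurable_first_sample _ _ 'rV[R]_d1 'rV[R]_d2 n.
  exact: (measurableT_comp (@measurable_sequence_coord _ 'rV[R]_d1 n i) ms).
have mX2 (i : 'I_n) : measurable_fun setT (fun x : X => x.2.2 i).
  have ms := @measurable_second_sample _ _ 'rV[R]_d1 'rV[R]_d2 n.
  exact: (measurableT_comp (@measurable_sequence_coord _ 'rV[R]_d2 n i) ms).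
have ma1 g : measurable_fun setT (fun x : X => a1 x.1 x.2.1 g).
  apply: (@measurable_by_code R _ X fst (fun c x => a1 c x.2.1 g)) => k.
    exact: measurable_code_atom.
  exact: (measurable_rank_val _ _ _ mX1).
have ma2 g : measurable_fun setT (fun x : X => a2 x.1 x.2.2 g).
  apply: (@measurable_by_code R _ X fst (fun c x => a2 c x.2.2 g)) => k.
    exact: measurable_code_atom.
  exact: (measurable_rank_val _ _ _ mX2).
have mb1 g : measurable_fun setT (fun x : X => b1 x.2.1 g).
  exact: (@measurable_antisymmetrized_oracle _ _ _ F1 (score_kernel J1 f1) n _ X (fun x => x.2.1) g hF1 mX1).
have mb2 g : measurable_fun setT (fun x : X => b2 x.2.2 g).
  exact: (@measurable_antisymmetrized_oracle _ _ _ F2 (score_kernel J2 f2) n _ X (fun x => x.2.2) g hF2 mX2).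
have fJ1 x : `|score_kernel J1 f1 x| <= M1 by exact: fM1.
have fJ2 x : `|score_kernel J2 f2 x| <= M2 by exact: fM2.
have uo := star_index_uniq hm.
have odd_t k l : (k, l) = (0, 3)%N \/ (k, l) = (1, 2)%N ->
    odd_perm (tperm (star_index hm k) (star_index hm l)).
  move=> kl; rewrite odd_tperm; move: uo; rewrite /= !inE !negb_or => /and4P[/and3P[u1 u2 u3] /andP[u4 u5] u6 _].
  by case: kl => -[-> ->].
have c03 : (0, 3)%N = (0, 3)%N \/ (0, 3)%N = (1, 2)%N by left.
have c12 : (1, 2)%N = (0, 3)%N \/ (1, 2)%N = (1, 2)%N by right.
have R1 := @expected_second_moment R m n _ _ P A1 D2 (@ordered_injections m n) K1 _ _ _ _ uo
  (@ordered_injections_inj m n)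
  (fun w h => rank_val_flip _ _ _ _ (odd_t _ _ c03) (Hstar_flip hm c03))
  (fun w h => rank_val_flip _ _ _ _ (odd_t _ _ c12) (Hstar_flip hm c12))
  (fun w h => rank_val_bounded _ _ _ (fun x => antisymmetrized_bounded H x fJ1)) bA1 bD2 _ n_gt1.
have R2 := @expected_second_moment R m n _ _ P B2 D1 (@ordered_injections m n) K2 _ _ _ _ uo
  (@ordered_injections_inj m n)
  (fun w h => oracle_val_flip _ _ _ _ (odd_t _ _ c03) (Hstar_flip hm c03))
  (fun w h => oracle_val_flip _ _ _ _ (odd_t _ _ c12) (Hstar_flip hm c12))
  (fun w h => antisymmetrized_bounded H _ (borel_version_bounded fJ2)) bB2 bD1 _ n_gt1.
have EA1 : A1 = fun w g => a1 (code w) (fun i => Z1 i w) g.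
  by apply/funext => w; apply/funext => g; rewrite /a1 /p1 -GE1.
have EA2 : A2 = fun w g => a2 (code w) (fun i => Z2 i w) g.
  by apply/funext => w; apply/funext => g; rewrite /a2 /p2 -GE2.
have {}R1 : n%:R * n.-1%:R * \int[P]_w T1 w ^+ 2 <= K1 ^+ 2 * (m ^ 4)%:R * (e / c).
  apply: le_trans (R1 _) _; last by apply: ler_wpM2l; [rewrite mulr_ge0 ?sqr_ge0|exact: H2].
  move=> s; rewrite /D2 EA1 EA2.
  exact: (exchange_first mZ1 mZ2 mcode (jl n) (a := a1) (b := fun c z g => a2 c z g - b2 z g)
    (@ordered_injections m n) ma1
    (fun g => measurable_funB (ma2 g) (mb2 g)) (s := s) (fun c z g => rank_val_perm _ _ _ _ _)).
have {}R2 : n%:R * n.-1%:R * \int[P]_w T2 w ^+ 2 <= K2 ^+ 2 * (m ^ 4)%:R * (e / c).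
  apply: le_trans (R2 _) _; last by apply: ler_wpM2l; [rewrite mulr_ge0 ?sqr_ge0|exact: H1].
  move=> s; rewrite /D1 EA1.
  exact: (exchange_second mZ1 mZ2 mcode (jl n) (a := fun c z g => a1 c z g - b1 z g)
    (b := fun=> b2) (@ordered_injections m n)
    (fun g => measurable_funB (ma1 g) (mb1 g)) mb2 (s := s) (fun c z g => oracle_val_perm _ _ _ _ _)).
have sq1 := bounded_measurable_sqr bT1; have sq2 := bounded_measurable_sqr bT2.
apply: (@le_trans _ _ (n%:R * n.-1%:R * (2 * (\int[P]_w T1 w ^+ 2 + \int[P]_w T2 w ^+ 2)))).
  rewrite ler_wpM2l ?mulr_ge0// -expectD//.
  rewrite -(expectZ P 2 (bounded_measurableD sq1 sq2)); apply: expect_le.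
  - exact: bounded_measurable_sqr.
  - exact/bounded_measurableZ/bounded_measurableD.
  - by move=> w; rewrite TE; have := sqr_ge0 (T1 w - T2 w); rewrite sqrrB sqrrD; lra.
apply: (@le_trans _ _ (2 * (K1 ^+ 2 * (m ^ 4)%:R * (e / c) + K2 ^+ 2 * (m ^ 4)%:R * (e / c)))).
  by rewrite mulrCA ler_wpM2l// mulrDr lerD.
apply: (@le_trans _ _ (c * (e / c))); last by rewrite mulrC divfK ?gt_eqF.
rewrite [leLHS](_ : _ = 2 * (K1 ^+ 2 + K2 ^+ 2) * (m ^ 4)%:R * (e / c)); last by ring.
by rewrite ler_wpM2r ?lerDl// ltW.
Qed.

End two_samples.

(** A bijection from the sample onto the grid lists the grid without repetition once the sample has
    none. *)
Lemma empirical_enumeration (R : realType) d n (z : 'I_n -> 'rV[R]_d) (A : set 'rV[R]_d)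
    (T : 'rV[R]_d -> 'rV[R]_d) : injective z -> empirical_center_outward z A T ->
  exists p : 'I_n -> 'rV[R]_d, injective p /\ range p = A.
Proof.
move=> zinj [[Tsub Tinj Tsurj] _]; exists (T \o z); split.
  by move=> i j E; apply: zinj; apply: Tinj => //; rewrite inE; [exists i|exists j].
apply/seteqP; split => [_ [i _ <-]|y /Tsurj[_ [i _ <-] <-]]; last by exists i.
by apply: Tsub; exists i.
Qed.

Theorem theorem5p2 (R : realType) (d1 d2 m : nat)
  (hd1 : (1 <= d1)%N) (hd2 : (1 <= d2)%N) (hm : (4 <= m)%N)
  (f1 : 'M[R]_(m, d1) -> R) (f2 : 'M[R]_(m, d2) -> R)
  (J1 J2 : R -> R)
  (hf1 : forall x, 0 <= f1 x) (hf2 : forall x, 0 <= f2 x)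
  (hJ1 : weakly_regular J1) (hJ2 : weakly_regular J2)
  (bf1 : exists M : R, forall x, f1 x <= M)
  (bf2 : exists M : R, forall x, f2 x <= M)
  (dO : measure_display) (Omega : measurableType dO) (P : probability Omega R)
  (X1 : {RV P >-> 'rV[R]_d1}) (X2 : {RV P >-> 'rV[R]_d2})
  (acX1 : abs_continuous (distribution P X1))
  (acX2 : abs_continuous (distribution P X2))
  (H0 : independent2 P X1 X2)
  (Xs1 : nat -> {RV P >-> 'rV[R]_d1}) (Xs2 : nat -> {RV P >-> 'rV[R]_d2})
  (iid : iid_copies P (fun i w => (Xs1 i w, Xs2 i w)) (fun w => (X1 w, X2 w)))
  (sigma1 : probability 'rV[R]_d1 R) (sigma2 : probability 'rV[R]_d2 R)
  (hsigma1 : sphere_uniform sigma1) (hsigma2 : sphere_uniform sigma2)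
  (F1 : 'rV[R]_d1 -> 'rV[R]_d1) (F2 : 'rV[R]_d2 -> 'rV[R]_d2)
  (hF1 : center_outward (distribution P X1) sigma1 F1)
  (hF2 : center_outward (distribution P X2) sigma2 F2)
  (cf1 : ae_continuous_along P f1 (fun i w => score J1 (F1 (Xs1 i w))))
  (cf2 : ae_continuous_along P f2 (fun i w => score J2 (F2 (Xs2 i w))))
  (G1 : nat -> Omega -> set 'rV[R]_d1) (G2 : nat -> Omega -> set 'rV[R]_d2)
  (hG1 : grid_sequence P sigma1 G1) (hG2 : grid_sequence P sigma2 G2)
  (hG : grids_independent P G1 G2 (fun i w => (Xs1 i w, Xs2 i w)))
  (Fn1 : nat -> Omega -> 'rV[R]_d1 -> 'rV[R]_d1)
  (Fn2 : nat -> Omega -> 'rV[R]_d2 -> 'rV[R]_d2)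
  (hFn1 : forall n w, (0 < n)%N -> injective (fun i : 'I_n => Xs1 i w) ->
    empirical_center_outward (fun i : 'I_n => Xs1 i w) (G1 n w) (Fn1 n w))
  (hFn2 : forall n w, (0 < n)%N -> injective (fun i : 'I_n => Xs2 i w) ->
    empirical_center_outward (fun i : 'I_n => Xs2 i w) (G2 n w) (Fn2 n w)) :
  let W_rank n w := sample_gsc (Hstar hm) f1 f2
    (\matrix_(i < n) score J1 (Fn1 n w (Xs1 i w)))
    (\matrix_(i < n) score J2 (Fn2 n w (Xs2 i w))) in
  let W_oracle n w := sample_gsc (Hstar hm) f1 f2
    (\matrix_(i < n) score J1 (F1 (Xs1 i w)))
    (\matrix_(i < n) score J2 (F2 (Xs2 i w))) in
  little_o_P P (fun n w => W_rank n w - W_oracle n w) (fun n => n%:R^-1).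
Proof.
move=> W_rank W_oracle.
have [M1 fM1'] := bf1; have [M2 fM2'] := bf2.
have fM1 x : `|f1 x| <= M1 by rewrite ger0_norm.
have fM2 x : `|f2 x| <= M2 by rewrite ger0_norm.
have mZ1 i : measurable_fun setT (Xs1 i) by [].
have mZ2 i : measurable_fun setT (Xs2 i) by [].
have lawZ1 : product_law P (fun i => Xs1 i : Omega -> _) (distribution P X1) := first_product_law H0 iid.
have lawZ2 : product_law P (fun i => Xs2 i : Omega -> _) (distribution P X2) := second_product_law H0 iid.
have jointZ := pair_coded_product_law H0 iid.
have gridE1 n w n0 (zi : injective (fun i : 'I_n => Xs1 i w)) :=
  empirical_enumeration zi (hFn1 n w n0 zi).
have gridE2 n w n0 (zi : injective (fun i : 'I_n => Xs2 i w)) :=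
  empirical_enumeration zi (hFn2 n w n0 zi).
have L2 := statistic_gap_L2 hm hd1 hd2 mZ1 mZ2 lawZ1 lawZ2 jointZ acX1 acX2 hsigma1 hsigma2 hF1 hF2
  hG1 hG2 hG gridE1 gridE2 hJ1 hJ2 fM1 fM2 cf1 cf2.
move=> eps eps0; apply/fine_cvgP.
suff key (delta : R) : 0 < delta -> \forall n \near \oo,
    (mu_ext P [set w | (eps * n%:R^-1 < `|W_rank n w - W_oracle n w|)%R] <= delta%:E)%E.
  have ge0 n : (0 <= mu_ext P [set w | (eps * n%:R^-1 < `|W_rank n w - W_oracle n w|)%R])%E.
    exact: mu_ext_ge0.
  split.
    apply: filterS (key 1 ltr01) => n kn; rewrite ge0_fin_numE//.
    exact: le_lt_trans kn (ltry _).
  apply/cvgrPdist_le => delta d0; apply: filterS (key _ d0) => n kn.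
  rewrite sub0r normrN ger0_norm ?fine_ge0//.
  by rewrite -lee_fin fineK// ge0_fin_numE//; exact: le_lt_trans kn (ltry _).
move=> delta0.
(* Markov's inequality for the squared gap at level [(eps / n) ^ 2], with [n <= 2 * n.-1], turns
   this value into a probability of at most [delta]. *)
have e0 : 0 < delta * eps ^+ 2 / 2 by rewrite divr_gt0 ?mulr_gt0 ?exprn_gt0.
have [n0 Hn] := L2 _ e0.
near=> n.
have n_gt1 : (1 < n)%N by near: n; exact: nbhs_infty_gt.
have nn0 : (n0 <= n)%N by near: n; exact: nbhs_infty_ge.
have [bT ET] := Hn n nn0.
set T := statistic_gap _ _ _ _ _ _ _ _ _ _ _ in bT ET.
have n_gt0 : (0 < n)%N by exact: ltnW.
have [N1 [mN1 PN1 HN1]] := sample_terms (Hstar hm) hd1 mZ1 lawZ1 acX1 hsigma1 hF1 hG1 gridE1 hJ1 cf1 n_gt0.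
have [N2 [mN2 PN2 HN2]] := sample_terms (Hstar hm) hd2 mZ2 lawZ2 acX2 hsigma2 hF2 hG2 gridE2 hJ2 cf2 n_gt0.
have [mN PN] := null_union mN1 mN2 PN1 PN2.
have WT w : ~ (N1 `|` N2) w -> W_rank n w - W_oracle n w = T n w.
  move=> /not_orP[/HN1[zi1 E1] /HN2[zi2 E2]].
  rewrite /W_rank /W_oracle !sample_gscE -mulrBr -sumrB; congr (_ * _).
  apply: eq_bigr => g /ordered_injections_inj ginj.
  have [r1 o1] := E1 _ g (hFn1 n w n_gt0 zi1) ginj.
  have [r2 o2] := E2 _ g (hFn2 n w n_gt0 zi2) ginj.
  by rewrite -r1 -o1 -r2 -o2.
pose c : R := (eps * n%:R^-1) ^+ 2.
have nR : 0 < n%:R :> R by rewrite ltr0n.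
have c0 : 0 < c by rewrite exprn_gt0// mulr_gt0// invr_gt0.
have bTT := bounded_measurable_sqr bT.
have mB : measurable [set w | c <= T n w ^+ 2].
  have -> : [set w | c <= T n w ^+ 2] = (fun w => T n w ^+ 2) @^-1` `[c, +oo[.
    by apply/seteqP; split => w /=; rewrite in_itv/= andbT.
  by rewrite -[X in measurable X]setTI; exact: (proj1 bTT).
(* The event may fail to be measurable; it is covered by a null set and a measurable event for the
   canonical gap [T]. *)
apply: (@le_trans _ _ (mu_ext P ((N1 `|` N2) `|` [set w | c <= T n w ^+ 2]))).
  apply: le_mu_ext => w /= lt; have [Nw|nN] := pselect ((N1 `|` N2) w); [by left|right].
  move: lt; rewrite (WT w nN) => lt; rewrite /c -[leRHS](real_normK (num_real _)).
  by rewrite lerXn2r ?nnegrE// ?(ltW lt)// mulr_ge0 ?invr_ge0// ltW.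
rewrite measurable_mu_extE; last exact: measurableU.
apply: le_trans (measureU2 _ mN mB) _.
have fB : P [set w | c <= T n w ^+ 2] \is a fin_num by exact: fin_num_measure.
apply: (@le_trans _ _ (0 + (fine (P [set w | c <= T n w ^+ 2])%R)%:E)%E).
  apply: leeD; last by rewrite fineK.
  exact: (@eq_ind_r _ 0%E (fun x => (x <= 0)%E) (lexx _) _ PN).
rewrite add0e lee_fin.
have Mk := expect_markov P bTT (fun w => sqr_ge0 _) c0.
have n2 : n%:R <= 2 * n.-1%:R :> R by rewrite -natrM ler_nat; lia.
have I0 : 0 <= \int[P]_w T n w ^+ 2 by apply: expect_ge0 => w; exact: sqr_ge0.
rewrite -(ler_pM2l c0); apply: le_trans Mk _.
rewrite -(ler_pM2l (mulr_gt0 nR nR)).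
apply: (@le_trans _ _ (2 * (n%:R * n.-1%:R * \int[P]_w T n w ^+ 2))).
  rewrite -!mulrA [leRHS]mulrCA ler_wpM2l ?(ltW nR)// !mulrA ler_wpM2r//.
have -> : n%:R * n%:R * (c * delta) = delta * eps ^+ 2 * (n%:R / n%:R) ^+ 2 :> R.
  by rewrite /c; ring.
rewrite divff ?gt_eqF// expr1n mulr1; lra.
Unshelve. all: by end_near. Qed.
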